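(* Let $\alpha\ge1$ be a countable ordinal and let $T$ be a satisfiable $\mathsf{E}_\alpha$ sentence in the language of linear orders (all of whose models are linear orders). Then there is a countable linear order $\mathcal{B}\models T$ with a $\Pi_{\alpha+3}$ Scott sentence, and hence with Scott rank at most $\alpha+2$.
   Context: Formulas are of $\mathcal{L}_{\omega_1\omega}$ (countable conjunctions and disjunctions). $\Sigma_0=\Pi_0$ are finitary quantifier-free formulas; for $\alpha\ge1$, $\Sigma_\alpha$ formulas have the form $\bigvee_i\exists\bar x_i\psi_i$ with $\psi_i\in\Pi_\beta$ for some $\beta<\alpha$, and $\Pi_\alpha$ formulas $\bigwedge_i\forall\bar x_i\psi_i$ with $\psi_i\in\Sigma_\beta$ for some $\beta<\alpha$. The classes: $\mathsf{A}_1=\Pi_1$, $\mathsf{E}_1=\Sigma_1$; for $\alpha>1$, $\mathsf{A}_\alpha$ is the closure of $\bigcup_{\beta<\alpha}\overline{\mathsf{E}}_\beta$ under $\forall$ and countable $\bigwedge$, and $\mathsf{E}_\alpha$ is the closure of $\bigcup_{\beta<\alpha}\overline{\mathsf{A}}_\beta$ under $\exists$ and countable $\bigvee$; $\overline{\mathsf{E}}_\alpha$, $\overline{\mathsf{A}}_\alpha$ are the closures of $\mathsf{E}_\alpha$, $\mathsf{A}_\alpha$ under countable $\bigvee$ and $\bigwedge$. A Scott sentence for a countable $\mathcal{A}$ is a sentence true in exactly the countable structures isomorphic to $\mathcal{A}$; the Scott rank of $\mathcal{A}$ is the least $\gamma$ such that $\mathcal{A}$ has a $\Pi_{\gamma+1}$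 Scott sentence. *)

(* Defs.v *)
From HB Require Import structures.
From mathcomp Require Import all_boot.
From mathcomp Require Import boolp classical_sets functions cardinality.

Set Implicit Arguments.
Unset Strict Implicit.
Unset Printing Implicit Defensive.

Local Open Scope classical_set_scope.

(* [Lub f] denotes the least ordinal strictly above every [f j], as in von
   Neumann's coding of an ordinal by the set of smaller ones.  Distinct terms
   may denote the same ordinal: equality of ordinals is [oeq], not [=].  Up to
   [oeq], [olt] is a total well-founded order; each of its elements has only
   countably many predecessors, and every countable well-order is isomorphic to
   an initial segment (lemma [ord_rank]). *)
Inductive ord : Type := Lub (J : countType) (f : J -> ord).

Fixpoint ole (a b : ord) : Prop :=
  let: Lub J f := a in let: Lub K g := b in
  forall j : J, exists k : K, ole (f j) (g k).

Definition oeq (a b : ord) : Prop := ole a b /\ ole b a.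

Definition olt (a b : ord) : Prop :=
  let: Lub K g := b in exists k : K, ole a (g k).

Definition ozero : ord := @Lub void (of_void ord).
Definition osucc (a : ord) : ord := @Lub unit (fun=> a).
Definition oone : ord := osucc ozero.

Lemma ole_refl a : ole a a.
Proof. by elim: a => J f IH /= j; exists j. Qed.

Lemma ole_trans a b c : ole a b -> ole b c -> ole a c.
Proof.
elim: a b c => J f IH [K g] [L h] /= ab bc j.
have [k fg] := ab j; have [l gh] := bc k.
by exists l; apply: IH fg gh.
Qed.

Lemma ole_olt a b c : ole a b -> olt b c -> olt a c.
Proof. by case: c => L h ab [l bl]; exists l; apply: ole_trans bl. Qed.

Lemma olt_ole a b c : olt a b -> ole b c -> olt a c.
Proof.
case: b c => K g [L h] /= [k ak] bc; have [l kl] := bc k.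
by exists l; apply: ole_trans kl.
Qed.

Lemma oleP a b : ole a b <-> (forall c, olt c a -> olt c b).
Proof.
split=> [ab c ca|]; first exact: olt_ole ca ab.
case: a b => J f [K g] H /= j.
by apply: (H (f j)); exists j; apply: ole_refl.
Qed.

Lemma olt_wf : well_founded olt.
Proof.
have H a b : ole b a -> Acc olt b.
  elim: a b => J f IH b ba; constructor=> c cb.
  by have [j cj] := olt_ole cb ba; apply: IH cj.
by move=> a; apply: H (ole_refl a).
Qed.

Lemma olt_irr a : ~ olt a a.
Proof. by elim: (olt_wf a) => x _ IH xx; exact: (IH x xx xx). Qed.

Lemma oltW a b : olt a b -> ole a b.
Proof.
elim: b a => K g IH a [k ak]; apply/oleP => c ca.
by exists k; apply: IH; apply: olt_ole ca ak.
Qed.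

Lemma ole_total a b : ole a b \/ olt b a.
Proof.
elim: a b => J f IH [K g].
have [|nH] := EM (exists j, ole (Lub g) (f j)); first by right.
left=> /= j; apply: contrapT => nk; apply: nH; exists j.
apply/oleP => c [k ck]; apply: ole_olt ck _.
by have [fg|//] := IH j (g k); case: nk; exists k.
Qed.

Lemma olt_osucc a b : olt a (osucc b) <-> ole a b.
Proof. by split=> [[]|]; [|exists tt]. Qed.

Lemma ole_osucc a b : ole (osucc a) b <-> olt a b.
Proof. by case: b => K g; split=> [H|H j]; [exact: H tt|exact: H]. Qed.

Lemma ord_rank (W : countType) (R : rel W) :
    well_founded R -> (forall x y, [|| R x y, x == y | R y x]) ->
  exists rk : W -> ord,
    (forall x y, R x y <-> olt (rk x) (rk y)) /\
    (forall x a, olt a (rk x) -> exists y, oeq a (rk y)).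
Proof.
move=> wfR totR.
have [rk rkE] : exists rk : W -> ord,
    forall x, rk x = Lub (fun y : {y : W | R y x} => rk (val y)).
  exists (Fix wfR (fun=> ord)
    (fun x r => Lub (fun y : {y : W | R y x} => r (val y) (valP y)))) => x.
  rewrite Fix_eq // => {}x r s rs; congr Lub.
  by apply/funext => y; apply: rs.
have RP x y : R x y -> olt (rk x) (rk y).
  by move=> xy; rewrite (rkE y); exists (exist _ x xy); apply: ole_refl.
exists rk; split=> [x y|x a].
  split=> [|lxy]; first exact: RP.
  have /or3P[//|/eqP xy|/RP yx] := totR x y.
    by case: (@olt_irr (rk y)); rewrite xy in lxy.
  by case: (@olt_irr (rk x)); apply: olt_ole lxy (oltW yx).
elim: (wfR x) a => {}x _ IH a ax.
have := ax; rewrite rkE => -[[y yx] /= ay].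
have [ya|lay] := ole_total (rk y) a; first by exists y.
exact: IH yx a lay.
Qed.

(* [formula n] has its free variables among [n] de Bruijn indices; [Ex] and
   [All] bind index [ord0]. *)
Inductive formula : nat -> Type :=
| Eq n : 'I_n -> 'I_n -> formula n
| Lt n : 'I_n -> 'I_n -> formula n
| Not n : formula n -> formula n
| And n (J : countType) : (J -> formula n) -> formula n
| Or n (J : countType) : (J -> formula n) -> formula n
| Ex n : formula n.+1 -> formula n
| All n : formula n.+1 -> formula n.

Definition sentence := formula 0.

Fixpoint Exs (k n : nat) : formula (k + n) -> formula n :=
  if k is k'.+1 then fun phi => @Exs k' n (Ex phi) else id.

Fixpoint Alls (k n : nat) : formula (k + n) -> formula n :=
  if k is k'.+1 then fun phi => @Alls k' n (All phi) else id.

Record structure := Structure {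
  dom :> Type;
  slt : dom -> dom -> Prop;
  dom_inh : inhabited dom
}.

Definition vcons (M : Type) (n : nat) (x : M) (v : 'I_n -> M) : 'I_n.+1 -> M :=
  fun i => if unlift ord0 i is Some j then v j else x.

Fixpoint sat (M : structure) (n : nat) (phi : formula n) : ('I_n -> M) -> Prop :=
  match phi in formula n return ('I_n -> M) -> Prop with
  | Eq _ i j => fun v => v i = v j
  | Lt _ i j => fun v => slt (v i) (v j)
  | Not _ psi => fun v => ~ sat psi v
  | And _ J F => fun v => forall j : J, sat (F j) v
  | Or _ J F => fun v => exists j : J, sat (F j) v
  | Ex _ psi => fun v => exists x : M, sat psi (vcons x v)
  | All _ psi => fun v => forall x : M, sat psi (vcons x v)
  end.

Definition models (M : structure) (phi : sentence) : Prop :=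
  forall v : 'I_0 -> M, sat phi v.

Definition satisfiable (phi : sentence) : Prop :=
  exists M : structure, models M phi.

Definition linear_order (M : structure) : Prop :=
  [/\ forall x : M, ~ slt x x,
      forall x y z : M, slt x y -> slt y z -> slt x z
    & forall x y : M, [\/ slt x y, x = y | slt y x]].

Definition countable_structure (M : structure) : Prop := countable [set: M].

Definition isomorphic (M N : structure) : Prop :=
  exists2 f : M -> N, bijective f & forall x y, slt x y <-> slt (f x) (f y).

Inductive finitary_qf : forall n, formula n -> Prop :=
| qf_Eq n (i j : 'I_n) : finitary_qf (Eq i j)
| qf_Lt n (i j : 'I_n) : finitary_qf (Lt i j)
| qf_Not n (phi : formula n) : finitary_qf phi -> finitary_qf (Not phi)
| qf_And n (J : countType) (F : J -> formula n) :
    finite_set [set: J] -> (forall j, finitary_qf (F j)) -> finitary_qf (And F)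
| qf_Or n (J : countType) (F : J -> formula n) :
    finite_set [set: J] -> (forall j, finitary_qf (F j)) -> finitary_qf (Or F).

Inductive isSigma : ord -> forall n, formula n -> Prop :=
| Sigma_zero a n (phi : formula n) :
    oeq a ozero -> finitary_qf phi -> isSigma a phi
| Sigma_pos a n (J : countType) (k : J -> nat)
    (psi : forall j, formula (k j + n)) (b : J -> ord) :
    ole oone a -> (forall j, olt (b j) a) -> (forall j, isPi (b j) (psi j)) ->
    isSigma a (Or (fun j => Exs (psi j)))
with isPi : ord -> forall n, formula n -> Prop :=
| Pi_zero a n (phi : formula n) :
    oeq a ozero -> finitary_qf phi -> isPi a phi
| Pi_pos a n (J : countType) (k : J -> nat)
    (psi : forall j, formula (k j + n)) (b : J -> ord) :
    ole oone a -> (forall j, olt (b j) a) -> (forall j, isSigma (b j) (psi j)) ->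
    isPi a (And (fun j => Alls (psi j))).

(* All four classes are empty at ordinal zero, where they are not defined. *)
Inductive isA : ord -> forall n, formula n -> Prop :=
| A_one a n (phi : formula n) : oeq a oone -> isPi oone phi -> isA a phi
| A_Ebar a b n (phi : formula n) :
    ole oone b -> olt b a -> isEbar b phi -> isA a phi
| A_All a n (phi : formula n.+1) : olt oone a -> isA a phi -> isA a (All phi)
| A_And a n (J : countType) (F : J -> formula n) :
    olt oone a -> (forall j, isA a (F j)) -> isA a (And F)
with isE : ord -> forall n, formula n -> Prop :=
| E_one a n (phi : formula n) : oeq a oone -> isSigma oone phi -> isE a phi
| E_Abar a b n (phi : formula n) :
    ole oone b -> olt b a -> isAbar b phi -> isE a phi
| E_Ex a n (phi : formula n.+1) : olt oone a -> isE a phi -> isE a (Ex phi)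
| E_Or a n (J : countType) (F : J -> formula n) :
    olt oone a -> (forall j, isE a (F j)) -> isE a (Or F)
with isAbar : ord -> forall n, formula n -> Prop :=
| Abar_A a n (phi : formula n) : isA a phi -> isAbar a phi
| Abar_And a n (J : countType) (F : J -> formula n) :
    ole oone a -> (forall j, isAbar a (F j)) -> isAbar a (And F)
| Abar_Or a n (J : countType) (F : J -> formula n) :
    ole oone a -> (forall j, isAbar a (F j)) -> isAbar a (Or F)
with isEbar : ord -> forall n, formula n -> Prop :=
| Ebar_E a n (phi : formula n) : isE a phi -> isEbar a phi
| Ebar_And a n (J : countType) (F : J -> formula n) :
    ole oone a -> (forall j, isEbar a (F j)) -> isEbar a (And F)
| Ebar_Or a n (J : countType) (F : J -> formula n) :
    ole oone a -> (forall j, isEbar a (F j)) -> isEbar a (Or F).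

Definition scott_sentence (M : structure) (phi : sentence) : Prop :=
  forall N : structure,
    countable_structure N -> (models N phi <-> isomorphic N M).

Definition has_Pi_scott_sentence (a : ord) (M : structure) : Prop :=
  exists2 phi : sentence, isPi a phi & scott_sentence M phi.

Definition is_scott_rank (M : structure) (c : ord) : Prop :=
  has_Pi_scott_sentence (osucc c) M /\
  forall d, has_Pi_scott_sentence (osucc d) M -> ole c d.

(* Main.v *)
(* A countable model M satisfies T because of a finite tuple m, in the sense that for
   some beta < alpha every structure (N, n) with (M, m) <=_beta (N, n) is a model
   of T.  So it suffices to find N above (M, m) at level beta in which tuples
   related by <=_(beta+2) are related by a back-and-forth system: orbits are then
   Pi_(beta+2) definable, which gives a Pi_(beta+4) Scott sentence.

   N is generic for finite conditions that list points and promise that each gap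
   lies, at level beta, above a given member of a countable class K: the closure
   of the intervals of M under A, B |-> A + 1 + B.  The set of conditions met by
   an interval of N is maximal, so inclusion of these sets is equality.  Call an
   interval isolated if it meets a complete condition.  By mutual genericity,
   disjoint intervals that meet the same conditions are isolated; hence if v and
   w are related by <=_(beta+2), all intervals between v i and w i are isolated.
   Intervals whose subintervals are all isolated are determined up to isomorphism
   by the conditions they meet.  Finally, if (a, b) is such an interval and
   (a, oo), (b, oo) meet the same conditions, then some condition forces this, so
   that (b, oo) begins with omega copies of [a, b) and absorbs one more. *)
From HB Require Import structures.
From mathcomp Require Import all_boot all_order all_algebra.
From mathcomp Require Import boolp classical_sets functions cardinality.
From mathcomp Require Import lra.
From Stdlib Require List.
Require Import Defs.

Set Implicit Arguments.
Unset Strict Implicit.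
Unset Printing Implicit Defensive.
Import Order.TTheory GRing.Theory Num.Theory.

(** Finite conditions can promise only lower bounds for gaps; hence N is placed above (M, m) and not
    made equivalent to it. The two levels above beta have separate uses. A condition met by I is
    read off a splitting of I. If J <=_(beta+1) I, one back-and-forth step carries this splitting to
    J, so J meets all that I meets. The other level pays for a step made earlier: an interval
    between v i and w i is itself played, and its answer lies on the far side of the point.

    The obstacle is that intervals that meet the same conditions need not be isomorphic. If a gap of
    v has a nonisolated subinterval, its ends are moved from v to w one at a time. Each move crosses
    a hereditarily isolated interval. The omega copies of that interval cannot reach the other end
    of the gap, since the gap would then be hereditarily isolated too, so the gap absorbs the move.

    Orders are compared only through the ways in which their intervals can be cut. Sums A + 1 + B
    can therefore stay formal, and an order and its reverse are treated alike. *)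

Notation Forall2 := List.Forall2.

Lemma olt_Lub (J : countType) (f : J -> ord) j : olt (f j) (Lub f).
Proof. by exists j; exact: ole_refl. Qed.

(** * Lists related termwise *)

Lemma forall2_single (T U : Type) (R : T -> U -> Prop) x t :
  Forall2 R [:: x] t -> exists2 y, t = [:: y] & R x y.
Proof. by move=> H; inversion H as [|? y ? t' xy H']; inversion H'; exists y. Qed.

Lemma forall2_cons (T U : Type) (R : T -> U -> Prop) x s t :
  Forall2 R (x :: s) t -> exists y t', [/\ t = y :: t', R x y & Forall2 R s t'].
Proof. by move=> H; inversion H as [|? y ? t' xy H']; exists y, t'. Qed.

Lemma forall2_cat (T U : Type) (R : T -> U -> Prop) s1 s2 t :
  Forall2 R (s1 ++ s2) t ->
  exists t1 t2, [/\ t = t1 ++ t2, Forall2 R s1 t1 & Forall2 R s2 t2].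
Proof.
by move=> /List.Forall2_app_inv_l[t1 [t2 [? [? ->]]]]; exists t1, t2.
Qed.

(** * Interval systems *)

(* [sp I A B] says that some point of the interval [I] has [A] to its left and
   [B] to its right. *)
Record isys := ISys {
  ival :> Type;
  sp : ival -> ival -> ival -> Prop;
  sp_assoc : forall I A B C D, sp I A B -> sp B C D ->
    exists2 E, sp I E D & sp E A C;
  sp_assoc' : forall I E D A C, sp I E D -> sp E A C ->
    exists2 B, sp I A B & sp B C D;
  sp_cmp : forall I A B A' B', sp I A B -> sp I A' B' ->
    [\/ A = A' /\ B = B', exists2 C, sp A' A C & sp B C B'
      | exists2 C, sp A A' C & sp B' C B]
}.
Arguments sp {_}.

(** Splittings by finitely many points into consecutive pieces; [[:: I]] is the splitting by no
    point. *)
Inductive spn (X : isys) : X -> seq X -> Prop :=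
| spn1 I : spn I [:: I]
| spnS I A B w : sp I A B -> spn B w -> spn I (A :: w).

Section Splittings.
Variable X : isys.
Implicit Types (I A B C D : X) (u v w : seq X).

Lemma spn_neq0 I w : spn I w -> w <> [::].
Proof. by case. Qed.

Lemma spn_cons I A w : spn I (A :: w) ->
  (w = [::] /\ A = I) \/ (exists2 B, sp I A B & spn B w).
Proof. by move=> H; inversion H as [|? ? B ? ? ?]; subst; [left|right; exists B]. Qed.

Lemma spn_single I A : spn I [:: A] -> A = I.
Proof. by case/spn_cons => [[]//|[B _ /spn_neq0]]. Qed.

Lemma spn_cat I A B u v : sp I A B -> spn A u -> spn B v -> spn I (u ++ v).
Proof.
move=> + Au; elim: Au I B => {A u} [A|A A1 A2 u A12 _ IH] I B IAB Bv.
  exact: spnS IAB Bv.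
have [E IE EA2] := sp_assoc' IAB A12.
by apply: spnS IE _; apply: IH EA2 Bv.
Qed.

Lemma spn_cut I A B w : sp I A B -> spn I w ->
  (exists u v, [/\ w = u ++ v, spn A u & spn B v]) \/
  (exists u d v c c', [/\ w = u ++ d :: v, sp d c c',
                           spn A (u ++ [:: c]) & spn B (c' :: v)]).
Proof.
move=> + Iw; elim: Iw A B => {I w} [I|I A0 B0 w I0 B0w IH] A B IAB.
  by right; exists [::], I, [::], A, B; split=> //; apply: spn1.
case: (sp_cmp IAB I0) => [[-> ->]|[C AC BC]|[C AC BC]].
- by left; exists [:: A0], w; split=> //; apply: spn1.
- right; exists [::], A0, w, A, C; split=> //; first exact: spn1.
  exact: spnS BC B0w.
case: (IH _ _ BC) => [[u [v [-> Cu Bv]]]|[u [d [v [c [c' [-> dc Cu Bv]]]]]]].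
  by left; exists (A0 :: u), v; split=> //; apply: spnS AC Cu.
by right; exists (A0 :: u), d, v, c, c'; split=> //; apply: spnS AC Cu.
Qed.

(** Forgetting the point between [A] and [B] fuses the last piece of [A] with the first piece of
    [B]. This undoes the second case of [spn_cut]. *)
Lemma spn_merge I A B u c c' v : sp I A B -> spn A (u ++ [:: c]) ->
  spn B (c' :: v) -> exists2 d, sp d c c' & spn I (u ++ d :: v).
Proof.
elim: u I A => [|a u IH] I A IAB.
  move=> /= /spn_single cA; subst c; case/spn_cons => [[-> cB]|[B' Bc B'v]].
    by exists I; [rewrite cB|apply: spn1].
  have [E IE Ec] := sp_assoc IAB Bc.
  by exists E => //; apply: spnS IE B'v.
move=> /= /spn_cons[[/(congr1 size)]|[A' Aa A'u] Bv].
  by rewrite size_cat addn1.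
have [E IE EA'] := sp_assoc' IAB Aa.
have [d dc Ed] := IH _ _ EA' A'u Bv.
by exists d => //; apply: spnS IE Ed.
Qed.

Lemma spn_flatten I w ws : spn I w -> Forall2 (@spn X) w ws -> spn I (flatten ws).
Proof.
move=> Iw; elim: Iw ws => {I w} [I|I A B w IAB _ IH] ws.
  by move=> H; have [r -> Ir] := forall2_single H; rewrite /= cats0.
move=> H; have [r [ws' [-> Ar /IH Bw]]] := forall2_cons H.
exact: spn_cat IAB Ar Bw.
Qed.

Lemma spn_singles w : Forall2 (@spn X) w [seq [:: x] | x <- w].
Proof. by elim: w => [|x w IH] /=; constructor=> //; apply: spn1. Qed.

Lemma flatten_singles (T : Type) (w : seq T) : flatten [seq [:: x] | x <- w] = w.
Proof. by elim: w => //= x w ->. Qed.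

Lemma spn_common I w w' : spn I w -> spn I w' ->
  exists ws ws', [/\ Forall2 (@spn X) w ws, Forall2 (@spn X) w' ws'
                   & flatten ws = flatten ws'].
Proof.
move=> Iw; elim: Iw w' => {I w} [I|I A B w IAB _ IH] w' Iw'.
  exists [:: w'], [seq [:: x] | x <- w']; split; last 1 first.
  - by rewrite flatten_singles /= cats0.
  - by constructor.
  exact: spn_singles.
case: (spn_cut IAB Iw') => [[u [v [-> Au Bv]]]|[u [d [v [c [c' [-> dc Au Bv]]]]]]].
  have [ws [vs [Hw Hv E]]] := IH _ Bv.
  exists (u :: ws), ([seq [:: x] | x <- u] ++ vs); split.
  - by constructor.
  - by apply: List.Forall2_app Hv; apply: spn_singles.
  by rewrite flatten_cat flatten_singles /= E.
have [ws [rvs [Hw Hrvs]]] := IH _ Bv.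
have [r [vs [-> c'r Hv]]] := forall2_cons Hrvs; move=> /= E.
exists ((u ++ [:: c]) :: ws), ([seq [:: x] | x <- u] ++ (c :: r) :: vs); split.
- by constructor.
- apply: List.Forall2_app; first exact: spn_singles.
  by constructor=> //; apply: spnS dc c'r.
by rewrite flatten_cat flatten_singles /= E -catA.
Qed.

End Splittings.

(* The asymmetric back-and-forth relation, restricted to intervals. *)
Fixpoint ile (a : ord) (X Y : isys) (I : X) (I' : Y) : Prop :=
  let: Lub J f := a in
  forall (j : J) w', spn I' w' -> exists2 w, spn I w & Forall2 (@ile (f j) Y X) w' w.
Arguments ile a {X Y}.

Lemma ile_mono a b (X Y : isys) (I : X) (I' : Y) : ole a b -> ile b I I' -> ile a I I'.
Proof.
elim: a b X Y I I' => J f IH [K g] X Y I I' /= ab H j w' I'w'.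
have [k fg] := ab j; have [w Iw ww'] := H k w' I'w'.
by exists w => //; apply: List.Forall2_impl ww' => x y; apply: IH fg.
Qed.

Lemma ile_trans a (X Y Z : isys) (I : X) (J : Y) (K : Z) :
  ile a I J -> ile a J K -> ile a I K.
Proof.
elim: a X Y Z I J K => T f IH X Y Z I J K /= IJ JK j w Kw.
have [v Jv wv] := JK j w Kw; have [u Iu vu] := IJ j v Jv.
exists u => //; elim: wv {Kw Jv Iu} u vu => [|x y s t xy _ IHs] u.
  by move=> H; inversion H; constructor.
move=> H; have [z [u' [-> yz /IHs su]]] := forall2_cons H.
by constructor=> //; apply: IH xy yz.
Qed.

(** Splitting [J] by no point at all is already a challenge, and its answer is the reverse relation
    one level down. *)
Lemma ile_flip a b (X Y : isys) (I : X) (J : Y) : olt a b -> ile b I J -> ile a J I.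
Proof.
case: b => K g /= [k agk] H.
have [w Iw Jw] := H k _ (spn1 J); have [y wy JI] := forall2_single Jw.
by move: Iw JI; rewrite wy => /spn_single -> /(ile_mono agk).
Qed.

(** A challenge to [I'] induces challenges to [A'] and [B']. If a piece straddles the point between
    them, its two halves are answered separately, and the induction hypothesis, with the two systems
    exchanged, adds the answers up. *)
Lemma ile_sp a (X Y : isys) (I A B : X) (I' A' B' : Y) :
  sp I A B -> sp I' A' B' -> ile a A A' -> ile a B B' -> ile a I I'.
Proof.
elim: a X Y I A B I' A' B' => T f IH X Y I A B I' A' B' IAB IAB' /= HA HB j w' Iw'.
case: (spn_cut IAB' Iw') => [[u' [v' [-> Au' Bv']]]|].
  have [u Au uu'] := HA j _ Au'; have [v Bv vv'] := HB j _ Bv'.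
  by exists (u ++ v); [apply: spn_cat IAB Au Bv|apply: List.Forall2_app].
move=> [u' [d' [v' [c1' [c2' [-> dc' Au' Bv']]]]]].
have [uc Auc Huc] := HA j _ Au'.
have [u [r [ucE uu' Hr]]] := forall2_cat Huc.
have [c1 rE cc1] := forall2_single Hr.
have [cv Bcv Hcv] := HB j _ Bv'; have [c2 [v [cvE cc2 vv']]] := forall2_cons Hcv.
move: Auc Bcv; rewrite {}ucE {}rE {}cvE => Auc Bcv.
have [d dc Id] := spn_merge IAB Auc Bcv.
exists (u ++ d :: v) => //; apply: List.Forall2_app => //; constructor=> //.
exact: IH dc' dc cc1 cc2.
Qed.

Lemma ile_spn a (X Y : isys) (I : X) (I' : Y) w w' :
  spn I w -> spn I' w' -> Forall2 (ile a) w w' -> ile a I I'.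
Proof.
move=> Iw; elim: Iw I' w' => {I w} [I|I A B w IAB Bw IH] I' w'.
  by move=> Iw' H; have [y wE] := forall2_single H; move: Iw'; rewrite wE => /spn_single ->.
move=> + H; have [A' [v' [-> AA' vv']]] := forall2_cons H; case/spn_cons => [[v'0 _]|[B' I'B B'v]].
  by case: (spn_neq0 Bw); rewrite v'0 in vv'; inversion vv'.
exact: ile_sp IAB I'B AA' (IH _ _ B'v vv').
Qed.

(** * Bisimilar intervals *)

Definition bisim (X Y : isys) (R : X -> Y -> Prop) := forall I J, R I J ->
  (forall A B, sp I A B -> exists A' B', [/\ sp J A' B', R A A' & R B B']) /\
  (forall A' B', sp J A' B' -> exists A B, [/\ sp I A B, R A A' & R B B']).

(** The greatest bisimulation. Between intervals of countable linear orders it amounts to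
    isomorphism. *)
Definition beq (X Y : isys) (I : X) (J : Y) := exists2 R, bisim R & R I J.

Lemma beq_bisim (X Y : isys) : bisim (@beq X Y).
Proof.
move=> I J [R bR IJ]; have [HI HJ] := bR _ _ IJ; split=> A B.
  by move=> /HI[A' [B' [H RA RB]]]; exists A', B'; split=> //; exists R.
by move=> /HJ[A' [B' [H RA RB]]]; exists A', B'; split=> //; exists R.
Qed.

Lemma beq_refl (X : isys) (I : X) : beq I I.
Proof. by exists eq => // A _ <-; split=> B C H; exists B, C. Qed.

Lemma beq_sym (X Y : isys) (I : X) (J : Y) : beq I J -> beq J I.
Proof.
move=> [R bR IJ]; exists (fun x y => R y x) => // A B /bR[H1 H2].
split=> C D.
  by move=> /H2[C' [D' []]]; exists C', D'.
by move=> /H1[C' [D' []]]; exists C', D'.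
Qed.

Lemma beq_trans (X Y Z : isys) (I : X) (J : Y) (K : Z) :
  beq I J -> beq J K -> beq I K.
Proof.
move=> IJ JK; exists (fun x z => exists2 y : Y, beq x y & beq y z); last by exists J.
move=> {IJ JK} {}I {}K [{}J /beq_bisim[IJ JI] /beq_bisim[JK KJ]]; split=> A B.
  move=> /IJ[A' [B' [/JK[A2 [B2 [K2 ? ?]]] ? ?]]].
  by exists A2, B2; split=> //; [exists A'|exists B'].
move=> /KJ[A' [B' [/JI[A2 [B2 [K2 ? ?]]] ? ?]]].
by exists A2, B2; split=> //; [exists A'|exists B'].
Qed.

Lemma bisim_spn (X Y : isys) (R : X -> Y -> Prop) I J w : bisim R -> R I J ->
  spn I w -> exists2 w', spn J w' & Forall2 R w w'.
Proof.
move=> bR + Iw; elim: Iw J => {I w} [I|I A B w IAB _ IH] J IJ.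
  by exists [:: J]; constructor.
have [/(_ _ _ IAB)[A' [B' [JA' AA' /IH[w' B'w' ww']]]] _] := bR _ _ IJ.
by exists (A' :: w'); [apply: spnS JA' B'w'|constructor].
Qed.

Lemma beq_ile a (X Y : isys) (I : X) (J : Y) : beq I J -> ile a I J.
Proof.
elim: a X Y I J => T f IH X Y I J /= /beq_sym IJ j w' Jw'.
have [w Iw ww'] := bisim_spn (@beq_bisim _ _) IJ Jw'.
by exists w => //; apply: List.Forall2_impl ww' => x y; apply: IH.
Qed.

Lemma ile_refl a (X : isys) (I : X) : ile a I I.
Proof. by apply: beq_ile; apply: beq_refl. Qed.

(** Being [beq], or being sums of [beq] parts, is a bisimulation: a cut inside one summand leaves a
    piece of it on one side and a sum on the other. By symmetry one direction is enough, provided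
    that it is proved for all pairs of systems. *)
Lemma beq_sp (X Y : isys) (I A B : X) (I' A' B' : Y) :
  sp I A B -> sp I' A' B' -> beq A A' -> beq B B' -> beq I I'.
Proof.
pose S (R : forall X Y : isys, X -> Y -> Prop) (X Y : isys) (I : X) (I' : Y) :=
  beq I I' \/ exists A B A' B', [/\ sp I A B, sp I' A' B', beq A A' & beq B B'].
pose R := @S (fun _ _ _ _ => True).
have Rsym (X' Y' : isys) (x : X') (y : Y') : R X' Y' x y -> R Y' X' y x.
  case=> [/beq_sym|[a [b [c [d [? ? /beq_sym ? /beq_sym ?]]]]]]; first by left.
  by right; exists c, d, a, b.
have half (X' Y' : isys) (x a b : X') (y : Y') : R X' Y' x y -> sp x a b ->
    exists a' b', [/\ sp y a' b', R _ _ a a' & R _ _ b b'].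
  move=> + xab; case=> [/beq_bisim[/(_ _ _ xab)[a' [b' [? ? ?]]] _]|].
    by exists a', b'; split=> //; left.
  move=> [c [d [c' [d' [xcd ycd cc' dd']]]]].
  case: (sp_cmp xab xcd) => [[-> ->]|[e ce be]|[e ae de]].
  - by exists c', d'; split=> //; left.
  - have [/(_ _ _ ce)[a' [e' [c'ae aa' ee']]] _] := beq_bisim cc'.
    have [b' yab b'ed] := sp_assoc' ycd c'ae.
    by exists a', b'; split=> //; [left|right; exists e, d, e', d'].
  have [/(_ _ _ de)[e' [b' [d'eb ee' bb']]] _] := beq_bisim dd'.
  have [a' yab a'ce] := sp_assoc ycd d'eb.
  by exists a', b'; split=> //; [right; exists c, e, c', e'|left].
move=> IAB IAB' AA' BB'; exists (R X Y); last by right; exists A, B, A', B'.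
move=> x y xy; split=> a b; first exact: half xy.
move=> /(half _ _ _ _ _ _ (Rsym _ _ _ _ xy))[a' [b' [? ? ?]]].
by exists a', b'; split=> //; apply: Rsym.
Qed.

(** * Formulas *)

Definition extends (T : Type) k n (u : 'I_(k + n) -> T) (v : 'I_n -> T) :=
  forall i, u (rshift k i) = v i.

Definition qfa (M N : structure) n (v : 'I_n -> M) (w : 'I_n -> N) := forall i j,
  (v i = v j <-> w i = w j) /\ (slt (v i) (v j) <-> slt (w i) (w j)).

(* [bf a v w]: every [Pi_a] formula true of [v] is true of [w]. *)
Fixpoint bf (a : ord) (M N : structure) n (v : 'I_n -> M) (w : 'I_n -> N) : Prop :=
  let: Lub J f := a in
  qfa v w /\ forall (j : J) k (w' : 'I_(k + n) -> N), extends w' w ->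
    exists2 v' : 'I_(k + n) -> M, extends v' v & bf (f j) w' v'.

Section Valuations.
Variable T : Type.

Lemma vcons0 n (x : T) (v : 'I_n -> T) : vcons x v ord0 = x.
Proof. by rewrite /vcons unlift_none. Qed.

Lemma vconsS n (x : T) (v : 'I_n -> T) i : vcons x v (lift ord0 i) = v i.
Proof. by rewrite /vcons liftK. Qed.

Lemma vcons_eta n (u : 'I_n.+1 -> T) : vcons (u ord0) (fun i => u (lift ord0 i)) = u.
Proof. by apply/funext => i; rewrite /vcons; case: unliftP => [j ->|->]. Qed.

Lemma extends0 n (u v : 'I_n -> T) : @extends T 0 n u v -> u = v.
Proof.
by move=> uv; apply/funext => i; rewrite -uv; congr u; apply: val_inj.
Qed.

Lemma extends_refl n (v : 'I_n -> T) : @extends T 0 n v v.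
Proof. by move=> i; congr v; apply: val_inj. Qed.

Definition vapp k n (u : 'I_k -> T) (v : 'I_n -> T) (i : 'I_(k + n)) : T :=
  match fintype.split i with inl j => u j | inr j => v j end.

Lemma vappl k n (u : 'I_k -> T) (v : 'I_n -> T) i : vapp u v (lshift n i) = u i.
Proof. by rewrite /vapp (unsplitK (inl i)). Qed.

Lemma vappr k n (u : 'I_k -> T) (v : 'I_n -> T) : extends (vapp u v) v.
Proof. by move=> i; rewrite /vapp (unsplitK (inr i)). Qed.

Lemma extends_vcons n x (v : 'I_n -> T) : @extends T 1 n (vcons x v) v.
Proof.
by move=> i; rewrite (_ : rshift 1 i = lift ord0 i) ?vconsS//; apply: val_inj.
Qed.

Lemma extendsP n (u : 'I_(1 + n) -> T) (v : 'I_n -> T) :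
  extends u v -> exists x, u = vcons x v.
Proof.
move=> uv; exists (u ord0); rewrite -[LHS]vcons_eta; congr vcons.
by apply/funext => i; rewrite -uv; congr u; apply: val_inj.
Qed.

Lemma extendsS k n (u : 'I_(k.+1 + n) -> T) (v : 'I_n -> T) :
  extends u v <-> exists x (u' : 'I_(k + n) -> T), u = vcons x u' /\ extends u' v.
Proof.
have E (i : 'I_n) : rshift k.+1 i = lift ord0 (rshift k i) by apply: val_inj.
split=> [uv|[x [u' [-> u'v]]] i]; last by rewrite E vconsS.
exists (u ord0), (fun i => u (lift ord0 i)); split; first by rewrite vcons_eta.
by move=> i; rewrite -E uv.
Qed.

End Valuations.

Lemma sat_Exs (M : structure) k n (psi : formula (k + n)) (v : 'I_n -> M) :
  sat (Exs psi) v <-> exists2 u, extends u v & sat psi u.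
Proof.
elim: k psi => [|k IH] psi /=.
  split=> [H|[u /extends0 ->]//]; exists v => //; exact: extends_refl.
rewrite IH; split=> [[u uv [x H]]|[u /extendsS[x [u' [-> u'v]]] H]].
  by exists (vcons x u) => //; apply/extendsS; exists x, u.
by exists u' => //; exists x.
Qed.

Lemma sat_Alls (M : structure) k n (psi : formula (k + n)) (v : 'I_n -> M) :
  sat (Alls psi) v <-> forall u, extends u v -> sat psi u.
Proof.
elim: k psi => [|k IH] psi /=.
  by split=> [H u /extends0 ->//|]; apply; exact: extends_refl.
rewrite IH; split=> [H u /extendsS[x [u' [-> u'v]]]|H u uv x]; first exact: H.
by apply: H; apply/extendsS; exists x, u.
Qed.

Lemma sat_qf n (phi : formula n) : finitary_qf phi ->
  forall (M N : structure) (v : 'I_n -> M) (w : 'I_n -> N),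
  qfa v w -> (sat phi v <-> sat phi w).
Proof.
elim=> {n phi} [n i j|n i j|n phi _ IH|n J F _ _ IH|n J F _ _ IH] M N v w vw /=.
- exact: (vw i j).1.
- exact: (vw i j).2.
- by rewrite (IH _ _ _ _ vw).
- by split=> H j; apply/(IH j _ _ _ _ vw).
- by split=> -[j H]; exists j; apply/(IH j _ _ _ _ vw).
Qed.

Lemma sat_iso (M N : structure) (f : M -> N) n (phi : formula n) (v : 'I_n -> M) :
  bijective f -> (forall x y, slt x y <-> slt (f x) (f y)) ->
  (sat phi v <-> sat phi (fun i => f (v i))).
Proof.
move=> bijf hf; have [g fK gK] := bijf.
have E m x (u : 'I_m -> M) : (fun i => f (vcons x u i)) = vcons (f x) (fun i => f (u i)).
  by apply/funext => i; rewrite /vcons; case: unlift.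
elim: phi v => {n} [n i j|n i j|n phi IH|n J F IH|n J F IH|n phi IH|n phi IH] v /=.
- by split=> [->//|/(bij_inj bijf)].
- exact: hf.
- by rewrite IH.
- by split=> H j; apply/IH.
- by split=> -[j H]; exists j; apply/IH.
- split=> [[x /IH H]|[y H]]; first by exists (f x); rewrite -E.
  by exists (g y); apply/IH; rewrite E gK.
- split=> [H y|H x]; last by apply/IH; rewrite E.
  by rewrite -(gK y) -E; apply/IH.
Qed.

(** * Back-and-forth relations and preservation *)

Lemma bf_qfa a (M N : structure) n (v : 'I_n -> M) (w : 'I_n -> N) : bf a v w -> qfa v w.
Proof. by case: a => J f []. Qed.

Lemma bf_mono a b (M N : structure) n (v : 'I_n -> M) (w : 'I_n -> N) :
  ole a b -> bf b v w -> bf a v w.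
Proof.
elim: a b M N n v w => J f IH [K g] M N n v w /= ab [vw H]; split=> // j k w' ww'.
have [i fg] := ab j; have [v' vv' H'] := H i k w' ww'.
by exists v' => //; apply: IH fg H'.
Qed.

Lemma bf_step a b (M N : structure) n (v : 'I_n -> M) (w : 'I_n -> N) k
    (w' : 'I_(k + n) -> N) : olt b a -> bf a v w -> extends w' w ->
  exists2 v' : 'I_(k + n) -> M, extends v' v & bf b w' v'.
Proof.
case: a => J f /= [j bj] [_ H] ww'; have [v' vv' H'] := H j k w' ww'.
by exists v' => //; apply: bf_mono bj H'.
Qed.

Lemma qfa_comp (M N : structure) m n (e : 'I_m -> 'I_n) (v : 'I_n -> M) (w : 'I_n -> N) :
  qfa v w -> qfa (fun i => v (e i)) (fun i => w (e i)).
Proof. by move=> vw i j; apply: vw. Qed.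

Lemma bf_comp a (M N : structure) m n (e : 'I_m -> 'I_n) (v : 'I_n -> M) (w : 'I_n -> N) :
  bf a v w -> bf a (fun i => v (e i)) (fun i => w (e i)).
Proof.
elim: a M N m n e v w => J f IH M N m n e v w /= [vw H]; split.
  exact: qfa_comp vw.
move=> j k w' ww'.
(* The challenge to the selected coordinates is put to the whole tuple [w]; [e2] selects the
   relevant part of the answer. *)
pose w2 := vapp (fun i => w' (lshift m i)) w.
have w2w : extends w2 w by exact: vappr.
have [v2 v2v H2] := H j k w2 w2w.
pose e2 := vapp (fun i => lshift n i) (fun i => rshift k (e i)).
have Ew : (fun i => w2 (e2 i)) = w'.
  apply/funext => i; rewrite -[i in RHS]splitK /e2 /vapp; case: (fintype.split i) => i1 /=.
    by rewrite /w2 vappl.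
  by rewrite /w2 vappr -ww'.
exists (fun i => v2 (e2 i)); last by rewrite -Ew; apply: IH.
by move=> i; rewrite /e2 vappr v2v.
Qed.

Definition witnessed (a : ord) (M : structure) n (v : 'I_n -> M)
    (P : forall N : structure, ('I_n -> N) -> Prop) :=
  exists b k (u : 'I_k -> M) (e : 'I_n -> 'I_k),
    [/\ olt b a, forall i, v i = u (e i) &
        forall (N : structure) (u' : 'I_k -> N), bf b u u' -> P N (fun i => u' (e i))].

(** The challenge is [u] put in front of [w]. The equalities between entries of [w] and of [u]
    belong to the quantifier-free type, so the answer satisfies them for [v]. *)
Lemma witnessed_bf a (M N : structure) n (v : 'I_n -> M) (w : 'I_n -> N)
    (P : forall N : structure, ('I_n -> N) -> Prop) :
  bf a v w -> witnessed a w P -> P M v.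
Proof.
move=> vw [b [k [u [e [ba uE H]]]]].
pose w' := vapp u w; have ww' : extends w' w by exact: vappr.
have [v' vv' H'] := bf_step ba vw ww'.
have := bf_comp (@lshift k n) H'.
rewrite (_ : (fun i => w' _) = u); last first.
  by apply/funext => i; rewrite /w' vappl.
move=> /H; rewrite (_ : (fun i => v' _) = v)//.
apply/funext => i; rewrite -vv'; apply/(bf_qfa H' _ _).1.
by rewrite /w' vappl vappr uE.
Qed.

Lemma olt_one_zero a : olt a oone -> oeq a ozero.
Proof. by move=> /olt_osucc a0; split=> //; case: (a) a0 => J f H []. Qed.

Lemma one_not_zero a : ole oone a -> ~ oeq a ozero.
Proof.
move=> a1 [a0 _]; apply: (@olt_irr a); apply: olt_ole a1.
by apply/olt_osucc.
Qed.

Lemma isSigmaP a n (phi : formula n) : isSigma a phi ->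
  (oeq a ozero /\ finitary_qf phi) \/
  (ole oone a /\ exists (J : countType) (k : J -> nat)
    (psi : forall j, formula (k j + n)) (b : J -> ord),
    [/\ forall j, olt (b j) a, forall j, isPi (b j) (psi j) &
      forall (M : structure) (v : 'I_n -> M),
        sat phi v <-> exists j, exists2 u, extends u v & sat (psi j) u]).
Proof.
case=> {a n phi} [a n phi0 a0 qf|a n J k psi b a1 ba H]; first by left.
right; split=> //; exists J, k, psi, b; split=> // M v /=.
by split=> -[j Hj]; exists j; apply/sat_Exs.
Qed.

Lemma isPiP a n (phi : formula n) : isPi a phi ->
  (oeq a ozero /\ finitary_qf phi) \/
  (ole oone a /\ exists (J : countType) (k : J -> nat)
    (psi : forall j, formula (k j + n)) (b : J -> ord),
    [/\ forall j, olt (b j) a, forall j, isSigma (b j) (psi j) &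
      forall (M : structure) (v : 'I_n -> M),
        sat phi v <-> forall j u, extends u v -> sat (psi j) u]).
Proof.
case=> {a n phi} [a n phi0 a0 qf|a n J k psi b a1 ba H]; first by left.
right; split=> //; exists J, k, psi, b; split=> // M v /=.
split=> Hj j; last exact/sat_Alls/Hj.
by have /sat_Alls := Hj j.
Qed.

Lemma isSigma_lt1 a n (phi : formula n) : olt a oone -> isSigma a phi -> finitary_qf phi.
Proof.
by move=> /olt_one_zero a0 /isSigmaP[[]|[/one_not_zero]].
Qed.

Lemma isPi_lt1 a n (phi : formula n) : olt a oone -> isPi a phi -> finitary_qf phi.
Proof.
by move=> /olt_one_zero a0 /isPiP[[]|[/one_not_zero]].
Qed.

Scheme isA_mut := Induction for isA Sort Prop
with isE_mut := Induction for isE Sort Prop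
with isAbar_mut := Induction for isAbar Sort Prop
with isEbar_mut := Induction for isEbar Sort Prop.
Combined Scheme classes_ind from isA_mut, isE_mut, isAbar_mut, isEbar_mut.

(** A true E formula, or a false A formula, of level [a] is settled by a tuple and a strictly lower
    level. The closures under both connectives lose this: their formulas are only preserved along
    [bf] at level [a] itself. Such preservation is exactly what a witness for a higher class asks
    for. At level one the quantifier-free matrix is what is preserved. *)
Lemma classes_witnessed :
  (forall a n (phi : formula n), isA a phi -> forall (N : structure) (w : 'I_n -> N),
    ~ sat phi w -> witnessed a w (fun M v => ~ @sat M _ phi v)) /\
  (forall a n (phi : formula n), isE a phi -> forall (N : structure) (w : 'I_n -> N),
    sat phi w -> witnessed a w (fun M v => @sat M _ phi v)) /\
  (forall a n (phi : formula n), isAbar a phi ->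
    forall (M N : structure) (v : 'I_n -> M) (w : 'I_n -> N),
    bf a v w -> sat phi v -> sat phi w) /\
  (forall a n (phi : formula n), isEbar a phi ->
    forall (M N : structure) (v : 'I_n -> M) (w : 'I_n -> N),
    bf a v w -> sat phi w -> sat phi v).
Proof.
apply: classes_ind.
- move=> a n phi [a1 a1'] piphi N w Hw.
  have [[oz _]|[_ [J [k [psi [b [b1 sb H]]]]]]] := isPiP piphi.
    by case: (one_not_zero (ole_refl _) oz).
  have [j Hj] : exists j, ~ forall u, extends u w -> sat (psi j) u.
    by apply/existsNP => Hj; apply: Hw; apply/H.
  have [u Hu] := (existsNP _).2 Hj; have [uw nu] := (not_implyP _ _).1 Hu.
  exists (b j), (k j + n), u, (@rshift (k j) n); split=> // [|M u' /bf_qfa uu'].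
    exact: olt_ole (b1 j) _.
  move=> /H/(_ j u' (fun _ => erefl)) Hu'; apply: nu.
  by apply/(sat_qf (isSigma_lt1 (b1 j) (sb j)) uu').
- move=> a b n phi _ ba _ IH N w Hw; exists b, n, w, id; split=> // M u' /IH.
  by move=> H /H.
- move=> a n phi _ _ IH N w /= /existsNP[x /IH[b [k [u [e [ba uE H]]]]]].
  exists b, k, u, (fun i => e (lift ord0 i)); split=> // [i|M u' /H Hu' /(_ (u' (e ord0)))].
    by rewrite -uE vconsS.
  by rewrite (@vcons_eta _ _ (fun i => u' (e i))).
- move=> a n J F _ _ IH N w /= /existsNP[j /IH[b [k [u [e [ba uE H]]]]]].
  by exists b, k, u, e; split=> // M u' /H Hu' /(_ j).
- move=> a n phi [a1 a1'] sphi N w Hw.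
  have [[oz _]|[_ [J [k [psi [b [b1 sb H]]]]]]] := isSigmaP sphi.
    by case: (one_not_zero (ole_refl _) oz).
  have /H[j [u uw Hu]] := Hw.
  exists (b j), (k j + n), u, (@rshift (k j) n); split=> // [|M u' /bf_qfa uu'].
    exact: olt_ole (b1 j) _.
  apply/H; exists j, u' => //.
  by apply/(sat_qf (isPi_lt1 (b1 j) (sb j)) uu').
- move=> a b n phi _ ba _ IH N w Hw; exists b, n, w, id; split=> // M u' /IH.
  exact.
- move=> a n phi _ _ IH N w /= [x /IH[b [k [u [e [ba uE H]]]]]].
  exists b, k, u, (fun i => e (lift ord0 i)); split=> // [i|M u' /H Hu'].
    by rewrite -uE vconsS.
  by exists (u' (e ord0)); rewrite (@vcons_eta _ _ (fun i => u' (e i))).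
- move=> a n J F _ _ IH N w /= [j /IH[b [k [u [e [ba uE H]]]]]].
  by exists b, k, u, e; split=> // M u' /H Hu'; exists j.
- move=> a n phi _ IH M N v w vw Hv; apply: contrapT => /IH.
  by move=> /(witnessed_bf vw).
- by move=> a n J F _ _ IH M N v w vw /= H j; apply: IH vw _.
- by move=> a n J F _ _ IH M N v w vw /= [j H]; exists j; apply: IH vw _.
- by move=> a n phi _ IH M N v w vw /IH; apply: witnessed_bf vw.
- by move=> a n J F _ _ IH M N v w vw /= H j; apply: IH vw _.
- by move=> a n J F _ _ IH M N v w vw /= [j H]; exists j; apply: IH vw _.
Qed.

(** * Separating formulas and Scott sentences *)

Definition isS a n (P : forall M : structure, ('I_n -> M) -> Prop) :=
  exists2 phi : formula n, isSigma a phi & forall M v, @sat M n phi v <-> P M v.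

Definition isP a n (P : forall M : structure, ('I_n -> M) -> Prop) :=
  exists2 phi : formula n, isPi a phi & forall M v, @sat M n phi v <-> P M v.

Lemma isS_intro a n (J : countType) (k : J -> nat) (b : J -> ord)
    (Q : forall j (M : structure), ('I_(k j + n) -> M) -> Prop) :
  ole oone a -> (forall j, olt (b j) a) -> (forall j, isP (b j) (@Q j)) ->
  isS a (fun M v => exists j, exists2 u, extends u v & Q j M u).
Proof.
move=> a1 ba H; pose psi j := s2val (cid2 (H j)).
exists (Or (fun j => Exs (psi j))).
  by apply: (Sigma_pos (b := b)) => // j; apply: (s2valP (cid2 (H j))).
move=> M v /=; split=> -[j].
  by move=> /sat_Exs[u uv /(s2valP' (cid2 (H j))) Qu]; exists j, u.
by move=> [u uv Qu]; exists j; apply/sat_Exs; exists u => //; apply/(s2valP' (cid2 (H j))).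
Qed.

Lemma isP_intro a n (J : countType) (k : J -> nat) (b : J -> ord)
    (Q : forall j (M : structure), ('I_(k j + n) -> M) -> Prop) :
  ole oone a -> (forall j, olt (b j) a) -> (forall j, isS (b j) (@Q j)) ->
  isP a (fun M v => forall j u, extends u v -> Q j M u).
Proof.
move=> a1 ba H; pose psi j := s2val (cid2 (H j)).
exists (And (fun j => Alls (psi j))).
  by apply: (Pi_pos (b := b)) => // j; apply: (s2valP (cid2 (H j))).
move=> M v /=; split=> Hv j.
  by move=> u uv; apply/(s2valP' (cid2 (H j))); have /sat_Alls := Hv j; apply.
by apply/sat_Alls => u uv; apply/(s2valP' (cid2 (H j))); apply: Hv.
Qed.

Lemma isS_ext a n (P Q : forall M : structure, ('I_n -> M) -> Prop) :
  (forall M v, P M v <-> Q M v) -> isS a P -> isS a Q.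
Proof. by move=> PQ [phi H E]; exists phi => // M v; rewrite E. Qed.

Lemma isP_ext a n (P Q : forall M : structure, ('I_n -> M) -> Prop) :
  (forall M v, P M v <-> Q M v) -> isP a P -> isP a Q.
Proof. by move=> PQ [phi H E]; exists phi => // M v; rewrite E. Qed.

Scheme isSigma_mut := Induction for isSigma Sort Prop
with isPi_mut := Induction for isPi Sort Prop.
Combined Scheme levels_ind from isSigma_mut, isPi_mut.

Lemma levels_neg :
  (forall a n (phi : formula n), isSigma a phi -> isP a (fun M v => ~ @sat M n phi v)) /\
  (forall a n (phi : formula n), isPi a phi -> isS a (fun M v => ~ @sat M n phi v)).
Proof.
apply: levels_ind.
- by move=> a n phi a0 H; exists (Not phi) => //; apply: Pi_zero => //; constructor.
- move=> a n J k psi b a1 ba _ IH; apply: isP_ext (isP_intro a1 ba IH) => M v /=.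
  split=> [H [j /sat_Exs[u uv]]|H j u uv Hu]; first exact: H.
  by apply: H; exists j; apply/sat_Exs; exists u.
- by move=> a n phi a0 H; exists (Not phi) => //; apply: Sigma_zero => //; constructor.
- move=> a n J k psi b a1 ba _ IH; apply: isS_ext (isS_intro a1 ba IH) => M v /=.
  split=> [[j [u uv nu]] /(_ j)/sat_Alls/(_ u uv)//|/existsNP[j]].
  move=> /sat_Alls/existsNP[u /not_implyP[uv Hu]].
  by exists j, u.
Qed.

Lemma isP_neg a n (P : forall M : structure, ('I_n -> M) -> Prop) :
  isP a P -> isS a (fun M v => ~ P M v).
Proof.
by move=> [phi /levels_neg.2 H E]; apply: isS_ext H => M v; rewrite E.
Qed.

(** The level must be positive, because finitary formulas of level zero are not syntactically of the
    form required above zero. *)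
Lemma isS_mono a b n (P : forall M : structure, ('I_n -> M) -> Prop) :
  ole oone a -> ole a b -> isS a P -> isS b P.
Proof.
move=> a1 ab [phi H E].
have [[oz _]|[_ [J [k [psi [c [ca Hc Hphi]]]]]]] := isSigmaP H.
  by case: (one_not_zero a1 oz).
have Q j : isP (c j) (fun M u => @sat M _ (psi j) u) by exists (psi j).
apply: isS_ext (isS_intro (ole_trans a1 ab) (fun j => olt_ole (ca j) ab) Q) => M v.
by rewrite -E Hphi.
Qed.

Lemma isS_or a n (P Q : forall M : structure, ('I_n -> M) -> Prop) :
  ole oone a -> isS a P -> isS a Q -> isS a (fun M v => P M v \/ Q M v).
Proof.
move=> a1 [phi H E] [phi' H' E'].
have [[oz _]|[_ [J [k [psi [c [ca Hc Hphi]]]]]]] := isSigmaP H.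
  by case: (one_not_zero a1 oz).
have [[oz _]|[_ [J' [k' [psi' [c' [ca' Hc' Hphi']]]]]]] := isSigmaP H'.
  by case: (one_not_zero a1 oz).
pose K (i : J + J') := match i with inl j => k j | inr j => k' j end.
pose C (i : J + J') := match i with inl j => c j | inr j => c' j end.
pose Psi (i : J + J') : formula (K i + n) :=
  match i with inl j => psi j | inr j => psi' j end.
have CP i : isP (C i) (fun M u => @sat M _ (Psi i) u) by exists (Psi i) => //; case: i.
apply: isS_ext (isS_intro a1 _ CP); last by case.
move=> M v; rewrite -E -E' Hphi Hphi'; split=> [[[j|j]]|[[j]|[j]]] Hj.
- by left; exists j.
- by right; exists j.
- by exists (inl j).
- by exists (inr j).
Qed.

Lemma isP_isS a b n (P : forall M : structure, ('I_n -> M) -> Prop) :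
  olt a b -> isP a P -> isS b P.
Proof.
move=> ab HP; have b1 : ole oone b.
  by apply/ole_osucc; apply: ole_olt ab; case: (a) => J f [].
apply: isS_ext (@isS_intro b n unit (fun=> 0) (fun=> a) (fun=> P) b1 _ _) => // M v.
split=> [[_ [u /extends0 ->]]//|Pv]; exists tt, v => //; exact: extends_refl.
Qed.

Lemma finite_setT_fin (T : finType) : finite_set [set: T].
Proof. exact: finite_finset. Qed.

Lemma isP_zero_of_qf n (M : structure) (v : 'I_n -> M) a : oeq a ozero ->
  isP a (fun N w => @qfa M N n v w) /\ isS a (fun N w => @qfa M N n v w).
Proof.
move=> a0.
pose lit (b : bool) (phi : formula n) := if b then phi else Not phi.
pose F (t : 'I_n * 'I_n) := And (fun b : bool =>
  if b then lit `[< v t.1 = v t.2 >] (Eq t.1 t.2)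
  else lit `[< slt (v t.1) (v t.2) >] (Lt t.1 t.2)).
have satl (P : Prop) phi (N : structure) (w : 'I_n -> N) :
    sat (lit `[< P >] phi) w <-> (P <-> sat phi w).
  by rewrite /lit; case: asboolP => HP /=; split; tauto.
have qfl b phi : finitary_qf phi -> finitary_qf (lit b phi).
  by case: b => // H; constructor.
have qfF : finitary_qf (And F).
  constructor; first exact: finite_setT_fin.
  move=> t; constructor; first exact: finite_setT_fin.
  by case; apply: qfl; constructor.
have E (N : structure) (w : 'I_n -> N) : sat (And F) w <-> qfa v w.
  split=> [H i j|H [i j] []].
  - by split; [have /satl := H (i, j) true|have /satl := H (i, j) false].
  - by apply/satl; exact: (H i j).1.
  - by apply/satl; exact: (H i j).2.
by split; exists (And F) => //; [apply: Pi_zero|apply: Sigma_zero].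
Qed.

Lemma countable_enum (M : structure) : countable_structure M ->
  exists e : nat -> M, forall x, exists i, e i = x.
Proof.
case: (dom_inh M) => x0 /countable_injP[f finj].
exists (fun i => if pselect (exists x, f x = i) is left H then projT1 (cid H) else x0).
move=> x; exists (f x); case: pselect => [H|[]]; last by exists x.
by case: cid => y /= /finj -> //; rewrite in_setE.
Qed.

Lemma tuple_enum (T : Type) (e : nat -> T) n (w : 'I_n -> T) :
  (forall x, exists i, e i = x) -> exists f : {ffun 'I_n -> nat}, (fun i => e (f i)) = w.
Proof.
move=> he; exists [ffun i => projT1 (cid (he (w i)))].
by apply/funext => i; rewrite ffunE; case: cid.
Qed.

Lemma qfa_sym (M N : structure) n (v : 'I_n -> M) (w : 'I_n -> N) : qfa v w -> qfa w v.
Proof. by move=> H i j; have [H1 H2] := H i j; split; tauto. Qed.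

(** If a tuple of [N] is not above [v], it has an extension [w'] to which [M] has no answer at some
    lower level. By induction a formula separates [w'] from all candidate answers in [M]; its
    negation, universally quantified, is one conjunct. As [N] is countable, so is the
    conjunction. *)
Lemma separation a (M N : structure) n (v : 'I_n -> M) :
  countable_structure M -> countable_structure N ->
  exists P : forall K : structure, ('I_n -> K) -> Prop,
    [/\ isP a P, P M v, forall w, P N w -> bf a v w &
        forall (K : structure) (w : 'I_n -> K), P K w -> qfa v w].
Proof.
elim: a M N n v => J f IH M N n v cM cN.
have [[j0]|J0] := pselect (inhabited J); last first.
  have a0 : oeq (Lub f) ozero by split=> /= [j|[]]; case: J0.
  exists (fun K w => @qfa M K n v w); split=> //; first exact: (isP_zero_of_qf v a0).1.
  by move=> w vw /=; split=> // j; case: J0.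
have a1 : ole oone (Lub f) by move=> _; exists j0; case: (f j0) => K g [].
have [e he] := countable_enum cN.
(* An index [Some g] takes care of one tuple of [N]. The index [None] fixes the quantifier-free type
   in every structure, which is needed later in an unknown model of the Scott sentence. *)
pose sepat (i : option {ffun 'I_n -> nat}) k b
    (Q : forall K : structure, ('I_(k + n) -> K) -> Prop) :=
  [/\ olt b (Lub f), isS b Q,
    forall u, extends u v -> Q M u &
    if i is Some g then bf (Lub f) v (fun i => e (g i)) \/
        exists2 u, extends u (fun i => e (g i)) & ~ Q N u
    else forall (K : structure) w, (forall u, extends u w -> Q K u) -> qfa v w].
have H i : exists k b (Q : forall K : structure, ('I_(k + n) -> K) -> Prop), sepat i k b Q.
  have triv : olt ozero (Lub f) /\ isS ozero (fun K (w : 'I_(0 + n) -> K) => qfa v w).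
    split; first exact/ole_osucc.
    by apply: (isP_zero_of_qf v _).2; split; apply: ole_refl.
  case: i => [g|]; last first.
    exists 0, ozero, (fun K w => @qfa M K n v w); split=> //; try by case: triv.
      by move=> u /extends0 ->.
    by move=> K w; apply; apply: extends_refl.
  have [vg|nvg] := pselect (bf (Lub f) v (fun i => e (g i))).
    exists 0, ozero, (fun K w => @qfa M K n v w); split=> //; try by case: triv.
      by move=> u /extends0 ->.
    by left.
  have [vg|nvg'] := pselect (qfa v (fun i => e (g i))); last first.
    exists 0, ozero, (fun K w => @qfa M K n v w); split=> //; try by case: triv.
      by move=> u /extends0 ->.
    by right; exists (fun i => e (g i)) => //; apply: extends_refl.
  have [j [k [w' [ww' Hw]]]] : exists j k (w' : 'I_(k + n) -> N),
      extends w' (fun i => e (g i)) /\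
      forall v' : 'I_(k + n) -> M, extends v' v -> ~ bf (f j) w' v'.
    apply: contrapT => Hn; apply: nvg; split=> // j k w' ww'.
    apply: contrapT => Hv; apply: Hn; exists j, k, w'; split=> // v' vv' Hb.
    by apply: Hv; exists v'.
  have [Q [HQ Qw Qb _]] := IH j N M (k + n) w' cN cM.
  exists k, (f j), (fun K u => ~ Q K u); split.
  - exact: olt_Lub.
  - exact: isP_neg.
  - by move=> u uv /Qb; apply: Hw.
  - by right; exists w' => //; apply.
pose K i := projT1 (cid (H i)); pose B i := projT1 (cid (projT2 (cid (H i)))).
pose Q i : forall S : structure, ('I_(K i + n) -> S) -> Prop :=
  projT1 (cid (projT2 (cid (projT2 (cid (H i)))))).
have HQ i : sepat i (K i) (B i) (Q i).
  exact: (projT2 (cid (projT2 (cid (projT2 (cid (H i))))))).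
exists (fun S w => forall i u, extends u w -> Q i S u); split.
- by apply: (isP_intro (b := B) (Q := Q)) => // i; case: (HQ i).
- by move=> i u uv; case: (HQ i) => _ _ + _; apply.
- move=> w Hw; have [g gw] := tuple_enum w he.
  case: (HQ (Some g)) => _ _ _; rewrite gw; case=> // -[u uw []].
  exact: Hw uw.
- by move=> S w Hw; case: (HQ None) => _ _ _; apply; apply: Hw.
Qed.

(** Bridges [m] and [m + 0]: in a sentence, [Alls] quantifies over [m + 0] variables. *)
Lemma isS_cast a m n (e : m = n) (P : forall M : structure, ('I_n -> M) -> Prop) :
  isS a P -> isS a (fun (M : structure) (u : 'I_m -> M) => P M (fun i => u (cast_ord (esym e) i))).
Proof.
move=> HP; subst n; apply: isS_ext HP => M u.
by rewrite (_ : (fun i => u _) = u)//; apply/funext => i; rewrite cast_ord_id.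
Qed.

Lemma back_forth_bij (A B : Type) (a : nat -> A) (b : nat -> B)
    (R : seq (A * B) -> Prop) :
  (forall x, exists i, a i = x) -> (forall y, exists i, b i = y) ->
  R [::] -> (forall z, R z -> forall x, exists y, R ((x, y) :: z)) ->
  (forall z, R z -> forall y, exists x, R ((x, y) :: z)) ->
  exists F : A -> B -> Prop,
    [/\ forall x, exists y, F x y, forall y, exists x, F x y &
        forall x y x' y', F x y -> F x' y' ->
          exists z, [/\ R z, List.In (x, y) z & List.In (x', y') z]].
Proof.
move=> ha hb R0 forth back.
have step (i : nat) (z : {z | R z}) : exists z' : {z | R z},
    [/\ forall p, List.In p (sval z) -> List.In p (sval z'),
        exists y, List.In (a i, y) (sval z') & exists x, List.In (x, b i) (sval z')].
  case: z => z Rz; have [y Ry] := forth z Rz (a i); have [x Rx] := back _ Ry (b i).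
  exists (exist _ _ Rx) => /=; split; first by move=> p; right; right.
    by exists y; right; left.
  by exists x; left.
pose s := fix s i := if i is i'.+1 then projT1 (cid (step i' (s i'))) else exist _ _ R0.
have sS i := projT2 (cid (step i (s i))).
have smono i j p : (i <= j)%N -> List.In p (sval (s i)) -> List.In p (sval (s j)).
  elim: j => [|j IH]; first by rewrite leqn0 => /eqP ->.
  rewrite leq_eqVlt => /orP[/eqP -> //|ij pi].
  by case: (sS j) => + _ _; apply; apply: IH.
exists (fun x y => exists i, List.In (x, y) (sval (s i))); split.
- by move=> x; have [i <-] := ha x; case: (sS i) => _ [y ?] _; exists y, i.+1.
- by move=> y; have [i <-] := hb y; case: (sS i) => _ _ [x ?]; exists x, i.+1.
move=> x y x' y' [i xyi] [j xyj]; exists (sval (s (maxn i j))); split.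
- exact: (proj2_sig (s (maxn i j))).
- by apply: smono xyi; apply: leq_maxl.
- by apply: smono xyj; apply: leq_maxr.
Qed.

(** Both halves of a list of pairs become valuations over one index type, so that a formula chosen
    for one half can be evaluated at the other. *)
Fixpoint lmap (T A : Type) (f : T -> A) (z : seq T) : 'I_(size z) -> A :=
  match z return 'I_(size z) -> A with
  | [::] => fun i => False_rect A (Bool.diff_false_true (ltn_ord i))
  | p :: z' => vcons (f p) (@lmap T A f z')
  end.

Arguments lmap {T A} f z i.

Lemma lmap_In (T : Type) (z : seq T) p : List.In p z ->
  exists i, forall (A : Type) (f : T -> A), lmap f z i = f p.
Proof.
elim: z => // q z IH /= [->|/IH[i Hi]]; first by exists ord0 => A f; rewrite vcons0.
by exists (lift ord0 i) => A f; rewrite vconsS.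
Qed.

Lemma qf_reindex n (phi : formula n) m (e : 'I_n -> 'I_m) : finitary_qf phi ->
  exists2 psi : formula m, finitary_qf psi &
    forall (M : structure) (w : 'I_m -> M), sat psi w <-> sat phi (fun i => w (e i)).
Proof.
move=> H; elim: H m e => {n phi} [n i j|n i j|n phi _ IH|n J F fJ _ IH|n J F fJ _ IH] m e.
- by exists (Eq (e i) (e j)); first by constructor.
- by exists (Lt (e i) (e j)); first by constructor.
- have [psi qf E] := IH m e; exists (Not psi); first by constructor.
  by move=> M w /=; rewrite E.
- exists (And (fun j => s2val (cid2 (IH j m e)))).
    by constructor=> // j; apply: (s2valP (cid2 (IH j m e))).
  by move=> M w /=; split=> H j; apply/(s2valP' (cid2 (IH j m e))).
- exists (Or (fun j => s2val (cid2 (IH j m e)))).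
    by constructor=> // j; apply: (s2valP (cid2 (IH j m e))).
  by move=> M w /=; split=> -[j H]; exists j; apply/(s2valP' (cid2 (IH j m e))).
Qed.

Lemma levels_reindex :
  (forall a n (phi : formula n), isSigma a phi -> forall m (e : 'I_n -> 'I_m),
    isS a (fun M w => @sat M n phi (fun i => w (e i)))) /\
  (forall a n (phi : formula n), isPi a phi -> forall m (e : 'I_n -> 'I_m),
    isP a (fun M w => @sat M n phi (fun i => w (e i)))).
Proof.
have R k n m (e : 'I_n -> 'I_m) (M : structure) (w : 'I_m -> M) (u : 'I_(k + n) -> M) :
    extends u (fun i => w (e i)) -> exists2 u' : 'I_(k + m) -> M, extends u' w &
      u = (fun i => u' (vapp (fun i => lshift m i) (fun i => rshift k (e i)) i)).
  move=> uw; exists (vapp (fun i => u (lshift n i)) w); first exact: vappr.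
  apply/funext => i; rewrite -[i in LHS]splitK /vapp; case: (fintype.split i) => i1 /=.
    by rewrite (unsplitK (inl i1)).
  by rewrite uw (unsplitK (inr (e i1))).
have R' k n m (e : 'I_n -> 'I_m) (M : structure) (w : 'I_m -> M) (u' : 'I_(k + m) -> M) :
    extends u' w -> @extends _ k n
      (fun i => u' (vapp (fun i => lshift m i) (fun i => rshift k (e i)) i))
      (fun i => w (e i)).
  by move=> uw i; rewrite vappr uw.
apply: levels_ind => a n.
- move=> phi a0 /qf_reindex H m e; have [psi qf E] := H m e.
  by exists psi => //; apply: Sigma_zero.
- move=> J k psi b a1 ba _ IH m e.
  apply: isS_ext (isS_intro a1 ba (fun j => IH j _ _)) => M w /=; split=> -[j].
    move=> [u' /R' uw Hu]; exists j; apply/sat_Exs; eexists; last exact: Hu.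
    exact: uw.
  by move=> /sat_Exs[u /R[u' uw' ->] Hu]; exists j, u'.
- move=> phi a0 /qf_reindex H m e; have [psi qf E] := H m e.
  by exists psi => //; apply: Pi_zero.
- move=> J k psi b a1 ba _ IH m e.
  apply: isP_ext (isP_intro a1 ba (fun j => IH j _ _)) => M w /=; split=> H j.
    by apply/sat_Alls => u /R[u' uw' ->]; apply: H.
  by move=> u' uw; have /sat_Alls := H j; apply; apply: R'.
Qed.

Lemma isS_reindex a n m (e : 'I_n -> 'I_m) (P : forall M : structure, ('I_n -> M) -> Prop) :
  isS a P -> isS a (fun M w => P M (fun i => w (e i))).
Proof.
by move=> [phi /levels_reindex.1 H E]; apply: isS_ext (H m e) => M v; rewrite E.
Qed.

Lemma levels_bf :
  (forall a n (phi : formula n), isSigma a phi ->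
    forall (M N : structure) (v : 'I_n -> M) (w : 'I_n -> N),
    bf a v w -> sat phi w -> sat phi v) /\
  (forall a n (phi : formula n), isPi a phi ->
    forall (M N : structure) (v : 'I_n -> M) (w : 'I_n -> N),
    bf a v w -> sat phi v -> sat phi w).
Proof.
apply: levels_ind => a n.
- by move=> phi _ qf M N v w /bf_qfa vw /(sat_qf qf vw).
- move=> J k psi b _ ba _ IH M N v w vw /= [j /sat_Exs[u uw Hu]]; exists j.
  have [u' uv Huu] := bf_step (ba j) vw uw.
  by apply/sat_Exs; exists u' => //; apply: IH Huu Hu.
- by move=> phi _ qf M N v w /bf_qfa vw /(sat_qf qf vw).
- move=> J k psi b _ ba _ IH M N v w vw /= H j; apply/sat_Alls => u uw.
  have [u' uv Huu] := bf_step (ba j) vw uw.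
  by apply: IH Huu _; have /sat_Alls := H j; apply.
Qed.

Lemma isP_bf a n (P : forall M : structure, ('I_n -> M) -> Prop) (M N : structure)
    (v : 'I_n -> M) (w : 'I_n -> N) : isP a P -> bf a v w -> P M v -> P N w.
Proof. by move=> [phi H E] vw /E /(levels_bf.2 _ _ _ H _ _ _ _ vw) /E. Qed.

(** If [bf d] is a back-and-forth system on [N], the Scott sentence only has to say that the
    separating [Pi_d] formulas have the back-and-forth property. Its clauses are universally
    quantified [Sigma_(d+1)] formulas, whence any level above d + 1 will do. *)
Lemma scott_homogeneous (N : structure) d g :
  countable_structure N -> ole oone d -> olt (osucc d) g ->
  (forall n (v w : 'I_n -> N), bf d v w ->
    forall x, exists y, bf d (vcons x v) (vcons y w)) ->
  (forall n (v w : 'I_n -> N), bf d v w ->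
    forall y, exists x, bf d (vcons x v) (vcons y w)) ->
  has_Pi_scott_sentence g N.
Proof.
move=> cN d1 dg forth back; have [e he] := countable_enum cN.
pose P n (v : 'I_n -> N) := projT1 (cid (@separation d N N n v cN cN)).
have HP n (v : 'I_n -> N) : [/\ isP d (P n v), P n v N v, forall w, P n v N w -> bf d v w &
    forall (K : structure) (w : 'I_n -> K), P n v K w -> qfa v w].
  exact: (projT2 (cid (@separation d N N n v cN cN))).
have g1 : ole oone g by apply/ole_osucc/(ole_olt _ dg)/oltW/olt_osucc; case: (d) => J f [].
have sd1 : ole oone (osucc d) by apply: ole_trans d1 _; apply/oltW/olt_osucc/ole_refl.
pose v0 : 'I_0 -> N := fun i => e i.
pose T := option ({n : nat & {ffun 'I_n -> nat}} * option nat).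
pose ve (s : {n : nat & {ffun 'I_n -> nat}}) : 'I_(tag s) -> N := fun i => e (tagged s i).
(* [Q1] is the forth clause for the tuple [s] and the point [e a], [Q2] the back clause for [s]. The
   new point of [Q2] is among its universally quantified variables, and only its counterpart in [N]
   is chosen, by a countable disjunction. *)
pose Q1 s a (K : structure) (w : 'I_(tag s) -> K) :=
  ~ P _ (ve s) K w \/ exists y, P _ (vcons (e a) (ve s)) K (vcons y w).
pose Q2 s (K : structure) (w : 'I_(tag s).+1 -> K) :=
  ~ P _ (ve s) K (fun i => w (lift ord0 i)) \/ exists a, P _ (vcons (e a) (ve s)) K w.
pose k (t : T) := match t with
  | None => 0 | Some (s, Some a) => tag s | Some (s, None) => (tag s).+1 end.
pose Q (t : T) : forall K : structure, ('I_(k t + 0) -> K) -> Prop :=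
  match t with
  | None => fun K u => P 0 v0 K u
  | Some (s, Some a) => fun K u => Q1 s a K (fun i => u (cast_ord (esym (addn0 _)) i))
  | Some (s, None) => fun K u => Q2 s K (fun i => u (cast_ord (esym (addn0 _)) i))
  end.
have negP n (v : 'I_n -> N) : isS (osucc d) (fun K w => ~ P n v K w).
  apply: (isS_mono d1); first by apply/oltW/olt_osucc/ole_refl.
  by apply: isP_neg; case: (HP n v).
have SQ t : isS (osucc d) (@Q t).
  have dd : olt d (osucc d) by apply/olt_osucc/ole_refl.
  case: t => [[s [a|]]|] /=.
  - apply: (isS_cast (addn0 _)) (_ : isS _ (Q1 s a)); apply: isS_or => //.
    apply: isS_ext (@isS_intro _ _ unit (fun=> 1) (fun=> d) (fun=> P _ (vcons (e a) (ve s))) sd1 _ _).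
    + move=> K w; split=> [[_ [u /extendsP[y ->] Hu]]|[y Hy]]; first by exists y.
      by exists tt, (vcons y w) => //; apply: extends_vcons.
    + by [].
    + by move=> _; case: (HP _ (vcons (e a) (ve s))).
  - apply: (isS_cast (addn0 _)) (_ : isS _ (Q2 s)); apply: isS_or => //.
      exact: isS_reindex (negP _ (ve s)).
    apply: isS_ext (@isS_intro _ _ nat (fun=> 0) (fun=> d) (fun a => P _ (vcons (e a) (ve s))) sd1 _ _).
    + move=> K w; split=> [[a [u /extends0 -> Hu]]|[a Hy]]; first by exists a.
      by exists a, w => //; apply: extends_refl.
    + by [].
    + by move=> a; case: (HP _ (vcons (e a) (ve s))).
  - by apply: isP_isS dd _; case: (HP _ v0).
have [theta Ptheta Htheta] := isP_intro g1 (fun _ : T => dg) SQ.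
have Etheta K : models K theta <-> [/\ forall w, P 0 v0 K w,
    forall s a (w : 'I_(tag s) -> K), Q1 s a K w &
    forall s (w : 'I_(tag s).+1 -> K), Q2 s K w].
  split=> [H|[H0 H1 H2] w].
    have /Htheta {}H := H (fun i => False_rect K (Bool.diff_false_true (ltn_ord i))).
    have cast m (u : 'I_m -> K) : exists2 u' : 'I_(m + 0) -> K,
        (fun i => u' (cast_ord (esym (addn0 _)) i)) = u & True.
      exists (fun i => u (cast_ord (addn0 _) i)) => //.
      by apply/funext => i; congr u; apply: val_inj.
    have ext0 m (u : 'I_(m + 0) -> K) w : extends u w by move=> -[].
    split=> [w|s a w|s w].
    - exact: (H None).
    - by have [u' <- _] := cast _ w; exact: (H (Some (s, Some a)) u').
    - by have [u' <- _] := cast _ w; exact: (H (Some (s, None)) u').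
  apply/Htheta => -[[s [a|]]|] u _ /=; [exact: H1|exact: H2|exact: H0].
have Pbf n (v w : 'I_n -> N) : bf d v w -> P n v N w.
  by move=> vw; have [HPv Pv _ _] := HP n v; apply: isP_bf HPv vw Pv.
have bfP n (v w : 'I_n -> N) : P n v N w -> bf d v w by case: (HP n v) => _ _ + _; apply.
have Ntheta : models N theta.
  apply/Etheta; split=> [w|s a w|s w].
  - by have [_ H _ _] := HP _ v0; rewrite (_ : w = v0)//; apply/funext => -[].
  - rewrite /Q1; have [/bfP Pw|] := pselect (P _ (ve s) N w); [right|by left].
    by have [y /Pbf Hy] := forth _ _ _ Pw (e a); exists y.
  - rewrite /Q2; have [/bfP Pw|] := pselect (P _ (ve s) N (fun i => w (lift ord0 i))).
      right; have [x /Pbf Hx] := back _ _ _ Pw (w ord0); have [a ax] := he x.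
      by exists a; rewrite ax -[w]vcons_eta.
    by left.
exists theta => // N' cN'; split; last first.
  by move=> [f bijf hf] v; apply/(sat_iso _ _ bijf hf).
move=> /Etheta[H0 H1 H2]; have [e' he'] := countable_enum cN'.
have forth' n (v : 'I_n -> N) (w : 'I_n -> N') x : P n v N' w ->
    exists y, P _ (vcons x v) N' (vcons y w).
  have [f <-] := tuple_enum v he; have [a <-] := he x => Pw.
  by have [] := H1 (existT _ n f) a w.
have back' n (v : 'I_n -> N) (w : 'I_n -> N') y : P n v N' w ->
    exists x, P _ (vcons x v) N' (vcons y w).
  have [f <-] := tuple_enum v he => Pw; have [] := H2 (existT _ n f) (vcons y w).
    by case; rewrite (_ : (fun i => _) = w)//; apply/funext => i; rewrite vconsS.
  by move=> [a Ha]; exists (e a).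
pose R z := P _ (lmap fst z) N' (lmap snd z).
have [] := @back_forth_bij N N' e e' R he he'.
- rewrite /R (_ : lmap fst [::] = v0); first exact: H0.
  by apply/funext => -[].
- by move=> z Rz x; have [y] := forth' _ _ _ x Rz; exists y.
- by move=> z Rz y; have [x] := back' _ _ _ y Rz; exists x.
move=> F [Ftot Fsur FR].
have Fq x y x' y' : F x y -> F x' y' -> (x = x' <-> y = y') /\ (slt x x' <-> slt y y').
  move=> Fxy Fxy'; have [z [Rz zi zj]] := FR _ _ _ _ Fxy Fxy'.
  have [i Hi] := lmap_In zi; have [j Hj] := lmap_In zj.
  have [_ _ _ /(_ _ _ Rz) q] := HP _ (lmap fst z).
  by have := q i j; rewrite !Hi !Hj.
pose h y := projT1 (cid (Fsur y)); have hF y : F (h y) y := projT2 (cid (Fsur y)).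
pose h' x := projT1 (cid (Ftot x)); have hF' x : F x (h' x) := projT2 (cid (Ftot x)).
exists h; last by move=> y y'; rewrite (Fq _ _ _ _ (hF y) (hF y')).2.
exists h' => y.
  by apply/(Fq _ _ _ _ (hF' (h y)) (hF y)).1.
by apply/(Fq _ _ _ _ (hF (h' y)) (hF' y)).1.
Qed.

(** * Intervals of a linear order *)

Section LinearOrder.
Variables (M : structure) (linM : linear_order M).

Lemma slt_irr (x : M) : ~ slt x x. Proof. by case: linM. Qed.

Lemma slt_trans (x y z : M) : slt x y -> slt y z -> slt x z.
Proof. by case: linM => _ + _; apply. Qed.

Lemma slt_total (x y : M) : [\/ slt x y, x = y | slt y x].
Proof. by case: linM. Qed.

Definition inI (I : option M * option M) (x : M) : Prop :=
  (if I.1 is Some a then slt a x else True) /\ (if I.2 is Some b then slt x b else True).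

Definition ointsp (I A B : option M * option M) : Prop :=
  exists x, [/\ inI I x, A = (I.1, Some x) & B = (Some x, I.2)].

Lemma inI_lt l u x y : inI (l, u) x -> inI (Some x, u) y -> inI (l, u) y.
Proof. by case: l => [l|] [/= lx _] [/= xy yu]; split=> //=; apply: slt_trans lx xy. Qed.

Lemma inI_gt l u x y : inI (l, u) x -> inI (l, Some x) y -> inI (l, u) y.
Proof. by case: u => [u|] [/= _ xu] [/= ly yx]; split=> //=; apply: slt_trans yx xu. Qed.

(** The end [None] is infinite. Pairs with ends in the wrong order are kept as intervals without
    cuts. *)
Definition oint : isys.
Proof.
refine (@ISys (option M * option M)%type ointsp _ _ _).
- move=> [l u] A B C D [x [Ix -> ->]] [y [/= Iy -> ->]]; exists (l, Some y).
    by exists y; split=> //; apply: inI_lt Ix Iy.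
  by exists x; split=> //; case: Ix Iy => /= lx _ [/= xy _].
- move=> [l u] E D A C [x [Ix -> ->]] [y [/= Iy -> ->]]; exists (Some y, u).
    by exists y; split=> //; apply: inI_gt Ix Iy.
  by exists x; split=> //; case: Ix Iy => /= _ xu [/= _ yx].
move=> [l u] A B A' B' [x [Ix -> ->]] [y [/= Iy -> ->]] /=.
case: Ix Iy => /= lx xu [/= ly yu].
have [xy|xy|xy] := slt_total x y.
- by constructor 2; exists (Some x, Some y); [exists x|exists y].
- by constructor 1; rewrite xy.
- by constructor 3; exists (Some y, Some x); [exists y|exists x].
Defined.

Fixpoint chain (I : oint) (t : seq M) : Prop :=
  if t is y :: t' then inI I y /\ chain (Some y, I.2) t' else True.

Fixpoint gapsof (I : oint) (t : seq M) : seq oint :=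
  if t is y :: t' then (I.1, Some y) :: gapsof (Some y, I.2) t' else [:: I].

Lemma spn_gapsof (I : oint) t : chain I t -> spn I (gapsof I t).
Proof.
elim: t I => [|y t IH] I /=; first by constructor.
by move=> [Iy /IH]; apply: spnS; exists y.
Qed.

Lemma spn_ointP (I : oint) w : spn I w -> exists2 t, chain I t & w = gapsof I t.
Proof.
elim=> {I w} [I|I A B w [x [Ix -> ->]] _ [t ct ->]]; first by exists [::].
by exists (x :: t).
Qed.

Lemma chain_insert (I : oint) t y : chain I t -> inI I y -> exists2 t', chain I t' &
  List.In y t' /\ forall x, List.In x t -> List.In x t'.
Proof.
elim: t I => [|x t IH] I /= => [_ Iy|[Ix xt] Iy].
  by exists [:: y] => //; split; [left|].
case: Ix (Iy) => /= lx xu [/= ly yu].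
have [yx|yx|xy] := slt_total y x.
- by exists (y :: x :: t) => //; split; [left|right].
- by exists (x :: t) => //; split; [left|].
have [//|t' xt' [yt' tt']] := IH _ xt (_ : inI (Some x, I.2) y).
by exists (x :: t') => //; split; [right|move=> z [->|/tt']; [left|right]].
Qed.

Lemma chain_exists (I : oint) (d : seq M) : exists2 t, chain I t &
  forall y, List.In y d -> inI I y -> List.In y t.
Proof.
elim: d => [|y d [t It dt]]; first by exists [::].
have [Iy|nIy] := pselect (inI I y); last first.
  by exists t => // z [<- //|]; apply: dt.
have [t' It' [yt' tt']] := chain_insert It Iy.
by exists t' => // z [<- //|zd Iz]; apply/tt'/dt.
Qed.

End LinearOrder.

(** * Back-and-forth for tuples and for the gaps between their points *)

Section Bridge.
Variables (M N : structure) (linM : linear_order M) (linN : linear_order N).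

Fixpoint zg (a : ord) (I : oint linM) (I' : oint linN) (z : seq (M * N)) : Prop :=
  if z is p :: z' then
    [/\ inI I p.1, inI I' p.2, ile a ((I.1, Some p.1) : oint linM) ((I'.1, Some p.2) : oint linN)
      & zg a (Some p.1, I.2) (Some p.2, I'.2) z']
  else ile a I I'.

Lemma zg_In a (I : oint linM) (I' : oint linN) (z : seq (M * N)) p : zg a I I' z -> List.In p z -> inI I p.1 /\ inI I' p.2.
Proof.
elim: z I I' => // q z IH [l u] [l' u'] /= [Iq Iq' _ qz] [<- //|/(IH _ _ qz)[H H']].
by split; [apply: inI_lt Iq H|apply: inI_lt Iq' H'].
Qed.

Lemma zg_qfa a (I : oint linM) (I' : oint linN) (z : seq (M * N)) p q : zg a I I' z -> List.In p z -> List.In q z ->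
  (p.1 = q.1 <-> p.2 = q.2) /\ (slt p.1 q.1 <-> slt p.2 q.2).
Proof.
have irr := slt_irr linM; have irr' := slt_irr linN.
have tr := slt_trans linM; have tr' := slt_trans linN.
elim: z I I' => // r z IH [l u] [l' u'] /= [Iq Iq' _ qz].
move=> [<-|pz] [<-|qz'].
- by split; split=> // [/irr|/irr'].
- have [[/= H _] [/= H' _]] := zg_In qz qz'; split; split=> // E.
    by case: (irr q.1); rewrite -{1}E.
  by case: (irr' q.2); rewrite -{1}E.
- have [[/= H _] [/= H' _]] := zg_In qz pz; split; split=> // E.
  + by case: (irr p.1); rewrite {1}E.
  + by case: (irr' p.2); rewrite {1}E.
  + by case: (irr p.1); apply: tr E H.
  + by case: (irr' p.2); apply: tr' E H'.
- exact: IH qz pz qz'.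
Qed.

Lemma zg_cat a (I : oint linM) (I' : oint linN) (z1 z2 : seq (M * N)) (p : M * N) : inI I p.1 -> inI I' p.2 ->
  zg a (I.1, Some p.1) (I'.1, Some p.2) z1 ->
  zg a (Some p.1, I.2) (Some p.2, I'.2) z2 -> zg a I I' (z1 ++ p :: z2).
Proof.
elim: z1 I I' => [|q z1 IH] [l u] [l' u'] /= Ip Ip'; first by split.
move=> [Iq Iq' H H1] H2; split=> //.
- exact: inI_gt Ip Iq.
- exact: inI_gt Ip' Iq'.
apply: IH => //=.
  by case: Ip Iq => /= _ pu [].
by case: Ip' Iq' => /= _ pu [].
Qed.

End Bridge.

Lemma zg_ile_split (M N : structure) (linM : linear_order M) (linN : linear_order N) b
    (I : oint linM) (I' : oint linN) (t : seq M) w :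
  spn I' w -> Forall2 (ile b) (gapsof I t) w -> chain I t ->
  exists2 z, zg b I I' z & forall x, List.In x t -> exists y, List.In (x, y) z.
Proof.
elim: t I I' w => [|x t IH] I I' w I'w /= H.
  move=> _; have [A wA IA] := forall2_single H; exists [::] => //=.
  by move: I'w; rewrite wA => /spn_single <-.
move=> [Ix xt]; have [A [w' [wA IA H']]] := forall2_cons H; move: I'w; rewrite wA.
case/spn_cons => [[w'0 _]|[B [y [Iy AE BE]] Bw']].
  by move: H'; rewrite w'0; case: (t) => [|? ?] /= H'; inversion H'.
have [z Hz xz] := IH _ _ _ Bw' H' xt.
exists ((x, y) :: z) => /=.
  by split=> //; rewrite -?AE -?BE.
by move=> x' [<-|/xz[y' ?]]; [exists y; left|exists y'; right].
Qed.

Section Bridge2.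
Variables (M N : structure) (linM : linear_order M) (linN : linear_order N).

(** One round of the game, played in all gaps at once: the challenge [d] is distributed over the
    gaps of [z], and the points of [z] are kept between the answers. *)
Lemma zg_refine (J : countType) (f : J -> ord) (I : oint linM) (I' : oint linN)
    (z : seq (M * N)) (j : J) (d : seq N) : zg (Lub f) I I' z ->
  exists2 z' : seq (N * M), zg (f j) I' I z' &
    (forall x y, List.In (x, y) z -> List.In (y, x) z') /\
    forall y, List.In y d -> inI I' y -> exists x, List.In (y, x) z'.
Proof.
have base (A : oint linM) (A' : oint linN) : ile (Lub f) A A' ->
    exists2 z' : seq (N * M), zg (f j) A' A z' &
      forall y, List.In y d -> inI A' y -> exists x, List.In (y, x) z'.
  move=> H; have [t At dt] := chain_exists A' d.
  have [w Aw wt] := H j _ (spn_gapsof At).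
  have [z' Hz tz] := zg_ile_split Aw wt At.
  by exists z' => // y yd Ay; apply/tz/dt.
elim: z I I' => [|[x y] z IH] I I' /= => [/base[z' ? ?]|[Ix Iy /base[z1 H1 d1] /IH[z2 H2 [zz2 d2]]]].
  by exists z'.
exists (z1 ++ (y, x) :: z2); first exact: zg_cat.
split=> [x' y' [[<- <-]|/zz2 H]|y' dy' Iy'].
- by apply/List.in_or_app; right; left.
- by apply/List.in_or_app; right; right.
have [y'y|->|yy'] := slt_total linN y' y.
- have [|x' Hx'] := d1 y' dy'; first by case: Iy'.
  by exists x'; apply/List.in_or_app; left.
- by exists x; apply/List.in_or_app; right; left.
- have [|x' Hx'] := d2 y' dy'; first by case: Iy'.
  by exists x'; apply/List.in_or_app; right; right.
Qed.

End Bridge2.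

Lemma zg_bf a (M N : structure) (linM : linear_order M) (linN : linear_order N)
    (z : seq (M * N)) n (v : 'I_n -> M) (w : 'I_n -> N) :
  zg a ((None, None) : oint linM) ((None, None) : oint linN) z ->
  (forall i, List.In (v i, w i) z) -> bf a v w.
Proof.
elim: a M N linM linN z n v w => J f IH M N linM linN z n v w Hz vw; split.
  by move=> i i'; apply: (zg_qfa Hz (vw i) (vw i')).
move=> j k w' ww'.
have [z' Hz' [zz' dz']] := zg_refine j [seq w' i | i <- enum 'I_(k + n)] Hz.
have Hx i : exists x, List.In (w' i, x) z'.
  apply: dz' => //; apply/List.in_map_iff; exists i; split=> //.
  have : i \in enum 'I_(k + n) by rewrite mem_enum.
  by elim: (enum _) => //= a s IHs; rewrite inE => /orP[/eqP ->|/IHs]; [left|right].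
pose x i := projT1 (cid (Hx i)).
exists (vapp (fun i => x (lshift n i)) v); first exact: vappr.
apply: (IH j N M linN linM z') => // i; rewrite -[i]splitK.
case: (fintype.split i) => i1 /=.
  by rewrite vappl; exact: (projT2 (cid (Hx (lshift n i1)))).
by rewrite vappr ww'; apply: zz'.
Qed.

Lemma bf_ile a (M N : structure) (linM : linear_order M) (linN : linear_order N)
    n (v : 'I_n -> M) (w : 'I_n -> N) (l r : option 'I_n) : bf a v w ->
  ile a ((omap v l, omap v r) : oint linM) ((omap w l, omap w r) : oint linN).
Proof.
elim: a M N linM linN n v w l r => J f IH M N linM linN n v w l r [_ H] j wd.
move=> /spn_ointP[t ct ->].
have [v' vv' H'] := H j (size t) _ (vappr (fun i => tnth (in_tuple t) i) w).
set w' := vapp _ _ in H'.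
pose l' := omap (@rshift (size t) n) l; pose r' := omap (@rshift (size t) n) r.
have El : omap v l = omap v' l' by rewrite /l'; case: (l) => //= i; rewrite vv'.
have Er : omap v r = omap v' r' by rewrite /r'; case: (r) => //= i; rewrite vv'.
have El' : omap w l = omap w' l' by rewrite /l'; case: (l) => //= i; rewrite /w' vappr.
have Er' : omap w r = omap w' r' by rewrite /r'; case: (r) => //= i; rewrite /w' vappr.
pose p := [seq lshift n i | i <- enum 'I_(size t)].
have Et : t = [seq w' i | i <- p].
  rewrite -map_comp; rewrite (eq_map (_ : _ =1 tnth (in_tuple t))).
    exact: (esym (map_tnth_enum (in_tuple t))).
  by move=> i /=; rewrite /w' vappl.
(* The left end [l1] has to vary, since it moves along the points of the splitting; the right end
   stays. *)
have key q l1 : chain ((omap w' l1, omap w' r') : oint linN) [seq w' i | i <- q] ->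
    exists2 wd', spn ((omap v' l1, omap v' r') : oint linM) wd' &
      Forall2 (ile (f j)) (gapsof ((omap w' l1, omap w' r') : oint linN) [seq w' i | i <- q]) wd'.
  elim: q l1 => [|i q IHq] l1 /=.
    move=> _; exists [:: ((omap v' l1, omap v' r') : oint linM)]; constructor=> //.
    exact: (IH j _ _ _ _ _ _ _ l1 r' H').
  move=> [[/= li ir] /(IHq (Some i))[wd' Hwd' Hf]].
  exists (((omap v' l1, Some (v' i)) : oint linM) :: wd').
    apply: spnS Hwd'; exists (v' i); split=> //; split=> /=.
      by case: (l1) li => //= i1; rewrite (bf_qfa H' _ _).2.
    by case: (r') ir => //= i1; rewrite (bf_qfa H' _ _).2.
  by constructor=> //; apply: (IH j _ _ _ _ _ _ _ l1 (Some i)).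
by have := key p l'; rewrite -El -Er -El' -Er' -Et; apply.
Qed.

(** * The free interval system closed under sums *)

Section Trees.
Variable X : isys.

(** [Mul a b] is the formal sum a + 1 + b. No associativity is imposed, because [ile] and [beq] see
    only how an interval can be cut. *)
Inductive tree := Base of X | Mul of tree & tree.

Inductive tsp : tree -> tree -> tree -> Prop :=
| tsp_base I A B : sp I A B -> tsp (Base I) (Base A) (Base B)
| tsp_mid a b : tsp (Mul a b) a b
| tsp_left a b a1 a2 : tsp a a1 a2 -> tsp (Mul a b) a1 (Mul a2 b)
| tsp_right a b b1 b2 : tsp b b1 b2 -> tsp (Mul a b) (Mul a b1) b2.

Lemma tsp_baseP I A B : tsp (Base I) A B -> exists A' B',
  [/\ A = Base A', B = Base B' & sp I A' B'].
Proof. by move=> H; inversion H as [? A' B'| | |]; exists A', B'. Qed.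

Lemma tsp_mulP a b A B : tsp (Mul a b) A B ->
  [\/ A = a /\ B = b, exists2 a2, tsp a A a2 & B = Mul a2 b
    | exists2 b1, tsp b b1 B & A = Mul a b1].
Proof.
move=> H; inversion H as [|? ?|? ? a1 a2 ?|? ? b1 b2 ?]; subst.
- by constructor 1.
- by constructor 2; exists a2.
- by constructor 3; exists b1.
Qed.

Definition free : isys.
Proof.
refine (@ISys tree tsp _ _ _).
- move=> I A B C D H; elim: H C D => {I A B} [I A B IAB|a b|a b a1 a2 Ha IH|a b b1 b2 Hb IH] C D.
  + move=> /tsp_baseP[C' [D' [-> -> BCD]]]; have [E IE EA] := sp_assoc IAB BCD.
    by exists (Base E); constructor.
  + by move=> bCD; exists (Mul a C); constructor.
  + move=> /tsp_mulP[[-> ->]|[c Hc ->]|[b1 Hb ->]].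
    * by exists a; [constructor|].
    * by have [E aE EA] := IH _ _ Hc; exists E => //; constructor.
    * by exists (Mul a b1); [constructor|constructor].
  + by move=> /IH[E bE Eb]; exists (Mul a E); constructor.
- move=> I E D A C H; elim: H A C => {I E D} [I E D IED|a b|a b a1 a2 Ha IH|a b b1 b2 Hb IH] A C.
  + move=> /tsp_baseP[C' [D' [-> -> BCD]]]; have [E' IE EA] := sp_assoc' IED BCD.
    by exists (Base E'); constructor.
  + by move=> bCD; exists (Mul C b); constructor.
  + by move=> /IH[E bE Eb]; exists (Mul E b); constructor.
  + move=> /tsp_mulP[[-> ->]|[c Hc ->]|[b1' Hb' ->]].
    * by exists b; [constructor|].
    * by exists (Mul c b); [constructor|constructor].
    * by have [E aE EA] := IH _ _ Hb'; exists E => //; constructor.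
move=> I A B A' B' H; elim: H A' B' => {I A B} [I A B IAB|a b|a b a1 a2 Ha IH|a b b1 b2 Hb IH] A' B'.
- move=> /tsp_baseP[C' [D' [-> -> /(sp_cmp IAB)[[-> ->]|[C ? ?]|[C ? ?]]]]].
  + by constructor 1.
  + by constructor 2; exists (Base C); constructor.
  + by constructor 3; exists (Base C); constructor.
- move=> /tsp_mulP[[-> ->]|[c Hc ->]|[b1 Hb ->]].
  + by constructor 1.
  + by constructor 3; exists c => //; constructor.
  + by constructor 2; exists b1 => //; constructor.
- move=> /tsp_mulP[[-> ->]|[c Hc ->]|[b1 Hb ->]].
  + by constructor 2; exists a2 => //; constructor.
  + case: (IH _ _ Hc) => [[-> ->]|[C ? ?]|[C ? ?]].
    * by constructor 1.
    * by constructor 2; exists C => //; constructor.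
    * by constructor 3; exists C => //; constructor.
  + by constructor 2; exists (Mul a2 b1); constructor.
- move=> /tsp_mulP[[-> ->]|[c Hc ->]|[b1' Hb' ->]].
  + by constructor 3; exists b1 => //; constructor.
  + by constructor 3; exists (Mul c b1); constructor.
  + case: (IH _ _ Hb') => [[-> ->]|[C ? ?]|[C ? ?]].
    * by constructor 1.
    * by constructor 2; exists C => //; constructor.
    * by constructor 3; exists C => //; constructor.
Defined.

Lemma free_mul (a b : free) : sp (Mul a b : free) a b.
Proof. exact: tsp_mid. Qed.

Lemma base_beq (I : X) : beq I (Base I : free).
Proof.
exists (fun I t => t = Base I) => // {}I _ ->; split=> A B.
  by move=> IAB; exists (Base A), (Base B); split=> //; constructor.
by move=> /tsp_baseP[A' [B' [-> -> IAB]]]; exists A', B'.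
Qed.

Lemma free_enum (e : nat -> X) : (forall x, exists i, e i = x) ->
  exists e' : nat -> free, forall t, exists i, e' i = t.
Proof.
move=> he.
pose dec := fix dec (t : GenTree.tree nat) : tree := match t with
  | GenTree.Leaf n => Base (e n)
  | GenTree.Node _ [:: a; b] => Mul (dec a) (dec b)
  | _ => Base (e 0) end.
exists (fun i => if unpickle i is Some t then dec t else Base (e 0)).
have H t : exists u, dec u = t.
  elim: t => [x|a [u <-] b [v <-]]; last by exists (GenTree.Node 0 [:: u; v]).
  by have [i <-] := he x; exists (GenTree.Leaf i).
by move=> t; have [u <-] := H t; exists (pickle u); rewrite pickleK.
Qed.

End Trees.

(** * Conditions and their refinements *)

Section Conditions.
Variables (K : isys) (mul : K -> K -> K) (mulP : forall a b, sp (mul a b) a b).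
Variables (k0 : K) (beta : ord).

Fixpoint sumK (w : seq K) : K :=
  if w is a :: w' then (if w' is [::] then a else mul a (sumK w')) else k0.

Lemma spn_sumK w : w <> [::] -> spn (sumK w) w.
Proof.
elim: w => // a [|b w] IH _; first exact: spn1.
exact: spnS (mulP _ _) (IH _).
Qed.

(** The larger condition is the stronger one. A promise [A] may be traded for a nonempty block of
    promises whose sum lies above [A], as when points are added inside the gap. *)
Inductive rle : seq K -> seq K -> Prop :=
| rle_nil : rle [::] [::]
| rle_cons A p t r : t <> [::] -> ile beta A (sumK t) -> rle p r -> rle (A :: p) (t ++ r).

Lemma rle_refl p : rle p p.
Proof.
elim: p => [|A p IH]; first exact: rle_nil.
by apply: (@rle_cons A p [:: A]) => //; apply: ile_refl.
Qed.

Lemma rle_cat p q p' q' : rle p p' -> rle q q' -> rle (p ++ q) (p' ++ q').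
Proof.
move=> pp' qq'; elim: pp' => //= A {}p t r t0 At _ IH.
by rewrite -catA; apply: rle_cons.
Qed.

Lemma rle_cat_inv p q r : rle (p ++ q) r ->
  exists r1 r2, [/\ r = r1 ++ r2, rle p r1 & rle q r2].
Proof.
elim: p r => [|A p IH] r /= H; first by exists [::], r; split=> //; apply: rle_nil.
inversion H as [|A' p' t r' t0 At Hr]; subst.
have [r1 [r2 [-> pr1 qr2]]] := IH _ Hr.
by exists (t ++ r1), r2; rewrite catA; split=> //; apply: rle_cons.
Qed.

Lemma rle_neq0 p r : rle p r -> p <> [::] -> r <> [::].
Proof. by case=> // A q [|b t] s. Qed.

Lemma rle_neq0r p r : rle p r -> r <> [::] -> p <> [::].
Proof. by case. Qed.

Lemma rle_groups p r : rle p r -> exists2 rs, r = flatten rs &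
  Forall2 (fun A t => t <> [::] /\ ile beta A (sumK t)) p rs.
Proof.
elim=> [|A q t s t0 At _ [rs -> H]]; first by exists [::].
by exists (t :: rs) => //; constructor.
Qed.

Lemma groups_rle p rs :
  Forall2 (fun A t => t <> [::] /\ ile beta A (sumK t)) p rs -> rle p (flatten rs).
Proof.
by elim=> [|A t q s [t0 At] _ IH] /=; [exact: rle_nil|exact: rle_cons].
Qed.

Lemma forall2_refl (R : K -> K -> Prop) (w : seq K) : (forall x, R x x) -> Forall2 R w w.
Proof. by move=> H; elim: w => *; constructor. Qed.

Lemma ile_spn_eq a (I J : K) w : spn I w -> spn J w -> ile a I J.
Proof.
by move=> Iw Jw; apply: ile_spn Iw Jw _; apply: forall2_refl => x; apply: ile_refl.
Qed.

(** The two sums differ only in bracketing: [flatten rs] splits both, and a common splitting makes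
    them equivalent at every level. *)
Lemma sumK_groups a rs : rs <> [::] -> (forall t, List.In t rs -> t <> [::]) ->
  ile a (sumK [seq sumK t | t <- rs]) (sumK (flatten rs)) /\
  ile a (sumK (flatten rs)) (sumK [seq sumK t | t <- rs]).
Proof.
move=> rs0 Hrs.
have H1 : spn (sumK [seq sumK t | t <- rs]) (flatten rs).
  apply: (@spn_flatten _ _ [seq sumK t | t <- rs]).
    by apply: spn_sumK; case: (rs) rs0.
  elim: rs Hrs {rs0} => [|t rs IH] Hrs /=; constructor.
    by apply: spn_sumK; apply: Hrs; left.
  by apply: IH => t' Ht'; apply: Hrs; right.
have H2 : spn (sumK (flatten rs)) (flatten rs).
  by apply: spn_sumK; apply: spn_neq0 H1.
by split; apply: ile_spn_eq; [exact: H1|exact: H2|exact: H2|exact: H1].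
Qed.

Lemma sumK_mono a p rs : p <> [::] ->
  Forall2 (fun A t => t <> [::] /\ ile a A (sumK t)) p rs ->
  ile a (sumK p) (sumK (flatten rs)).
Proof.
move=> p0 H; apply: (@ile_trans _ _ _ _ _ (sumK [seq sumK t | t <- rs])).
  apply: ile_spn (spn_sumK p0) (_ : spn _ [seq sumK t | t <- rs]) _.
    by apply: spn_sumK; case: H p0.
  by elim: H => [|A t q s [_ At] _ IH] /=; constructor.
apply: (sumK_groups _ _ _).1; first by case: H p0.
elim: H {p0} => [|A t q s [t0 _] _ IH] t' //= [<- //|]; exact: IH.
Qed.

Lemma rle_sumK p r : rle p r -> p <> [::] -> ile beta (sumK p) (sumK r).
Proof. by move=> /rle_groups[rs -> H] p0; apply: sumK_mono. Qed.

Lemma rle_trans p q r : rle p q -> rle q r -> rle p r.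
Proof.
move=> pq; elim: pq r => [|A s t u t0 At _ IH] r //.
move=> /rle_cat_inv[r1 [r2 [-> tr1 /IH sr2]]]; apply: rle_cons => //.
  exact: rle_neq0 tr1 t0.
exact: ile_trans At (rle_sumK tr1 t0).
Qed.

(** Take a common refinement of the splittings [q] and [w] of the same sum. Grouped along [q] it is
    a stronger condition; grouped along [w] it has the pieces of [w] as sums. *)
Lemma rle_split q w : q <> [::] -> spn (sumK q) w ->
  exists rs, [/\ rle q (flatten rs), forall t, List.In t rs -> t <> [::] &
    Forall2 (fun x t => forall a, ile a x (sumK t) /\ ile a (sumK t) x) w rs].
Proof.
move=> q0 qw; have [qs [ws [Hq Hw E]]] := spn_common (spn_sumK q0) qw.
have eqv (x : K) t : spn x t -> t <> [::] /\ forall a, ile a x (sumK t) /\ ile a (sumK t) x.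
  move=> xt; have t0 := spn_neq0 xt; split=> // a.
  by split; apply: ile_spn_eq; [exact: xt|exact: spn_sumK|exact: spn_sumK|exact: xt].
exists ws; split.
- rewrite -E; apply: groups_rle; apply: List.Forall2_impl Hq => x t /eqv[t0 /(_ beta)[]].
  by [].
- by elim: Hw {E} => [|x t w' ts /eqv[t0 _] _ IH] t' //= [<- //|]; exact: IH.
- by apply: List.Forall2_impl Hw => x t /eqv[].
Qed.

Definition comp p q := exists2 r, rle p r & rle q r.

(* A complete condition decides every other one, up to refinement. *)
Definition compl q := forall p p', comp p q -> comp p' q -> comp p p'.

End Conditions.

HB.instance Definition _ (K : isys) := gen_eqMixin (ival K).

(** * Finite labelled approximations of a linear order *)

Section States.
Local Open Scope ring_scope.
Variables (K : isys) (mul : K -> K -> K) (mulP : forall a b, sp (mul a b) a b).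
Variables (k0 : K) (beta : ord).

Notation sumK := (sumK mul k0).
Notation rle := (rle mul k0 beta).

(* A pair [(x, A)] promises an interval lying above [A] between [x] and the next
   listed point, or [1]. *)
Definition state := seq (rat * K).
Implicit Types (s : state) (l u x y : rat).

Definition srt s := pairwise (fun p q : rat * K => p.1 < q.1) s.

Definition pts s := [seq p.1 | p <- s].

(** The point 0 is always listed and stands for the left end of the order. The number 1 stands for
    the right end and is never listed. *)
Definition wf s := [&& srt s, all (fun p => 0 <= p.1 < 1) s & 0 \in pts s].

Definition gl s l u : seq K := [seq p.2 | p <- s & (l <= p.1) && (p.1 < u)].

Definition endp s u := (u == 1) || (u \in pts s).

Definition ext s s' := {subset pts s <= pts s'} /\
  forall l u, l \in pts s -> endp s u -> l < u -> rle (gl s l u) (gl s' l u).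

Lemma gl_cat s1 s2 l u : gl (s1 ++ s2) l u = gl s1 l u ++ gl s2 l u.
Proof. by rewrite /gl filter_cat map_cat. Qed.

Lemma gl_none s l u : all (fun p => (p.1 < l) || (u <= p.1)) s -> gl s l u = [::].
Proof.
rewrite /gl; elim: s => //= p s IH /andP[H /IH].
by case: ifP => // /andP[lp pu]; move: H; rewrite ltNge lp leNgt pu.
Qed.

Lemma gl_all s l u : all (fun p => (l <= p.1) && (p.1 < u)) s -> gl s l u = [seq p.2 | p <- s].
Proof. by move=> /all_filterP; rewrite /gl => ->. Qed.

Lemma srt_split s x : srt s -> exists s1 s2, [/\ s = s1 ++ s2,
  all (fun p => p.1 < x) s1 & all (fun p => x <= p.1) s2].
Proof.
rewrite /srt; elim: s => [|p s IH] /=; first by exists [::], [::].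
move=> /andP[ps /IH[s1 [s2 [sE H1 H2]]]]; subst s.
have [px|xp] := ltP p.1 x; first by exists (p :: s1), s2; rewrite /= px.
exists [::], (p :: s1 ++ s2); split=> //=; rewrite xp /=.
by apply: sub_all ps => q pq; apply: le_trans xp (ltW pq).
Qed.

Lemma gl_split s l x u : srt s -> l <= x -> x <= u -> gl s l u = gl s l x ++ gl s x u.
Proof.
move=> /(srt_split x)[s1 [s2 [-> H1 H2]]] lx xu; rewrite !gl_cat.
rewrite [gl s2 l x]gl_none; last by apply: sub_all H2 => p ->; rewrite orbT.
rewrite [gl s1 x u]gl_none; last by apply: sub_all H1 => p ->.
rewrite cats0 /=; congr (_ ++ _); rewrite /gl; congr map; apply: eq_in_filter => p.
  move=> /(allP H1) px; rewrite px; have -> // : p.1 < u by apply: lt_le_trans px xu.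
by move=> /(allP H2) xp; rewrite xp (le_trans lx xp).
Qed.

Lemma gl_decomp s l u r1 r2 : srt s -> gl s l u = r1 ++ r2 ->
  r1 <> [::] -> r2 <> [::] ->
  exists2 x, x \in pts s & [/\ l < x, x < u, gl s l x = r1 & gl s x u = r2].
Proof.
move=> ss; rewrite /gl; set f := filter _ s => E r10 r20.
have Ef : f = take (size r1) f ++ drop (size r1) f by rewrite cat_take_drop.
have E1 : [seq p.2 | p <- take (size r1) f] = r1 by rewrite map_take E take_size_cat.
have E2 : [seq p.2 | p <- drop (size r1) f] = r2 by rewrite map_drop E drop_size_cat.
case D : (drop (size r1) f) E2 Ef => [|q f2]; first by move=> /= r2E; case: r20.
case T : (take (size r1) f) E1 => [|p f1]; first by move=> /= r1E; case: r10.
move=> E1 E2 Ef.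
have sf : srt f by apply: subseq_pairwise ss; apply: filter_subseq.
have inf p' : p' \in f -> [/\ p' \in s, l <= p'.1 & p'.1 < u].
  by rewrite mem_filter => /andP[/andP[? ?] ?].
have [qs lq qu] : [/\ q \in s, l <= q.1 & q.1 < u].
  by apply: inf; rewrite Ef mem_cat mem_head orbT.
have [ps lp pu] : [/\ p \in s, l <= p.1 & p.1 < u].
  by apply: inf; rewrite Ef mem_cat mem_head.
move: (sf); rewrite /srt Ef pairwise_cat => /and3P[/allrelP H12 _ /= /andP[Hq _]].
have lqs : l < q.1 by apply: le_lt_trans lp _; apply: H12; rewrite mem_head.
exists q.1; first by apply: map_f.
have F1 : [seq p <- s | (l <= p.1) && (p.1 < q.1)] = p :: f1.
  have -> : [seq p <- s | (l <= p.1) && (p.1 < q.1)] = [seq p <- f | p.1 < q.1].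
    rewrite /f -filter_predI; apply: eq_filter => t /=.
    by have [tq|] := boolP (t.1 < q.1); rewrite ?andbF ?andbT//= (lt_trans tq qu) andbT.
  rewrite Ef filter_cat (all_filterP _); last by apply/allP => t /H12; apply; rewrite mem_head.
  rewrite /= ltxx (eq_in_filter (_ : {in f2, _ =1 pred0})) ?filter_pred0 ?cats0//.
  by move=> t /(allP Hq) /ltW; rewrite leNgt => /negbTE.
have F2 : [seq p <- s | (q.1 <= p.1) && (p.1 < u)] = q :: f2.
  have -> : [seq p <- s | (q.1 <= p.1) && (p.1 < u)] = [seq p <- f | q.1 <= p.1].
    rewrite /f -filter_predI; apply: eq_filter => t /=.
    by have [tq|] := boolP (q.1 <= t.1); rewrite ?andbF//= (le_trans lq tq).
  rewrite Ef filter_cat (eq_in_filter (_ : {in p :: f1, _ =1 pred0})); last first.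
    by move=> t /H12/(_ (mem_head _ _)); rewrite ltNge => /negbTE.
  rewrite filter_pred0 /= lexx; congr cons; apply/all_filterP.
  by apply: sub_all Hq => t /ltW.
by split=> //; rewrite ?F1 ?F2 -?E1 -?E2.
Qed.

Lemma ext_refl s : ext s s.
Proof. by split=> // *; apply: rle_refl. Qed.

Lemma ext_endp s s' u : ext s s' -> endp s u -> endp s' u.
Proof. by move=> [H _] /orP[/eqP ->|/H]; rewrite /endp ?eqxx// => ->; rewrite orbT. Qed.

Lemma ext_trans s1 s2 s3 : ext s1 s2 -> ext s2 s3 -> ext s1 s3.
Proof.
move=> E12 E23; split=> [x /E12.1 /E23.1 //|l u ls us lu].
apply: (rle_trans mulP) (E12.2 _ _ ls us lu) (E23.2 _ _ (E12.1 _ ls) _ lu).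
exact: ext_endp E12 us.
Qed.

Lemma ext_relabel s1 x A B s2 : ile beta A B -> wf (s1 ++ (x, A) :: s2) ->
  wf (s1 ++ (x, B) :: s2) /\ ext (s1 ++ (x, A) :: s2) (s1 ++ (x, B) :: s2).
Proof.
move=> AB; have Ep : pts (s1 ++ (x, B) :: s2) = pts (s1 ++ (x, A) :: s2).
  by rewrite /pts !map_cat.
move=> H; split.
  move: H; rewrite /wf Ep => /and3P[H1 H2 ->]; rewrite andbT.
  apply/andP; split; last by move: H2; rewrite !all_cat.
  move: H1; rewrite /srt !pairwise_cat /= => /and3P[H1 -> ->].
  by rewrite !andbT; move/allrelP: H1 => H1; apply/allrelP => p q ps1;
    rewrite inE => /orP[/eqP ->|qs2]; [apply: (H1 p (x, A)); rewrite ?mem_head|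
      apply: H1; rewrite // inE qs2 orbT].
split=> [y|l u _ _ _]; first by rewrite Ep.
rewrite !gl_cat; apply: rle_cat; first exact: rle_refl.
rewrite -[(x, A) :: s2]cat1s -[(x, B) :: s2]cat1s !gl_cat.
apply: rle_cat; last exact: rle_refl.
rewrite /gl /=; case: ifP => _ /=; last exact: rle_refl.
by apply: (@rle_cons _ _ _ _ A [::] [:: B] [::]) => //; apply: rle_nil.
Qed.

Lemma ext_insert s1 x A B C y s2 : ile beta A (mul B C) ->
  wf (s1 ++ (x, A) :: s2) -> x < y -> y < 1 -> all (fun p => y < p.1) s2 ->
  wf (s1 ++ (x, B) :: (y, C) :: s2) /\
  ext (s1 ++ (x, A) :: s2) (s1 ++ (x, B) :: (y, C) :: s2).
Proof.
move=> ABC /and3P[H1 H2 H3] xy y1 ys2.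
move: (H1); rewrite /srt pairwise_cat /= => /and3P[/allrelP R1 P1 /andP[R2 P2]].
have s1x : all (fun p => p.1 < x) s1.
  by apply/allP => p ps; apply: (R1 p (x, A)); rewrite // mem_head.
have x0 : 0 <= x by move: H2; rewrite all_cat /= => /and3P[_ /andP[]].
split.
  apply/and3P; split.
  - rewrite /srt pairwise_cat /= P1 P2 ys2 R2 xy /= !andbT.
    apply/allrelP => p q ps1; have px := allP s1x _ ps1.
    rewrite !inE => /or3P[/eqP -> //|/eqP ->|qs2]; first exact: lt_trans px xy.
    by apply: R1; rewrite // inE qs2 orbT.
  - move: H2; rewrite !all_cat /= => /and3P[-> -> ->] /=.
    by rewrite y1 (le_trans x0 (ltW xy)).
  - by move: H3; rewrite /pts !map_cat !mem_cat /= !inE => /or3P[->|->|->]; rewrite ?orbT.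
split=> [z|l u ls us lu].
  by rewrite /pts !map_cat !mem_cat /= !inE => /or3P[->|->|->]; rewrite ?orbT.
(* No listed point exceeds [x] without exceeding [y], so the ends of an older interval compare with
   [y] as they do with [x]. *)
have cmpxy z : z \in pts (s1 ++ (x, A) :: s2) -> (z <= y) = (z <= x) /\ (y < z) = (x < z).
  rewrite /pts map_cat mem_cat /= inE => /or3P[/mapP[p ps1 ->]|/eqP ->|/mapP[p ps2 ->]].
  - have px := allP s1x _ ps1.
    rewrite !(ltW px) (ltW (lt_trans px xy)); split=> //.
    by rewrite !ltNge !(ltW px) (ltW (lt_trans px xy)).
  - by rewrite lexx (ltW xy) ltxx ltNge (ltW xy).
  - have yp := allP ys2 _ ps2; rewrite yp (lt_trans xy yp); split=> //.
    by rewrite !leNgt yp (lt_trans xy yp).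
have yu : (y < u) = (x < u).
  case/orP: us => [/eqP ->|/cmpxy[]//]; by rewrite y1 (lt_trans xy y1).
rewrite !gl_cat; apply: rle_cat; first exact: rle_refl.
rewrite -[(x, A) :: s2]cat1s -[(x, B) :: _]cat1s -[(y, C) :: s2]cat1s !gl_cat catA.
apply: rle_cat; last exact: rle_refl.
rewrite /gl /= (cmpxy _ ls).1 yu; case: ifP => _ /=; last exact: rle_refl.
by apply: (@rle_cons _ _ _ _ A [::] [:: B; C] [::]) => //; apply: rle_nil.
Qed.

Lemma ext_spread s1 x A s2 y t : t <> [::] -> ile beta A (sumK t) ->
  wf (s1 ++ (x, A) :: s2) -> x < y -> y <= 1 -> all (fun p => y <= p.1) s2 ->
  exists b, [/\ wf (s1 ++ b ++ s2), ext (s1 ++ (x, A) :: s2) (s1 ++ b ++ s2),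
    [seq p.2 | p <- b] = t & all (fun p => (x <= p.1) && (p.1 < y)) b].
Proof.
elim: t s1 x A => // B t IH s1 x A _; case: t IH => [|C t] IH /= AB Hwf xy y1 ys2.
  exists [:: (x, B)]; have [H1 H2] := ext_relabel AB Hwf; split=> //=.
  by rewrite lexx xy.
(* The midpoint carries the sum of the remaining labels and leaves room before [y] to spread
   them. *)
pose z := (x + y) / 2; have [xz zy] : x < z /\ z < y by rewrite /z; split; lra.
have zs2 : all (fun p => z < p.1) s2.
  by apply: sub_all ys2 => p; apply: lt_le_trans.
have [W E] := ext_insert AB Hwf xz (lt_le_trans zy y1) zs2.
have := IH (s1 ++ [:: (x, B)]) z (sumK (C :: t)).
rewrite -!catA /= => /(_ _ (ile_refl _ _) W zy y1 ys2)[//|b [Wb Eb bE Hb]].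
rewrite -!catA /= in Wb Eb; exists ((x, B) :: b); split=> //.
- exact: ext_trans E Eb.
- by rewrite /= bE.
rewrite /= lexx xy; apply: sub_all Hb => p /andP[zp ->].
by rewrite (le_trans (ltW xz) zp).
Qed.

Lemma ext_block s1 s2 s3 l u r : rle [seq p.2 | p <- s2] r ->
  wf (s1 ++ s2 ++ s3) -> all (fun p => (l <= p.1) && (p.1 < u)) s2 -> u <= 1 ->
  all (fun p => u <= p.1) s3 ->
  exists b, [/\ wf (s1 ++ b ++ s3), ext (s1 ++ s2 ++ s3) (s1 ++ b ++ s3),
    [seq p.2 | p <- b] = r & all (fun p => (l <= p.1) && (p.1 < u)) b].
Proof.
elim: s2 s1 r => [|[x A] s2 IH] s1 r /= H.
  by move=> *; exists [::]; split=> //; [exact: ext_refl|inversion H].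
inversion H as [|A' p t r' t0 At Hr]; subst => W /andP[/andP[lx xu] Hs2] u1 us3.
(* The next listed point of the block, or its right end; the points that replace the label [A] must
   stay before it. *)
pose y := head u (pts s2).
have [ss _ _] := and3P W; move: ss; rewrite /srt pairwise_cat /= => /and3P[_ _ /andP[xs ss]].
have [xy yu] : x < y /\ y <= u.
  rewrite /y; case: (s2) xs Hs2 => [|[x2 B] s2'] /=; first by split.
  by move=> /andP[-> _] /andP[/andP[_ /ltW]].
have ys : all (fun p => y <= p.1) (s2 ++ s3).
  rewrite all_cat; apply/andP; split; last by apply: sub_all us3 => p; apply: le_trans.
  move: ss; rewrite pairwise_cat /y => /and3P[_ ss _].
  case: (s2) ss => //= q s2' /andP[qs _]; rewrite lexx /=.
  by apply: sub_all qs => p /ltW.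
have [b1 [W1 E1 b1t Hb1]] := ext_spread t0 At W xy (le_trans yu u1) ys.
have Wc : wf ((s1 ++ b1) ++ s2 ++ s3) by rewrite -catA.
have [b2 [W2 E2 b2r Hb2]] := IH (s1 ++ b1) _ Hr Wc Hs2 u1 us3.
exists (b1 ++ b2); rewrite -!catA in W2 E2 *; split=> //.
- exact: ext_trans E1 E2.
- by rewrite map_cat b1t b2r.
- rewrite all_cat Hb2 andbT; apply: sub_all Hb1 => p /andP[xp py].
  by rewrite (le_trans lx xp) (lt_le_trans py yu).
Qed.

(** Every strengthening of the promises inside one interval can be attained without touching the
    promises outside it. Mutual genericity of disjoint intervals rests on this. *)
Lemma ext_realize s l u r : wf s -> l < u -> u <= 1 -> rle (gl s l u) r ->
  exists s', [/\ wf s', ext s s', gl s' l u = r &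
    forall l' u', u' <= l \/ u <= l' -> gl s' l' u' = gl s l' u'].
Proof.
move=> W lu u1; have [ss _ _] := and3P W.
have [s1 [s23 [sE H1 H23]]] := srt_split l ss.
have [|s2 [s3 [sE' H2 H3]]] := @srt_split s23 u.
  by move: ss; rewrite sE /srt pairwise_cat => /and3P[].
move: H23; rewrite sE' all_cat => /andP[H2' H3'].
have H2l : all (fun p => (l <= p.1) && (p.1 < u)) s2.
  by apply/allP => p ps; rewrite (allP H2' _ ps) (allP H2 _ ps).
have G b : all (fun p => (l <= p.1) && (p.1 < u)) b ->
    gl (s1 ++ b ++ s3) l u = [seq p.2 | p <- b].
  move=> Hb; rewrite !gl_cat (gl_all Hb) gl_none; last by apply: sub_all H1 => p ->.
  rewrite [gl s3 _ _]gl_none ?cats0//; by apply: sub_all H3 => p ->; rewrite orbT.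
rewrite sE sE' (G _ H2l) => Hr; rewrite sE sE' in W.
have [b [Wb Eb br Hb]] := ext_block Hr W H2l u1 H3.
exists (s1 ++ b ++ s3); split=> //; first by rewrite G.
move=> l' u' H; have N c : all (fun p => (l <= p.1) && (p.1 < u)) c -> gl c l' u' = [::].
  move=> Hc; apply: gl_none; apply: sub_all Hc => p /andP[lp pu].
  case: H => [u'l|ul']; first by rewrite (le_trans u'l lp) orbT.
  by rewrite (lt_le_trans pu ul').
by rewrite !gl_cat (N _ Hb) (N _ H2l).
Qed.

Section Chain.
Variables (D : nat -> seq K -> seq K -> Prop) (s0 : state) (s0_wf : wf s0).

Definition meets (q : rat * rat * rat * rat * nat) s :=
  let: (l1, u1, l2, u2, d) := q in
  [/\ (l1 \in pts s) && (l2 \in pts s), endp s u1 && endp s u2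
    & D d (gl s l1 u1) (gl s l2 u2)].

(** At its stage a requirement is met if some extension meets it; otherwise it is excluded for good.
    So each requirement is decided, which is all the genericity used later. *)
Lemma generic_chain : exists st : nat -> state,
  [/\ st 0 = s0, forall i, wf (st i), forall i j, (i <= j)%N -> ext (st i) (st j) &
    forall q, exists i, meets q (st i) \/
      forall s', wf s' -> ext (st i) s' -> ~ meets q s'].
Proof.
have step (i : nat) (s : {s | wf s}) : exists s' : {s | wf s}, ext (sval s) (sval s') /\
    forall q, unpickle i = Some q -> meets q (sval s') \/
      forall s'', wf s'' -> ext (sval s') s'' -> ~ meets q s''.
  case Ei : (unpickle i) => [q|]; last by exists s; split=> //; exact: ext_refl.
  have [[s' [W [E M]]]|H] := pselect (exists s', wf s' /\ ext (sval s) s' /\ meets q s').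
    by exists (exist _ s' W); split=> // _ [<-]; left.
  exists s; split; first exact: ext_refl.
  by move=> _ [<-]; right => s'' W E M; apply: H; exists s''.
pose st := fix st i := if i is i'.+1 then projT1 (cid (step i' (st i'))) else exist _ s0 s0_wf.
have stS i := projT2 (cid (step i (st i))).
exists (fun i => sval (st i)); split=> //.
- by move=> i; case: (st i).
- move=> i j; elim: j => [|j IH]; first by rewrite leqn0 => /eqP ->; exact: ext_refl.
  rewrite leq_eqVlt => /orP[/eqP ->|ij]; first exact: ext_refl.
  exact: ext_trans (IH ij) (stS j).1.
- move=> q; exists (pickle q).+1; apply: (stS (pickle q)).2.
  exact: pickleK.
Qed.

End Chain.
End States.

(** * Absorption of repeated intervals *)

Section Shift.
Variable X : isys.
Implicit Types (I J A B C D : X).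

(** [V 0] begins with omega copies of [e 0]. Whatever follows these copies belongs to every
    [V n]. *)
Definition omega_sum (V e : nat -> X) :=
  (forall n, sp (V n) (e n) (V n.+1)) /\ (forall n, beq (e n) (e n.+1)).

Lemma omega_sumS V e : omega_sum V e -> omega_sum (fun n => V n.+1) (fun n => e n.+1).
Proof. by move=> [H1 H2]; split=> n. Qed.

Definition shiftR I J := exists V e, [/\ omega_sum V e, I = V 0 & J = V 1].

(** The third form arises from a cut inside a summand: the rest of this summand is followed by a
    tail that still has to be shifted. *)
Definition shiftRp I J := [\/ beq I J, shiftR I J |
  exists A B A' B', [/\ sp I A B, sp J A' B', beq A A' & shiftR B B']].

(* The split [(B, C)] of [V 0] falls inside one of the summands [e m]. *)
Inductive reaches : (nat -> X) -> (nat -> X) -> X -> X -> Prop :=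
| reach_eq V e : reaches V e (e 0) (V 1)
| reach_in V e B C D : sp (e 0) B D -> sp C D (V 1) -> reaches V e B C
| reach_S V e B C D : sp B (e 0) D ->
    reaches (fun n => V n.+1) (fun n => e n.+1) D C -> reaches V e B C.

(** A cut in one summand of [V 0] is answered in the next summand, so the part of [V 1] to its left,
    which lacks [e 0], again has the right number of copies. *)
Lemma reaches_forth V e B C : omega_sum V e -> reaches V e B C ->
  exists B' C', [/\ sp (V 1) B' C', beq B B' & shiftRp C C'].
Proof.
move=> + H; elim: H => {V e B C} [V e|V e B C D eBD CD|V e B C D BD _ IH] Ve.
- exists (e 1), (V 2); split; [exact: Ve.1|exact: Ve.2|constructor 2].
  by exists (fun n => V n.+1), (fun n => e n.+1); split=> //; apply: omega_sumS.
- have [/(_ _ _ eBD)[B' [D' [eBD' BB' DD']]] _] := beq_bisim (Ve.2 0).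
  have [C' VC' C'D'] := sp_assoc' (Ve.1 1) eBD'.
  exists B', C'; split=> //; constructor 3; exists D, (V 1), D', (V 2); split=> //.
  by exists (fun n => V n.+1), (fun n => e n.+1); split=> //; apply: omega_sumS.
- have [D' [C' [VD' DD' CC']]] := IH (omega_sumS Ve).
  have [E VE ED] := sp_assoc (Ve.1 1) VD'.
  by exists E, C'; split=> //; apply: beq_sp BD ED (Ve.2 0) DD'.
Qed.

Lemma reaches_back V e B' C' : omega_sum V e ->
  reaches (fun n => V n.+1) (fun n => e n.+1) B' C' ->
  exists B C, [/\ sp (V 0) B C, beq B B' & shiftRp C C'].
Proof.
move=> + H; move: H; set V1 := fun n => V n.+1; set e1 := fun n => e n.+1.
move EV : V1 => W; move Ee : e1 => f H.
elim: H V e @V1 @e1 EV Ee => {W f B' C'} [W f|W f B' C' D' eBD CD|W f B' C' D' BD _ IH]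
  V e /= EV Ee Ve; subst W f.
- exists (e 0), (V 1); split; [exact: Ve.1|exact: Ve.2|constructor 2].
  by exists (fun n => V n.+1), (fun n => e n.+1); split=> //; apply: omega_sumS.
- have [_ /(_ _ _ eBD)[B [D [eBD' BB' DD']]]] := beq_bisim (Ve.2 0).
  have [C VC CD'] := sp_assoc' (Ve.1 0) eBD'.
  exists B, C; split=> //; constructor 3; exists D, (V 1), D', (V 2); split=> //.
  by exists (fun n => V n.+1), (fun n => e n.+1); split=> //; apply: omega_sumS.
- have [D [C [VD DD' CC']]] := IH _ _ erefl erefl (omega_sumS Ve).
  have [E VE ED] := sp_assoc (Ve.1 0) VD.
  by exists E, C; split=> //; apply: beq_sp ED BD (Ve.2 0) DD'.
Qed.

(** A cut beyond all summands lies to the right of the point after each [e n]. The part on its left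
    is therefore again an omega sum of the same [e], and the part [C] on its right is shared by all
    [V n]. *)
Lemma not_reaches V e B C : omega_sum V e -> sp (V 0) B C -> ~ reaches V e B C ->
  exists W, [/\ forall n, sp (W n) (e n) (W n.+1), W 0 = B & forall n, sp (V n) (W n) C].
Proof.
move=> Ve VBC nr.
pose T n := {W : X | sp (V n) W C /\ ~ reaches (fun k => V (n + k)) (fun k => e (n + k)) W C}.
have step n (W : T n) : exists W' : T n.+1, sp (sval W) (e n) (sval W').
  case: W => W [VW nW] /=.
  case: (sp_cmp VW (Ve.1 n)) => [[WE CE]|[D WD CD]|[D WD VD]].
  - case: nW; rewrite WE CE -{3}[n]addn0 -addn1.
    exact: (reach_eq (fun k => V (n + k)) (fun k => e (n + k))).
  - case: nW; apply: (@reach_in (fun k => V (n + k)) (fun k => e (n + k)) W C D).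
      by rewrite addn0.
    by rewrite addn1.
  - have nD : ~ reaches (fun k => V (n.+1 + k)) (fun k => e (n.+1 + k)) D C.
      move=> H; apply: nW.
      apply: (@reach_S (fun k => V (n + k)) (fun k => e (n + k)) W C D).
        by rewrite addn0.
      have E (f : nat -> X) : (fun k => f (n + k.+1)) = (fun k => f (n.+1 + k)).
        by apply/funext => k; rewrite addnS.
      by rewrite !E.
    by exists (exist _ D (conj VD nD)).
pose W0 : T 0 := exist _ B (conj VBC nr).
pose W := fix W n : T n := if n is n'.+1 then projT1 (cid (step n' (W n'))) else W0.
exists (fun n => sval (W n)); split=> //.
- by move=> n; exact: (projT2 (cid (step n (W n)))).
- by move=> n; case: (W n) => w [].
Qed.

Lemma shiftR_forth I J B C : shiftR I J -> sp I B C ->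
  exists B' C', [/\ sp J B' C', shiftRp B B' & shiftRp C C'].
Proof.
move=> [V [e [Ve -> ->]]] VBC; have [r|nr] := pselect (reaches V e B C).
  have [B' [C' [? ? ?]]] := reaches_forth Ve r.
  by exists B', C'; split=> //; constructor 1.
have [W [We WB VW]] := not_reaches Ve VBC nr.
exists (W 1), C; split; [exact: VW|constructor 2|constructor 1; exact: beq_refl].
by exists W, e; split=> //; split=> //; case: Ve.
Qed.

Lemma shiftR_back I J B' C' : shiftR I J -> sp J B' C' ->
  exists B C, [/\ sp I B C, shiftRp B B' & shiftRp C C'].
Proof.
move=> [V [e [Ve -> ->]]] VBC.
have [r|nr] := pselect (reaches (fun n => V n.+1) (fun n => e n.+1) B' C').
  have [B [C [? ? ?]]] := reaches_back Ve r.
  by exists B, C; split=> //; constructor 1.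
have [W [We WB VW]] := not_reaches (omega_sumS Ve) VBC nr.
(* The left part of the cut of [V 1] is an omega sum [W] that starts with [e 1]; [E] puts [e 0] in
   front of it. *)
have [E VE EW] := sp_assoc (Ve.1 0) (VW 0).
exists E, C'; split; [exact: VE|constructor 2|constructor 1; exact: beq_refl].
exists (fun n => if n is m.+1 then W m else E), e; split=> //.
by split; [case|case: Ve].
Qed.

Lemma shiftRp_sum I J A A' B B' : sp I A B -> sp J A' B' -> beq A A' ->
  shiftRp B B' -> shiftRp I J.
Proof.
move=> IAB JAB AA' [BB'|BB'|[C [D [C' [D' [BCD BCD' CC' DD']]]]]].
- by constructor 1; apply: beq_sp IAB JAB AA' BB'.
- by constructor 3; exists A, B, A', B'.
have [E IE EA] := sp_assoc IAB BCD; have [E' JE' EA'] := sp_assoc JAB BCD'.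
by constructor 3; exists E, D, E', D'; split=> //; apply: beq_sp EA EA' AA' CC'.
Qed.

Lemma beq_shift V e : omega_sum V e -> beq (V 0) (V 1).
Proof.
move=> Ve; exists shiftRp; last by constructor 2; exists V, e.
move=> I J [IJ|IJ|[A [B [A' [B' [IAB JAB AA' BB']]]]]].
- have [H1 H2] := beq_bisim IJ; split=> C D.
    by move=> /H1[C' [D' [? ? ?]]]; exists C', D'; split=> //; constructor 1.
  by move=> /H2[C' [D' [? ? ?]]]; exists C', D'; split=> //; constructor 1.
- by split=> C D; [exact: shiftR_forth|exact: shiftR_back].
split=> C D.
  move=> /(sp_cmp IAB)[[<- <-]|[E CAE BED]|[E AE BE]].
  - by exists A', B'; split=> //; [constructor 1|constructor 2].
  - have [E' [D' [BED' EE' DD']]] := shiftR_forth BB' BED.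
    have [C' JC CAE'] := sp_assoc JAB BED'.
    by exists C', D'; split=> //; apply: shiftRp_sum CAE CAE' AA' EE'.
  - have [/(_ _ _ AE)[C' [E' [AE' CC' EE']]] _] := beq_bisim AA'.
    have [D' JD DE'] := sp_assoc' JAB AE'.
    by exists C', D'; split=> //; [constructor 1|constructor 3; exists E, B, E', B'].
move=> /(sp_cmp JAB)[[<- <-]|[E CAE BED]|[E AE BE]].
- by exists A, B; split=> //; [constructor 1|constructor 2].
- have [E' [D' [BED' EE' DD']]] := shiftR_back BB' BED.
  have [C' JC CAE'] := sp_assoc IAB BED'.
  by exists C', D'; split=> //; apply: shiftRp_sum CAE' CAE AA' EE'.
- have [_ /(_ _ _ AE)[C' [E' [AE' CC' EE']]]] := beq_bisim AA'.
  have [D' JD DE'] := sp_assoc' IAB AE'.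
  by exists C', D'; split=> //; [constructor 1|constructor 3; exists E', B, E, B'].
Qed.

End Shift.

(** The reversed system, through which absorption on the left follows from absorption on the
    right. *)
Definition opp (X : isys) : isys.
Proof.
refine (@ISys X (fun I A B => sp I B A) _ _ _).
- by move=> I A B C D IAB BCD; have [E ? ?] := sp_assoc' IAB BCD; exists E.
- by move=> I E D A C IED EAC; have [B ? ?] := sp_assoc IED EAC; exists B.
- move=> I A B A' B' IAB IAB'; case: (sp_cmp IAB IAB') => [[-> ->]|[C ? ?]|[C ? ?]].
  + by constructor 1.
  + by constructor 3; exists C.
  + by constructor 2; exists C.
Defined.

Lemma beq_opp (X Y : isys) (I : X) (J : Y) : @beq (opp X) (opp Y) I J <-> beq I J.
Proof.
split=> -[R bR IJ]; exists R => // A B /bR[H1 H2]; split=> C D.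
- by move=> /(H1 D C)[D' [C' [? ? ?]]]; exists C', D'.
- by move=> /(H2 D C)[D' [C' [? ? ?]]]; exists C', D'.
- by move=> /(H1 D C)[D' [C' [? ? ?]]]; exists C', D'.
- by move=> /(H2 D C)[D' [C' [? ? ?]]]; exists C', D'.
Qed.

(** * Subintervals *)

Inductive sub (X : isys) (J : X) : X -> Prop :=
| sub_refl : sub J J
| sub_l I A B : sp I A B -> sub J A -> sub J I
| sub_r I A B : sp I A B -> sub J B -> sub J I.

Lemma sub_opp (X : isys) (I J : X) : @sub (opp X) I J <-> sub I J.
Proof.
split; elim=> [|J' A B JAB _ IH|J' A B JAB _ IH]; try exact: sub_refl.
- exact: (@sub_r X I J' B A).
- exact: (@sub_l X I J' B A).
- exact: (@sub_r (opp X) I J' B A).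
- exact: (@sub_l (opp X) I J' B A).
Qed.

Lemma sub_trans (X : isys) (I J K : X) : sub I J -> sub J K -> sub I K.
Proof.
move=> IJ; elim=> [//|K' A B KAB _ IH|K' A B KAB _ IH].
- exact: sub_l KAB IH.
- exact: sub_r KAB IH.
Qed.

Lemma sub_cut (X : isys) (I A B J : X) : sub J I -> sp I A B ->
  [\/ sub J A, sub J B | exists a b, [/\ sp J a b, sub a A & sub b B]].
Proof.
move=> JI; elim: JI A B => {I} [|I A0 B0 I0 JA IH|I A0 B0 I0 JB IH] A B IAB.
- by constructor 3; exists A, B; split=> //; apply: sub_refl.
- case: (sp_cmp IAB I0) => [[-> _]|[C AC BC]|[C AC BC]].
  + by constructor 1.
  + case: (IH _ _ AC) => [|JC|[a [b [Jab aA bC]]]].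
    * by constructor 1.
    * by constructor 2; apply: sub_l BC JC.
    * by constructor 3; exists a, b; split=> //; apply: sub_l BC bC.
  + by constructor 1; apply: sub_l AC JA.
- case: (sp_cmp IAB I0) => [[_ ->]|[C AC BC]|[C AC BC]].
  + by constructor 2.
  + by constructor 2; apply: sub_r BC JB.
  + case: (IH _ _ BC) => [JC|JB'|[a [b [Jab aC bB]]]].
    * by constructor 1; apply: sub_r AC JC.
    * by constructor 2.
    * by constructor 3; exists a, b; split=> //; apply: sub_r AC aC.
Qed.

(** * Generic assignments of conditions to intervals *)

Definition gcomp (C : Type) (le : C -> C -> Prop) p q := exists2 r, le p r & le q r.

Definition gcompl (C : Type) (le : C -> C -> Prop) q :=
  forall p p', gcomp le p q -> gcomp le p' q -> gcomp le p p'.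

(* [g_tp I p] says that the interval [I] meets the condition [p]; the last four
   laws express genericity. *)
Record gsys (X : isys) := GSys {
  gC : Type;
  cc : gC -> gC -> gC;
  gle : gC -> gC -> Prop;
  gtp : X -> gC -> Prop;
  gle_refl : forall p, gle p p;
  gle_trans : forall p q r, gle p q -> gle q r -> gle p r;
  gle_cc : forall p q p' q', gle p p' -> gle q q' -> gle (cc p q) (cc p' q');
  gle_ccV : forall p q r, gle (cc p q) r -> exists r1 r2,
    [/\ r = cc r1 r2, gle p r1 & gle q r2];
  gtp_le : forall I p q, gle p q -> gtp I q -> gtp I p;
  gtp_dir : forall I p q, gtp I p -> gtp I q -> exists r, [/\ gtp I r, gle p r & gle q r];
  gtp_valid : forall I A B, sp I A B -> (exists p, gtp A p) /\ (exists p, gtp B p);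
  gtp_cc : forall I A B p q, sp I A B -> gtp A p -> gtp B q -> gtp I (cc p q);
  gtp_ccV : forall I p q, gtp I (cc p q) -> exists A B, [/\ sp I A B, gtp A p & gtp B q];
  gtp_dec : forall I p, (exists q, gtp I q) -> gtp I p \/
    exists2 q, gtp I q & ~ gcomp gle p q;
  gtp_wild : forall I, (exists q, gtp I q) -> exists2 q, gtp I q &
    gcompl gle q \/ forall r, gle q r -> ~ gcompl gle r;
  gtp_absr : forall I A B, sp I A B -> exists a b, [/\ gtp A a, gtp B b &
    ~ gcomp gle b (cc a b) \/
    forall a' b', gle a a' -> gle b b' -> gcomp gle b' (cc a' b')];
  gtp_absl : forall I A B, sp I A B -> exists a b, [/\ gtp A a, gtp B b &
    ~ gcomp gle a (cc a b) \/
    forall a' b', gle a a' -> gle b b' -> gcomp gle a' (cc a' b')]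
}.
Arguments cc {X} g.
Arguments gle {X} g.
Arguments gtp {X} g.

Definition gopp (X : isys) (g : gsys X) : gsys (opp X).
Proof.
refine (@GSys (opp X) (gC g) (fun p q => cc g q p) (gle g) (gtp g) _ _ _ _ _ _ _ _ _ _ _ _ _).
- exact: gle_refl.
- exact: gle_trans.
- by move=> p q p' q' ? ?; apply: gle_cc.
- by move=> p q r /gle_ccV[r1 [r2 [? ? ?]]]; exists r2, r1.
- exact: (@gtp_le X g).
- exact: (@gtp_dir X g).
- by move=> I A B IAB; case: (@gtp_valid X g I B A IAB).
- by move=> I A B p q IAB Ap Bq; apply: (@gtp_cc X g I B A q p).
- by move=> I p q Ipq; have [A [B [? ? ?]]] := @gtp_ccV X g I q p Ipq; exists B, A.
- exact: (@gtp_dec X g).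
- exact: (@gtp_wild X g).
- move=> I A B IAB; have [b [a [? ? H]]] := @gtp_absl X g I B A IAB; exists a, b; split=> //.
  by case: H => [|H]; [left|right=> a' b' ? ?; apply: H].
- move=> I A B IAB; have [b [a [? ? H]]] := @gtp_absr X g I B A IAB; exists a, b; split=> //.
  by case: H => [|H]; [left|right=> a' b' ? ?; apply: H].
Defined.

Section Generic.
Variables (X : isys) (g : gsys X).
Implicit Types (I J A B : X) (p q r : gC g).

Notation "p || q" := (gcomp (gle g) p q).
Notation compl := (gcompl (gle g)).
Notation tp := (gtp g).

Definition valid I := exists p, tp I p.
Definition tpe I J := forall p, tp I p <-> tp J p.
(** Isolated, as for isolated types; not a notion of isomorphism. *)
Definition iso I := exists2 q, tp I q & compl q.
Definition her I := forall J, sub J I -> iso J.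

Lemma tp_comp I p q : tp I p -> tp I q -> p || q.
Proof. by move=> Ip Iq; have [r [_ ? ?]] := gtp_dir Ip Iq; exists r. Qed.

Lemma tp_max I J : valid I -> (forall p, tp I p -> tp J p) -> tpe I J.
Proof.
move=> vI IJ p; split=> [/IJ //|Jp]; have [//|[q /IJ Jq []]] := gtp_dec p vI.
exact: tp_comp Jp Jq.
Qed.

Lemma tpe_sym I J : tpe I J -> tpe J I.
Proof. by move=> IJ p; rewrite IJ. Qed.

(** All conditions met by [I] or by [J] are compatible with the complete [q], hence with each other.
    By [gtp_dec] neither interval can miss one that the other meets. *)
Lemma compl_tpe I J q : compl q -> tp I q -> tp J q -> tpe I J.
Proof.
move=> cq Iq Jq; apply: tp_max; first by exists q.
move=> p Ip; have [//|[q' Jq' []]] := gtp_dec p (ex_intro _ q Jq).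
by apply: cq; [exact: tp_comp Ip Iq|exact: tp_comp Jq' Jq].
Qed.

Lemma compl_le q r : compl q -> gle g q r -> compl r.
Proof.
by move=> cq qr p p' [m ? ?] [m' ? ?]; apply: cq; [exists m|exists m'] => //;
  apply: gle_trans qr _.
Qed.

Lemma compl_cc q q' : compl q -> compl q' -> compl (cc g q q').
Proof.
move=> cq cq' p p' [r pr /gle_ccV[r1 [r2 [rE q1 q2]]]] [s ps /gle_ccV[s1 [s2 [sE t1 t2]]]].
have [m1 rm1 sm1] : r1 || s1.
  by apply: cq; [exists r1|exists s1] => //; apply: gle_refl.
have [m2 rm2 sm2] : r2 || s2.
  by apply: cq'; [exists r2|exists s2] => //; apply: gle_refl.
exists (cc g m1 m2).
  by apply: gle_trans pr _; rewrite rE; apply: gle_cc.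
by apply: gle_trans ps _; rewrite sE; apply: gle_cc.
Qed.

Lemma iso_sp I A B : sp I A B -> iso A -> iso B -> iso I.
Proof.
move=> IAB [p Ap cp] [q Bq cq]; exists (cc g p q); last exact: compl_cc.
exact: gtp_cc IAB Ap Bq.
Qed.

Lemma her_iso I : her I -> iso I.
Proof. by apply; apply: sub_refl. Qed.

Lemma her_valid I : her I -> valid I.
Proof. by move=> /her_iso[q Iq _]; exists q. Qed.

Lemma her_sub I J : her I -> sub J I -> her J.
Proof. by move=> hI JI J' J'J; apply: hI; apply: sub_trans JI. Qed.

Lemma her_sp I A B : sp I A B -> her A -> her B -> her I.
Proof.
move=> IAB hA hB J /sub_cut/(_ IAB)[/hA //|/hB //|[a [b [Jab /hA ia /hB ib]]]].
exact: iso_sp Jab ia ib.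
Qed.

(** [w] occurs in the other condition as a consecutive part. This is how the conditions met by an
    interval record those met by its subintervals. *)
Inductive cont (w : gC g) : gC g -> Prop :=
| cont_refl : cont w w
| cont_l p q : cont w p -> cont w (cc g p q)
| cont_r p q : cont w q -> cont w (cc g p q).

Lemma sub_cont I J w : sub J I -> tp J w -> exists2 c, tp I c & cont w c.
Proof.
move=> + Jw; elim=> [|I' A B IAB _ [c Ac wc]|I' A B IAB _ [c Bc wc]].
- by exists w => //; apply: cont_refl.
- have [_ [b Bb]] := gtp_valid g IAB; exists (cc g c b); last exact: cont_l.
  exact: gtp_cc IAB Ac Bb.
- have [[a Aa] _] := gtp_valid g IAB; exists (cc g a c); last exact: cont_r.
  exact: gtp_cc IAB Aa Bc.
Qed.

Lemma cont_sub I w c : cont w c -> tp I c -> exists2 J, sub J I & tp J w.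
Proof.
move=> wc; elim: wc I => [|p q _ IH|p q _ IH] I.
- by exists I => //; apply: sub_refl.
- move=> /gtp_ccV[A [B [IAB /IH[J JA Jw] _]]]; exists J => //; exact: sub_l IAB JA.
- move=> /gtp_ccV[A [B [IAB _ /IH[J JB Jw]]]]; exists J => //; exact: sub_r IAB JB.
Qed.

Lemma sub_valid I J : sub J I -> valid I -> valid J.
Proof.
elim=> // {}I A B IAB _ IH _; apply: IH.
  by have [] := gtp_valid g IAB.
by have [] := gtp_valid g IAB.
Qed.

(** If a subinterval of [J] is not isolated, it meets a [w] without complete extensions. Then [I]
    meets a condition containing [w], so a subinterval of [I] meets [w]; it is isolated, which gives
    [w] a complete extension. *)
Lemma her_tpe I J : her I -> tpe I J -> her J.
Proof.
move=> hI IJ J' J'J; have vJ' : valid J'.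
  by apply: sub_valid J'J _; have [p /IJ Jp] := her_valid hI; exists p.
have [w Jw [cw|wild]] := gtp_wild vJ'; first by exists w.
have [c /IJ Ic wc] := sub_cont J'J Jw; have [I' /hI[q Iq cq] Iw] := cont_sub wc Ic.
have [r [_ qr wr]] := gtp_dir Iq Iw.
by case: (wild r wr); apply: compl_le cq qr.
Qed.

(** Both parts of a cut of [I] meet complete conditions. [J] meets their concatenation, so it has a
    cut whose parts meet the same complete conditions, and these determine everything else that the
    parts meet. *)
Lemma her_beq I J : her I -> tpe I J -> beq I J.
Proof.
move=> hI IJ; exists (fun I J => [/\ her I, her J & tpe I J]); last first.
  by split=> //; apply: her_tpe IJ.
have half I0 J0 A B : her I0 -> her J0 -> tpe I0 J0 -> sp I0 A B ->
    exists A' B', [/\ sp J0 A' B', her A /\ her A' /\ tpe A A' & her B /\ her B' /\ tpe B B'].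
  move=> h0 h0' IJ0 IAB.
  have sA : sub A I0 by apply: sub_l IAB (sub_refl _).
  have sB : sub B I0 by apply: sub_r IAB (sub_refl _).
  have [p Ap cp] := h0 _ sA; have [q Bq cq] := h0 _ sB.
  have /IJ0/gtp_ccV[A' [B' [JAB Ap' Bq']]] := gtp_cc IAB Ap Bq.
  exists A', B'; split=> //; split; try exact: her_sub h0 _; split;
    try by [exact: compl_tpe cp _ _|exact: compl_tpe cq _ _].
  - by apply: her_sub h0' _; apply: sub_l JAB (sub_refl _).
  - by apply: her_sub h0' _; apply: sub_r JAB (sub_refl _).
move=> {hI IJ} {}I {}J [hI hJ IJ]; split=> A B.
  by move=> /(half _ _ _ _ hI hJ IJ)[A' [B' [? [? [? ?]] [? [? ?]]]]]; exists A', B'.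
move=> /(half _ _ _ _ hJ hI (tpe_sym IJ))[A' [B' [? [? [? ?]] [? [? ?]]]]].
by exists A', B'; split=> //; split=> //; apply: tpe_sym.
Qed.

(* By genericity some [a] met by [A] and [b] met by [B] already force every
   interval that meets [b] to meet [cc g a b], so a copy of [A] can be split off
   [B], then off what remains, and so on. *)
Lemma absorb I A B : sp I A B -> her A -> tpe I B ->
  exists V e, [/\ omega_sum V e, V 0 = I, e 0 = A, V 1 = B & forall n, her (e n)].
Proof.
move=> IAB hA IB; have [a0 [b [Aa0 Bb H]]] := gtp_absr g IAB.
have {H} H a' b' : gle g a0 a' -> gle g b b' -> b' || cc g a' b'.
  (* The negative alternative fails at [B], which meets [b] and, like [I], also [cc g a0 b]. *)
  case: H => [[]|H]; last exact: H.
  by apply: (@tp_comp B) => //; apply/IB; apply: gtp_cc IAB Aa0 Bb.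
have [q Aq cq] := her_iso hA; have [a [Aa a0a qa]] := gtp_dir Aa0 Aq.
have ca : compl a by apply: compl_le cq qa.
pose T := {V | tp V b}.
have step (V : T) : exists eV : X * T, sp (sval V) eV.1 (sval eV.2) /\ tp eV.1 a.
  case: V => V Vb /=; have : tp V (cc g a b).
    (* Otherwise [V] meets some [m] incompatible with [cc g a b]. [V] meets a common extension [r]
       of [b] and [m], and [H] makes [r] compatible with [cc g a r], which extends [cc g a b]. *)
    have [//|[m Vm []]] := gtp_dec (cc g a b) (ex_intro _ b Vb).
    have [r [_ br mr]] := gtp_dir Vb Vm; have [t rt at_] := H a r a0a br.
    exists t; first by apply: gle_trans (gle_cc _ br) at_; apply: gle_refl.
    exact: gle_trans mr rt.
  by move=> /gtp_ccV[e [V' [VV' ea V'b]]]; exists (e, exist _ V' V'b).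
pose B0 : T := exist _ B Bb.
pose W := fix W n : T := if n is n'.+1 then (projT1 (cid (step (W n')))).2 else B0.
have WS n := projT2 (cid (step (W n))).
pose V n := if n is n'.+1 then sval (W n') else I.
pose e n := if n is n'.+1 then (projT1 (cid (step (W n')))).1 else A.
have ea n : tp (e n) a by case: n => // n; exact: (WS n).2.
have Ae n : tpe A (e n) by apply: compl_tpe ca Aa (ea n).
have he n : her (e n) by apply: her_tpe hA (Ae n).
exists V, e; split=> //; split=> n; first by case: n => // n; exact: (WS n).1.
by apply: her_beq (he n) _ => p; rewrite -(Ae n p); apply: Ae.
Qed.

End Generic.

Arguments valid {X} g.
Arguments tpe {X} g.
Arguments iso {X} g.
Arguments her {X} g.

Lemma her_opp (X : isys) (g : gsys X) I : her (gopp g) I <-> her g I.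
Proof. by split=> H J JI; apply: (H J); apply/sub_opp. Qed.

(** * Levels below a given ordinal *)

Lemma ile_step a b (X Y : isys) (I : X) (I' : Y) w' : ile a I I' -> olt b a ->
  spn I' w' -> exists2 w, spn I w & Forall2 (ile b) w' w.
Proof.
case: a => J f H [j bj] /(H j)[w Iw ww']; exists w => //.
by apply: List.Forall2_impl ww' => x y; apply: ile_mono.
Qed.

Lemma not_ile a (X Y : isys) (I : X) (I' : Y) : ~ ile a I I' ->
  exists b w', [/\ olt b a, spn I' w' & forall w, spn I w -> ~ Forall2 (ile b) w' w].
Proof.
case: a => J f /existsNP[j /existsNP[w' /not_implyP[Iw' H]]].
exists (f j), w'; split=> //; first exact: olt_Lub.
by move=> w Iw Hw; apply: H; exists w.
Qed.

(** The ordinals from which the term [b] is built. A generic chain can treat only countably many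
    levels, and these suffice because [ile] descends to no others. *)
Fixpoint desc (b c : ord) : Prop :=
  c = b \/ let: Lub J f := b in exists j, desc (f j) c.

Lemma desc_refl b : desc b b.
Proof. by case: b; left. Qed.

Lemma desc_step b (J : countType) (f : J -> ord) j : desc b (Lub f) -> desc b (f j).
Proof.
elim: b => K g IH [E|[k Hk]]; last by right; exists k; apply: IH.
by rewrite -E; right; exists j; apply: desc_refl.
Qed.

Lemma desc_ole b c : desc b c -> ole c b.
Proof.
elim: b => K g IH [->|[k /IH ck]]; first exact: ole_refl.
exact: ole_trans ck (oltW (olt_Lub g k)).
Qed.

Lemma desc_enum b : exists e : nat -> ord, forall c, desc b c -> exists n, e n = c.
Proof.
elim: b => J f IH; pose e j := projT1 (cid (IH j)).
exists (fun n => if unpickle n is Some (Some (j, m)) then e j m else Lub f) => c [->|[j Hj]].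
  by exists (pickle (@None (J * nat))); rewrite pickleK.
have [m <-] := projT2 (cid (IH j)) _ Hj.
by exists (pickle (Some (j, m))); rewrite pickleK.
Qed.

(** * The generic order and the conditions met by its intervals *)

Local Open Scope ring_scope.

Record setting := Setting {
  K :> isys;
  mul : K -> K -> K;
  mulP : forall a b, sp (mul a b) a b;
  eK : nat -> K;
  eK_surj : forall k, exists n, eK n = k;
  beta : ord;
  dl : nat -> ord;
  dl_surj : forall c, desc beta c -> exists n, dl n = c
}.
Arguments mul {s}.
Arguments eK {s}.

Notation k0 := (eK 0%N).

Section Forcing.
Variable (S : setting).

Local Notation sumK := (sumK (@mul S) k0).
Local Notation rle := (rle (@mul S) k0 (beta S)).
Local Notation comp := (comp (@mul S) k0 (beta S)).
Local Notation compl := (compl (@mul S) k0 (beta S)).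
Local Notation ext := (ext (@mul S) k0 (beta S)).

Definition nonnil (rs : seq (seq S)) := forall t, List.In t rs -> t <> [::].

(* Some decomposition of [q] witnesses that [A] is not below [sumK q]. *)
Definition refutes (A : S) (q : seq S) := exists b rs, [/\ olt b (beta S), q = flatten rs,
  nonnil rs & forall w, spn A w -> ~ Forall2 (ile b) [seq sumK t | t <- rs] w].

Definition splits_above d (w : seq S) (q : seq S) := exists rs, [/\ q = flatten rs, nonnil rs &
  Forall2 (ile d) w [seq sumK t | t <- rs]].

(** The questions that genericity has to decide. [Dsplit] serves [truth], [Drefute] serves
    [reality], [Dincomp] serves [disjoint_iso]; the others provide the laws of [gsys]. *)
Inductive demand :=
| Dle of seq nat | Drefute of nat | Dsplit of nat & seq nat
| Dcompl | Dincomp | Dabsr | Dabsl.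

Definition meet_demand (d : demand) (q1 q2 : seq S) : Prop := match d with
  | Dle p => rle [seq eK i | i <- p] q1
  | Drefute a => refutes (eK a) q1
  | Dsplit m w => splits_above (dl S m) [seq eK i | i <- w] q1
  | Dcompl => compl q1
  | Dincomp => ~ comp q1 q2
  | Dabsr => ~ comp q2 (q1 ++ q2)
  | Dabsl => ~ comp q1 (q1 ++ q2) end.

Definition demand_code (d : demand) : (seq nat * nat * nat)%type := match d with
  | Dle p => (p, 0, 0)%N | Drefute a => ([::], a, 1)%N | Dsplit m w => (w, m, 2)%N
  | Dcompl => ([::], 0, 3)%N | Dincomp => ([::], 0, 4)%N
  | Dabsr => ([::], 0, 5)%N | Dabsl => ([::], 0, 6)%N end.

Definition demand_decode (c : seq nat * nat * nat) : demand :=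
  let: (p, a, i) := c in match i with
  | 0 => Dle p | 1 => Drefute a | 2 => Dsplit a p | 3 => Dcompl
  | 4 => Dincomp | 5 => Dabsr | _ => Dabsl end%N.

Lemma demand_codeK : cancel demand_code demand_decode.
Proof. by case. Qed.

Definition Dfam (n : nat) : seq S -> seq S -> Prop :=
  if unpickle n is Some c then meet_demand (demand_decode c) else fun _ _ => False.

Lemma DfamE d : exists n, Dfam n = meet_demand d.
Proof. by exists (pickle (demand_code d)); rewrite /Dfam pickleK demand_codeK. Qed.

Lemma eK_seq (w : seq S) : exists p, [seq eK i | i <- p] = w.
Proof.
elim: w => [|x w [p <-]]; first by exists [::].
by have [i <-] := eK_surj x; exists (i :: p).
Qed.

Variables (s0 : state S) (s0_wf : wf s0).
Variable (s0_pt : exists2 x, x \in pts s0 & 0 < x).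

Definition gchain := cid (generic_chain (@mulP S) k0 (beta S) Dfam s0_wf).
Definition st : nat -> state S := projT1 gchain.

Lemma st0 : st 0 = s0. Proof. by case: (projT2 gchain). Qed.

Lemma st_wf i : wf (st i). Proof. by case: (projT2 gchain) => _ H _ _; apply: H. Qed.

Lemma st_srt i : srt (st i). Proof. by have /and3P[] := st_wf i. Qed.

Lemma st_ext i j : (i <= j)%N -> ext (st i) (st j).
Proof. by case: (projT2 gchain) => _ _ H _; apply: H. Qed.

(** The mark 0 of the left end is not a point of the order. *)
Definition onN (x : rat) : bool := `[< 0 < x /\ exists i, x \in pts (st i) >].

Lemma N_inh : inhabited {x | onN x}.
Proof.
have [x xs x0] := s0_pt; constructor; exists x; apply/asboolP; split=> //.
by exists 0%N; rewrite st0.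
Qed.

Definition N : structure := @Structure {x | onN x} (fun x y => val x < val y) N_inh.

Definition vN (x : N) : rat := val (x : {x | onN x}).

Lemma vN_inj : injective vN. Proof. exact: val_inj. Qed.

Lemma vN_gt0 x : 0 < vN x. Proof. by have /asboolP[] := valP (x : {x | onN x}). Qed.

Lemma vN_pts x : exists i, vN x \in pts (st i).
Proof. by have /asboolP[] := valP (x : {x | onN x}). Qed.

Lemma pts_bound i x : x \in pts (st i) -> 0 <= x < 1.
Proof.
by move=> /mapP[p ps ->]; have /and3P[_ /allP H _] := st_wf i; apply: H.
Qed.

Lemma vN_lt1 x : vN x < 1.
Proof. by have [i /pts_bound/andP[]] := vN_pts x. Qed.

Lemma N_onto i x : x \in pts (st i) -> 0 < x -> exists y : N, vN y = x.
Proof.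
move=> xi x0; have H : onN x by apply/asboolP; split=> //; exists i.
by exists (exist _ x H).
Qed.

Lemma N_lin : linear_order N.
Proof.
split=> [x|x y z|x y] /=; rewrite ?ltxx//; first exact: lt_trans.
have [?|?|/val_inj ?] := ltgtP (vN x) (vN y);
  by [constructor 1|constructor 3|constructor 2].
Qed.

Lemma N_countable : countable_structure N.
Proof. exact: (@countableP {x | onN x}). Qed.

Notation IN := (oint N_lin).
Implicit Types (I J A B : IN).

Definition lo I : rat := if I.1 is Some x then vN x else 0.
Definition hi I : rat := if I.2 is Some x then vN x else 1.

Lemma inIP I x : inI I x <-> lo I < vN x /\ vN x < hi I.
Proof.
have [x0 x1] := (vN_gt0 x, vN_lt1 x).
by case: I => [[l|] [u|]]; rewrite /inI /lo /hi /=; split=> -[].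
Qed.

Lemma spNP I A B : sp I A B -> exists x, [/\ A = (I.1, Some x), B = (Some x, I.2),
  lo I < vN x & vN x < hi I].
Proof. by move=> [x [/inIP[lx xu] -> ->]]; exists x. Qed.

Lemma spN_bnd I A B : sp I A B -> [/\ lo A = lo I, hi B = hi I, hi A = lo B,
  lo A < hi A & lo B < hi B].
Proof. by move=> /spNP[x [-> -> lx xu]]. Qed.

Definition ready i I := [/\ lo I \in pts (st i), endp (st i) (hi I) & lo I < hi I].

Definition q i I : seq S := gl (st i) (lo I) (hi I).

Lemma ready_mono i j I : (i <= j)%N -> ready i I -> ready j I.
Proof.
move=> /st_ext E [H1 H2 H3]; split=> //; first exact: E.1.
exact: ext_endp E H2.
Qed.

Lemma ready_ex I : lo I < hi I -> exists i, ready i I.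
Proof.
move=> lh; have [i Hi] : exists i, lo I \in pts (st i).
  rewrite /lo; case: I.1 => [x|]; first exact: vN_pts.
  by exists 0%N; have /and3P[] := st_wf 0.
have [j Hj] : exists j, endp (st j) (hi I).
  rewrite /hi; case: I.2 => [x|]; last by exists 0%N; rewrite /endp eqxx.
  by have [j Hj] := vN_pts x; exists j; rewrite /endp Hj orbT.
exists (maxn i j); split=> //.
  by apply: (st_ext (leq_maxl i j)).1.
by apply: ext_endp (st_ext (leq_maxr i j)) Hj.
Qed.

Lemma q_mono i j I : (i <= j)%N -> ready i I -> rle (q i I) (q j I).
Proof. by move=> ij [H1 H2 H3]; apply: (st_ext ij).2. Qed.

Lemma q_neq0 i I : ready i I -> q i I <> [::].
Proof.
move=> [/mapP[p ps lE] _ lh] /(congr1 size)/eqP; rewrite /q /gl size_map.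
by rewrite size_filter -leqn0 leqNgt -has_count; case/hasP; exists p; rewrite // -lE lexx.
Qed.

Lemma q_sp i I A B : sp I A B -> ready i A -> ready i B ->
  ready i I /\ q i I = q i A ++ q i B.
Proof.
move=> /spN_bnd[lA hB hAB lhA lhB] [A1 A2 _] [B1 B2 _]; split.
  by split; rewrite -?lA -?hB//; apply: lt_trans lhA _; rewrite hAB.
rewrite /q -lA -hB -hAB; apply: gl_split (st_srt i) (ltW lhA) _.
by rewrite hAB ltW.
Qed.

Lemma q_split i I r1 r2 : ready i I -> q i I = r1 ++ r2 -> r1 <> [::] -> r2 <> [::] ->
  exists A B, [/\ sp I A B, ready i A /\ q i A = r1 & ready i B /\ q i B = r2].
Proof.
move=> [H1 H2 H3] qE r10 r20.
have [x xs [lx xu G1 G2]] := gl_decomp (st_srt i) qE r10 r20.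
have x0 : 0 < x by apply: le_lt_trans lx; have /andP[] := pts_bound H1.
have [y yx] := N_onto xs x0; subst x.
exists (I.1, Some y), (Some y, I.2); split.
- by exists y; split=> //; apply/inIP.
- by split=> //; split=> //; rewrite /endp /hi /= xs orbT.
- by split.
Qed.

Lemma q_groups i I rs : ready i I -> q i I = flatten rs -> nonnil rs ->
  exists2 w, spn I w & Forall2 (fun J r => ready i J /\ q i J = r) w rs.
Proof.
elim: rs I => [|r rs IH] I rI qE H; first by case: (q_neq0 rI).
have r0 : r <> [::] by apply: H; left.
have rs0 t : List.In t rs -> t <> [::] by move=> tr; apply: H; right.
case: rs IH qE rs0 {H} => [|r' rs] IH qE rs0.
  exists [:: I]; first exact: spn1.
  by constructor=> //; split=> //; rewrite qE /= cats0.
have [|A [B [IAB rA [rB qB]]]] := q_split rI qE r0.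
  by case: (r') (rs0 r' (or_introl erefl)).
have [w Bw Hw] := IH _ rB qB rs0.
by exists (A :: w); [apply: spnS IAB Bw|constructor].
Qed.

Lemma spn_ready I w i : lo I < hi I -> spn I w -> exists j, [/\ (i <= j)%N, ready j I,
  forall J, List.In J w -> ready j J & q j I = flatten [seq q j J | J <- w]].
Proof.
move=> lh Iw; have H : exists j, (i <= j)%N /\ forall J, List.In J w -> ready j J.
  elim: Iw lh => {I w} [I|I A B w IAB _ IH] lh.
    have [j rj] := ready_ex lh; exists (maxn i j); split; first exact: leq_maxl.
    by move=> J [<-|//]; apply: ready_mono rj; apply: leq_maxr.
  have [_ _ _ lhA lhB] := spN_bnd IAB.
  have [j [ij Hj]] := IH lhB; have [k rk] := ready_ex lhA.
  exists (maxn j k); split; first by apply: leq_trans ij (leq_maxl _ _).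
  move=> J [<-|/Hj]; apply: ready_mono; [exact: leq_maxr| |exact: leq_maxl].
  exact: rk.
have [j [ij Hj]] := H; exists j; split=> //.
  elim: Iw Hj {lh H} => {I w} [I|I A B w IAB _ IH] Hj; first by apply: Hj; left.
  have rB : ready j B by apply: IH => J Jw; apply: Hj; right.
  by have [] := q_sp IAB (Hj _ (or_introl erefl)) rB.
suff : ready j I /\ q j I = flatten [seq q j J | J <- w] by case.
elim: Iw Hj {lh H} => {I w} [I|I A B w IAB _ IH] Hj /=.
  by rewrite cats0; split=> //; apply: Hj; left.
have [rB <-] : ready j B /\ q j B = flatten [seq q j J | J <- w].
  by apply: IH => J Jw; apply: Hj; right.
exact: q_sp IAB (Hj _ (or_introl erefl)) rB.
Qed.

(** Since [I] and [J] are disjoint, strengthening the promises in one leaves those in the other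
    alone. If the demand is never met, it therefore fails for all independent choices of [r1] and
    [r2]. [i0] allows a stage as late as desired. *)
Lemma generic2 I J d i0 : lo I < hi I -> lo J < hi J -> hi I <= lo J ->
  (exists i, [/\ ready i I, ready i J & meet_demand d (q i I) (q i J)]) \/
  (exists i, [/\ (i0 <= i)%N, ready i I, ready i J &
    forall r1 r2, rle (q i I) r1 -> rle (q i J) r2 -> ~ meet_demand d r1 r2]).
Proof.
move=> lhI lhJ IJ; have [n Dn] := DfamE d.
have [i [|H]] : exists i, meets Dfam (lo I, hi I, lo J, hi J, n) (st i) \/
    forall s', wf s' -> ext (st i) s' -> ~ meets Dfam (lo I, hi I, lo J, hi J, n) s'.
  by case: (projT2 gchain).
  by move=> /= [/andP[? ?] /andP[? ?]]; rewrite Dn => ?; left; exists i; split.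
right; have [iI rI] := ready_ex lhI; have [iJ rJ] := ready_ex lhJ.
pose m := maxn (maxn i i0) (maxn iI iJ).
have im : (i <= m)%N by rewrite /m !leq_max leqnn.
have rIm : ready m I by apply: ready_mono rI; rewrite /m !leq_max leqnn !orbT.
have rJm : ready m J by apply: ready_mono rJ; rewrite /m !leq_max leqnn !orbT.
exists m; split=> //; first by rewrite /m !leq_max leqnn !orbT.
move=> r1 r2 q1 q2 Hd.
have bnd (A : IN) : hi A <= 1 by rewrite /hi; case: A.2 => // x; rewrite ltW// vN_lt1.
have [s1 [W1 E1 G1 L1]] := ext_realize (@mulP S) (st_wf m) lhI (bnd I) q1.
have G1J : gl s1 (lo J) (hi J) = q m J by apply: L1; right.
have [s2 [W2 E2 G2 L2]] : exists s2, [/\ wf s2, ext s1 s2, gl s2 (lo J) (hi J) = r2 &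
    forall l' u', u' <= lo J \/ hi J <= l' -> gl s2 l' u' = gl s1 l' u'].
  by apply: (ext_realize (@mulP S) W1 lhJ (bnd J)); rewrite G1J.
have E : ext (st m) s2 by apply: ext_trans E1 E2; exact: mulP.
apply: (H s2 W2); first by apply: ext_trans (st_ext im) E; exact: mulP.
rewrite /= Dn G2 L2; last by left.
have [rI1 rI2 _] := rIm; have [rJ1 rJ2 _] := rJm.
by split; [rewrite !E.1|rewrite !(ext_endp E)|rewrite G1].
Qed.

Lemma generic1 I (P : seq S -> Prop) i0 :
  (exists d, forall q1 q2, meet_demand d q1 q2 <-> P q1) -> lo I < hi I ->
  (exists i, ready i I /\ P (q i I)) \/
  (exists i, [/\ (i0 <= i)%N, ready i I & forall r, rle (q i I) r -> ~ P r]).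
Proof.
move=> [d dP] lhI; have [n Dn] := DfamE d.
(* A requirement names two intervals; here both of them are [I]. *)
have [i [|H]] : exists i, meets Dfam (lo I, hi I, lo I, hi I, n) (st i) \/
    forall s', wf s' -> ext (st i) s' -> ~ meets Dfam (lo I, hi I, lo I, hi I, n) s'.
  by case: (projT2 gchain).
  by move=> /= [/andP[? ?] /andP[? ?]]; rewrite Dn dP => ?; left; exists i; split.
right; have [iI rI] := ready_ex lhI.
pose m := maxn (maxn i i0) iI.
have im : (i <= m)%N by rewrite /m !leq_max leqnn.
have rIm : ready m I by apply: ready_mono rI; rewrite /m !leq_max leqnn !orbT.
exists m; split=> //; first by rewrite /m !leq_max leqnn !orbT.
move=> r q1 Pr.
have bnd : hi I <= 1 by rewrite /hi; case: I.2 => // x; rewrite ltW// vN_lt1.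
have [s1 [W1 E1 G1 L1]] := ext_realize (@mulP S) (st_wf m) lhI bnd q1.
apply: (H s1 W1); first by apply: ext_trans (st_ext im) E1; exact: mulP.
have [rI1 rI2 _] := rIm.
by rewrite /= Dn G1; split; [rewrite !E1.1|rewrite !(ext_endp E1)|apply/dP].
Qed.

Definition c i I : S := sumK (q i I).

Lemma c_mono i j I : (i <= j)%N -> ready i I -> ile (beta S) (c i I) (c j I).
Proof.
move=> ij rI; apply: (rle_sumK (@mulP S)); first exact: q_mono.
exact: q_neq0.
Qed.

Lemma spn_c i I w : ready i I -> (forall J, List.In J w -> ready i J) -> w <> [::] ->
  q i I = flatten [seq q i J | J <- w] -> forall a,
  ile a (sumK [seq c i J | J <- w]) (c i I) /\ ile a (c i I) (sumK [seq c i J | J <- w]).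
Proof.
move=> rI rw w0 qE a; rewrite /c qE.
have -> : [seq sumK (q i J) | J <- w] = [seq sumK t | t <- [seq q i J | J <- w]].
  by rewrite -map_comp.
apply: (sumK_groups (@mulP S)); first by case: (w) w0.
move=> t /List.in_map_iff[J [<- /rw]]; exact: q_neq0.
Qed.

Lemma in_splits_above d w (q0 : seq S) : splits_above d w q0 -> forall i I, ready i I ->
  q i I = q0 -> exists2 v, spn I v & Forall2 (fun (A : S) J => ready i J /\ ile d A (c i J)) w v.
Proof.
move=> [rs [-> rs0 H]] i I rI qE; have [v Iv Hv] := q_groups rI qE rs0.
exists v => //; elim: Hv w H {qE rs0 Iv} => [|J r v' rs' [rJ qJ] _ IH] w /= H.
  by inversion H; constructor.
by inversion H; subst; constructor; [split|apply: IH].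
Qed.

(* The two halves need each other: the promise [c i I <= I] at level [g] uses
   [I <= c i I] at lower levels, and conversely. *)
Lemma truth g : desc (beta S) g ->
  (forall i I, ready i I -> ile g (c i I) I) /\
  (olt g (beta S) -> forall i I, ready i I -> ile g I (c i I)).
Proof.
elim: g => J f IH dg.
have IHj j := IH j (desc_step j dg).
have fb j : olt (f j) (beta S) by apply: olt_ole (olt_Lub f j) (desc_ole dg).
split=> [i I rI j w Iw|gb i I rI j w cw].
  have lh : lo I < hi I by case: rI.
  (* Wait for a stage at which all points of the splitting [w] are listed. *)
  have [t [it rt rw qE]] := spn_ready i lh Iw.
  have cit : ile (Lub f) (c i I) (c t I).
    by apply: ile_mono (desc_ole dg) _; apply: c_mono.
  have w0 : w <> [::] by apply: spn_neq0 Iw.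
  have H : ile (Lub f) (c i I) (sumK [seq c t J | J <- w]).
    by apply: ile_trans cit _; apply: (spn_c rt rw w0 qE _).2.
  have w1 : [seq c t J | J <- w] <> [::] by case: (w) w0.
  have [u cu Hu] := H j _ (spn_sumK (@mulP S) k0 w1).
  exists u => //; elim: (w) u Hu rw {cu H w0 w1 qE Iw} => [|J0 w' IHw] u /= Hu rw.
    by inversion Hu; constructor.
  inversion Hu as [|? y ? u' Hy Hu' E1 E2]; subst; constructor.
    by apply: ile_trans Hy; apply: (IHj j).2 => //; apply: rw; left.
  by apply: IHw Hu' _ => J1 ?; apply: rw; right.
have [p pw] := eK_seq w; have [m mf] := dl_surj (desc_step j dg).
have lh : lo I < hi I by case: rI.
have [||[t [rt /in_splits_above/(_ _ _ rt erefl)[v Iv Hv]]]|[t [it rt Ht]]] :=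
    @generic1 I (splits_above (f j) w) i _ _ => //.
- by exists (Dsplit m p) => q1 q2; rewrite /= mf pw.
- exists v => //; apply: List.Forall2_impl Hv => A J0 [rJ AJ].
  by apply: ile_trans AJ _; apply: (IHj j).1.
(* If the demand is excluded: the promises have only grown from [i] to [t], so strictly below [beta]
   the sums are also related in the reverse direction. Hence [w] is answered inside [c t I], and
   this answer strengthens [q t I] to meet the demand. *)
have /(_ j w cw)[u cu wu] : ile (Lub f) (c t I) (c i I).
  by apply: ile_flip gb _; apply: c_mono.
have [rs [qr rs0 Hrs]] := rle_split (@mulP S) (beta S) (q_neq0 rt) cu.
case: (Ht _ qr); exists rs; split=> //.
elim: Hrs w wu {cw pw Ht qr rs0 cu} => [|x s u' rs' Hx _ IHr] w wu.
  by inversion wu; constructor.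
inversion wu as [|y ? w' ? Hy Hw]; subst; constructor; last exact: IHr.
by apply: ile_trans Hy _; case: (Hx (f j)).
Qed.

Lemma c_le i I : ready i I -> ile (beta S) (c i I) I.
Proof. exact: (truth (desc_refl _)).1. Qed.

(** A refutation of [A] met by [I] would be visible among the points of the order, against
    [ile (beta S) A I]. So from some stage on no refutation is possible, which says that the
    promised sum itself lies above [A]. *)
Lemma reality (A : S) I : lo I < hi I -> ile (beta S) A I ->
  exists i, ready i I /\ ile (beta S) A (c i I).
Proof.
move=> lh AI; have [a aA] := eK_surj A.
have [|[i [ri [b [rs [bb qE rs0 H]]]]]|[i [_ ri H]]] := @generic1 I (refutes A) 0 _ lh.
- by exists (Drefute a) => q1 q2; rewrite /= aA.
- have [w Iw Hw] := q_groups ri qE rs0.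
  have [u Au Hu] := ile_step AI bb Iw.
  case: (H _ Au); elim: Hw u Hu {qE rs0 H Iw Au} => [|J r w' rs' [rJ qJ] _ IH] u Hu.
    by inversion Hu; constructor.
  inversion Hu as [|? y ? u' Hy Hu' E1 E2]; subst; constructor; last exact: IH.
  by apply: ile_trans Hy; apply: ile_mono (oltW bb) _; apply: c_le.
exists i; split=> //; apply: contrapT => /not_ile[b [w [bb cw Hw]]].
have [rs [qr rs0 Hrs]] := rle_split (@mulP S) (beta S) (q_neq0 ri) cw.
apply: (H _ qr); exists b, rs; split=> // u Au Hu.
apply: (Hw u Au); elim: Hrs u Hu {cw H qr rs0 Hw Au} => [|x t w' rs' Hx _ IH] u Hu.
  by inversion Hu; constructor.
inversion Hu as [|? y ? u' Hy Hu' E1 E2]; subst; constructor; last exact: IH.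
by apply: ile_trans Hy; case: (Hx b).
Qed.

Definition cond := {p : seq S | (0 < size p)%N}.

Lemma condP (p : cond) : sval p <> [::]. Proof. by case: p => -[]. Qed.

Definition ccat (p p' : cond) : cond.
Proof.
by exists (sval p ++ sval p'); rewrite size_cat addn_gt0 (proj2_sig p).
Defined.

Definition mkc (p : seq S) (p0 : p <> [::]) : cond.
Proof. by exists p; case: p p0. Defined.

Definition cle (p p' : cond) := rle (sval p) (sval p').

Definition tp I (p : cond) := exists2 i, ready i I & rle (sval p) (q i I).

Lemma gcompE (p p' : cond) : gcomp cle p p' <-> comp (sval p) (sval p').
Proof.
split=> -[r pr p'r]; first by exists (sval r).
by exists (mkc (rle_neq0 pr (@condP p))).
Qed.

Lemma gcomplE (p : cond) : gcompl cle p <-> compl (sval p).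
Proof.
split=> H r r'; last by rewrite !gcompE; apply: H.
move=> pr pr'; have [m rm pm] := pr; have [m' rm' pm'] := pr'.
have r0 := rle_neq0r rm (rle_neq0 pm (@condP p)).
have r0' := rle_neq0r rm' (rle_neq0 pm' (@condP p)).
have /gcompE : gcomp cle (mkc r0) (mkc r0') by apply: H; apply/gcompE.
by [].
Qed.

Lemma val_cond (p p' : cond) : sval p = sval p' -> p = p'.
Proof. exact: val_inj. Qed.

Definition qc i I (r : ready i I) : cond := mkc (q_neq0 r).

Lemma tp_qc i I (r : ready i I) : tp I (qc r).
Proof. by exists i => //; apply: rle_refl. Qed.

Lemma tp_lt I p : tp I p -> lo I < hi I.
Proof. by case=> i []. Qed.

Definition GS : gsys IN.
Proof.
refine (@GSys IN cond ccat cle tp _ _ _ _ _ _ _ _ _ _ _ _ _).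
- by move=> p; apply: rle_refl.
- by move=> p p' r; apply: rle_trans; apply: mulP.
- by move=> p p' r r'; apply: rle_cat.
- move=> p p' [r r0] /= /rle_cat_inv[r1 [r2 [rE pr1 pr2]]].
  exists (mkc (rle_neq0 pr1 (@condP p))), (mkc (rle_neq0 pr2 (@condP p'))).
  by split=> //; apply: val_cond.
- by move=> I p p' pp' [i ri pi]; exists i => //; apply: rle_trans pi; first exact: mulP.
- move=> I p p' [i ri pi] [j rj pj]; have rm := ready_mono (leq_maxl i j) ri.
  exists (qc rm); split; first exact: tp_qc.
    by apply: rle_trans pi _; [exact: mulP|apply: q_mono (leq_maxl _ _) ri].
  by apply: rle_trans pj _; [exact: mulP|apply: q_mono (leq_maxr _ _) rj].
- move=> I A B /spN_bnd[_ _ _ /ready_ex[i rA] /ready_ex[j rB]].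
  by split; [exists (qc rA)|exists (qc rB)]; apply: tp_qc.
- move=> I A B p p' IAB [i ri pi] [j rj pj].
  have rA := ready_mono (leq_maxl i j) ri; have rB := ready_mono (leq_maxr i j) rj.
  have [rI qE] := q_sp IAB rA rB; exists (maxn i j) => //; rewrite qE; apply: rle_cat.
    by apply: rle_trans pi _; [exact: mulP|apply: q_mono (leq_maxl _ _) ri].
  by apply: rle_trans pj _; [exact: mulP|apply: q_mono (leq_maxr _ _) rj].
- move=> I p p' [i ri /= /rle_cat_inv[r1 [r2 [qE p1 p2]]]].
  have [A [B [IAB [rA qA] [rB qB]]]] :=
    q_split ri qE (rle_neq0 p1 (@condP p)) (rle_neq0 p2 (@condP p')).
  by exists A, B; split=> //; exists i; rewrite ?qA ?qB.
- move=> I p [p' /tp_lt lh]; have [a ap] := eK_seq (sval p).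
  have [|[i [ri H]]|[i [_ ri H]]] := @generic1 I (rle (sval p)) 0 _ lh.
  + by exists (Dle a) => q1 q2; rewrite /= ap.
  + by left; exists i.
  + by right; exists (qc ri); [exact: tp_qc|move=> /gcompE[r pr /H]].
- move=> I [p' /tp_lt lh].
  have [|[i [ri H]]|[i [_ ri H]]] := @generic1 I compl 0 _ lh.
  + by exists Dcompl.
  + by exists (qc ri); [exact: tp_qc|left; apply/gcomplE].
  + by exists (qc ri); [exact: tp_qc|right=> r qr /gcomplE; apply: H].
- move=> I A B /spN_bnd[_ _ hAB lhA lhB].
  have [|[i [rA rB H]]|[i [_ rA rB H]]] := @generic2 A B Dabsr 0 lhA lhB _.
  + by rewrite hAB.
  + by exists (qc rA), (qc rB); split; try exact: tp_qc; left=> /gcompE.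
  + exists (qc rA), (qc rB); split; try exact: tp_qc.
    by right=> a' b' qa qb; apply/gcompE; apply: contrapT; apply: H.
- move=> I A B /spN_bnd[_ _ hAB lhA lhB].
  have [|[i [rA rB H]]|[i [_ rA rB H]]] := @generic2 A B Dabsl 0 lhA lhB _.
  + by rewrite hAB.
  + by exists (qc rA), (qc rB); split; try exact: tp_qc; left=> /gcompE.
  + exists (qc rA), (qc rB); split; try exact: tp_qc.
    by right=> a' b' qa qb; apply/gcompE; apply: contrapT; apply: H.
Defined.

(** [I] and [J] meet no incompatible conditions, so at some stage all strengthenings on [I] are
    compatible with all those on [J]. Two strengthenings on [I] are then compatible with each other:
    extend the first jointly with [q i J], and compare the second with the result. *)
Lemma disjoint_iso I J : lo I < hi I -> lo J < hi J -> hi I <= lo J ->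
  tpe GS I J -> iso GS I.
Proof.
move=> lhI lhJ IJ E.
have [[i [rI rJ []]]|[i [_ rI rJ H]]] := @generic2 I J Dincomp 0 lhI lhJ IJ.
  have IqJ : gtp GS I (qc rJ) by apply/E; apply: tp_qc.
  by have /gcompE := tp_comp (tp_qc rI : gtp GS I (qc rI)) IqJ.
exists (qc rI); first exact: tp_qc.
have {}H r1 r2 : rle (q i I) r1 -> rle (q i J) r2 -> comp r1 r2.
  by move=> h1 h2; apply: contrapT; apply: H.
apply/gcomplE => p p' [r pr qr] [r' pr' qr'].
have [m rm Jm] := H _ _ qr (rle_refl _ _ _ _).
have [n r'n mn] := H _ _ qr' Jm.
have tr := rle_trans (@mulP S).
by exists n; [apply: tr pr (tr _ _ _ _ _ rm mn)|apply: tr pr' r'n].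
Qed.

(** A condition met by [I] yields a splitting of [I] with pieces above its promises. [J] answers
    with pieces that are larger still, and [reality] turns these lower bounds back into promises. *)
Lemma tp_le I J : lo I < hi I -> lo J < hi J -> ile (osucc (beta S)) J I ->
  forall p, tp I p -> tp J p.
Proof.
move=> lhI lhJ JI p [i rI /rle_groups[rs qE Hrs]].
have rs0 : nonnil rs.
  by elim: Hrs {qE} => [|A t p' rs' [t0 _] _ IH] t' //= [<- //|]; exact: IH.
have [w Iw Hw] := q_groups rI qE rs0.
have [u Ju Hu] := JI tt _ Iw.
have H : Forall2 (fun (A : S) J => ile (beta S) A J) (sval p) u.
  elim: Hrs w Hw u Hu {qE rs0 Iw Ju} => [|A t p' rs' [t0 At] _ IH] w Hw u Hu.
    by inversion Hw; subst; inversion Hu; constructor.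
  inversion Hw as [|J0 ? w' ? [rJ qJ] Hw']; subst.
  inversion Hu as [|? y ? u' Hy Hu']; subst; constructor; last exact: IH Hw' _ Hu'.
  by apply: ile_trans At (ile_trans (c_le rJ) Hy).
elim: Ju lhJ p H {JI Hu qE Hrs} => {J u} [J|J A B u JAB Bu IH] lhJ [p p0] /= H.
  inversion H as [|x ? p' ? xJ Hp]; subst; inversion Hp; subst.
  have [j [rj Hj]] := reality lhJ xJ; exists j => //=.
  rewrite -[q j J]cats0; apply: rle_cons => //; [exact: q_neq0|exact: rle_nil].
inversion H as [|x ? p' ? xA Hp]; subst; have [_ _ _ lhA lhB] := spN_bnd JAB.
have p'0 : p' <> [::] by move=> E; move: Hp (spn_neq0 Bu); rewrite E => Hp; inversion Hp.
have [j [rj Hj]] := reality lhA xA.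
have x0 : [:: x] <> [::] by [].
have TA : tp A (mkc x0).
  exists j => //=; rewrite -[q j A]cats0.
  by apply: rle_cons => //; [exact: q_neq0|exact: rle_nil].
have TB : tp B (mkc p'0) by apply: IH => //; subst.
have [k rk Hk] : tp J (ccat (mkc x0) (mkc p'0)) := @gtp_cc IN GS J A B _ _ JAB TA TB.
by exists k.
Qed.

End Forcing.

(** * Homogeneity of the generic order *)

Section Homogeneous.
Local Open Scope ring_scope.
Variables (S : setting) (s0 : state S) (s0_wf : wf s0).
Variable (s0_pt : exists2 x, x \in pts s0 & 0 < x).

Local Notation N := (N s0_wf s0_pt).
Local Notation linN := (N_lin s0_wf s0_pt).
Local Notation IN := (oint linN).
Local Notation g := (GS s0_wf s0_pt).
Local Notation b1 := (osucc (beta S)).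
Local Notation b2 := (osucc (osucc (beta S))).
Local Notation itv := (fun l u : option N => ((l, u) : IN)).
Implicit Types (I J A B : IN) (a b x y : N) (c l u : option N).

Lemma ltNE x y : slt x y <-> vN x < vN y. Proof. by []. Qed.

Lemma lo_inj I J : lo I = lo J -> I.1 = J.1.
Proof.
rewrite /lo; case: I.1 J.1 => [x|] [y|] //; first by move=> /vN_inj ->.
- by move=> E; have := vN_gt0 x; rewrite E ltxx.
- by move=> E; have := vN_gt0 y; rewrite -E ltxx.
Qed.

Lemma hi_inj I J : hi I = hi J -> I.2 = J.2.
Proof.
rewrite /hi; case: I.2 J.2 => [x|] [y|] //; first by move=> /vN_inj ->.
- by move=> E; have := vN_lt1 x; rewrite E ltxx.
- by move=> E; have := vN_lt1 y; rewrite -E ltxx.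
Qed.

Lemma sub_bnd I J : sub J I -> lo I < hi I -> [/\ lo I <= lo J, hi J <= hi I & lo J < hi J].
Proof.
elim=> [lh|I' A B IAB _ IH lh|I' A B IAB _ IH lh]; first by split.
- have [<- <- hAB lhA lhB] := spN_bnd IAB; have [? H ?] := IH lhA; split=> //.
  by apply: le_trans H _; rewrite hAB ltW.
- have [<- <- hAB lhA lhB] := spN_bnd IAB; have [H ? ?] := IH lhB; split=> //.
  by apply: le_trans H; rewrite -hAB ltW.
Qed.

Lemma sp_mid l x u : lo (itv l u) < vN x -> vN x < hi (itv l u) ->
  sp (itv l u) (itv l (Some x)) (itv (Some x) u).
Proof. by move=> lx xu; exists x; split=> //; apply/inIP. Qed.

Lemma bnd_sub I J : lo I <= lo J -> hi J <= hi I -> lo J < hi J -> sub J I.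
Proof.
case: I J => [l u] [l' u'] ll uu lh.
have R : sub (itv l' u') (itv l' u).
  move: (uu); rewrite le_eqVlt => /orP[/eqP/hi_inj/= ->|uu1]; first exact: sub_refl.
  have [y uE] : exists y, u' = Some y.
    case: (u') uu1 => [y|]; first by exists y.
    by rewrite {1}/hi /= ltNge /hi /=; case: (u) => [z|]; rewrite ?lexx// ltW ?vN_lt1.
  by subst u'; apply: sub_l (sub_refl _); apply: sp_mid.
move: (ll); rewrite le_eqVlt => /orP[/eqP/lo_inj/= ->//|ll1].
have [y lE] : exists y, l' = Some y.
  case: (l') ll1 => [y|]; first by exists y.
  by rewrite /lo /= ltNge; case: (l) => [z|]; rewrite ?lexx// ltW ?vN_gt0.
subst l'; apply: sub_r R; apply: sp_mid => //.
exact: lt_le_trans lh uu.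
Qed.

Lemma her_not I : lo I < hi I -> ~ her g I -> exists J, [/\ lo I <= lo J, hi J <= hi I,
  lo J < hi J & ~ iso g J].
Proof.
move=> lh /existsNP[J /not_implyP[JI nJ]]; exists J.
by have [? ? ?] := sub_bnd JI lh.
Qed.

Lemma valid_lt I : lo I < hi I -> valid g I.
Proof. by move=> /ready_ex[i ri]; exists (qc ri); apply: tp_qc. Qed.

Lemma ile_tpe I J : lo I < hi I -> lo J < hi J -> ile b1 J I -> tpe g I J.
Proof.
by move=> lhI lhJ JI; apply: tp_max; [exact: valid_lt|exact: tp_le].
Qed.

Definition near a b := [\/ a = b, slt a b /\ her g (Some a, Some b)
  | slt b a /\ her g (Some b, Some a)].

Lemma bf_lt n (v w : 'I_n -> N) (l r : option 'I_n) : qfa v w ->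
  lo (itv (omap v l) (omap v r)) < hi (itv (omap v l) (omap v r)) ->
  lo (itv (omap w l) (omap w r)) < hi (itv (omap w l) (omap w r)).
Proof.
move=> vw; case: l r => [l|] [r|] /=; rewrite /lo /hi /= ?ltr01 ?vN_gt0 ?vN_lt1//.
by move/(vw l r).2.
Qed.

Lemma bf_tpe n (v w : 'I_n -> N) (l r : option 'I_n) : bf b2 v w ->
  lo (itv (omap v l) (omap v r)) < hi (itv (omap v l) (omap v r)) ->
  tpe g (itv (omap v l) (omap v r)) (itv (omap w l) (omap w r)).
Proof.
move=> vw lh; have lh' := bf_lt (bf_qfa vw) lh.
apply: tpe_sym; apply: ile_tpe => //; apply: (@bf_ile _ _ _ linN linN).
by apply: bf_mono vw; apply/oltW/olt_osucc/ole_refl.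
Qed.

Lemma le_qfa n (v w : 'I_n -> N) i j : qfa v w -> vN (v i) <= vN (v j) -> vN (w i) <= vN (w j).
Proof.
move=> vw; rewrite le_eqVlt => /orP[/eqP/vN_inj/(vw i j).1 -> //|/(vw i j).2 H].
exact/ltW.
Qed.

(* A nonisolated interval between [v i] and [w i] would have a copy on the other
   side of the point, hence disjoint from it, against [disjoint_iso]. *)
Lemma bf_near n (v w : 'I_n -> N) i : bf b2 v w -> near (v i) (w i).
Proof.
move=> vw.
have key x y : vN x < vN y -> ~ iso g (Some x, Some y) ->
    (vN (v i) <= vN x /\ vN y <= vN (w i)) \/ (vN (w i) <= vN x /\ vN y <= vN (v i)) -> False.
  move=> xy nxy H; pose w' : 'I_(2 + n) -> N := vcons x (vcons y w).
  have ww' : extends w' w.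
    by apply/extendsS; exists x, (vcons y w); split=> //; apply: extends_vcons.
  have bb : olt b1 b2 by apply/olt_osucc/ole_refl.
  have [v' vv' H'] := bf_step bb vw ww'.
  move: vv' => /extendsS[x' [v1 [v'E /extendsP[y' v1E]]]]; subst v' v1.
  pose i0 : 'I_(2 + n) := ord0; pose i1 : 'I_(2 + n) := lift ord0 ord0.
  pose i2 : 'I_(2 + n) := lift ord0 (lift ord0 i).
  have [E0 E1 E2] : [/\ w' i0 = x, w' i1 = y & w' i2 = w i].
    by rewrite /w' /i0 /i1 /i2 !vcons0 !vconsS vcons0.
  have [F0 F1 F2] : [/\ vcons x' (vcons y' v) i0 = x', vcons x' (vcons y' v) i1 = y'
      & vcons x' (vcons y' v) i2 = v i].
    by rewrite /i0 /i1 /i2 !vcons0 !vconsS vcons0.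
  have q := bf_qfa H'.
  have xy' : vN x' < vN y'.
    by have := (q i0 i1).2; rewrite E0 E1 F0 F1 => Q; exact: (Q.1 xy).
  have T : tpe g (Some x', Some y') (Some x, Some y).
    apply: ile_tpe => //.
    by have := @bf_ile _ _ _ linN linN _ _ _ (Some i0) (Some i1) H'; rewrite /= E0 E1 F0 F1.
  (* If [(x, y)] lies left of [w i], its copy [(x', y')] lies left of [v i], whereas [(x, y)] lies
     right of [v i]. The other case is the mirror image. *)
  case: H => -[H1 H2].
    have yv : vN y' <= vN (v i).
      by have := @le_qfa _ _ _ i1 i2 q; rewrite E1 E2 F1 F2; apply.
    apply: nxy; have [p p1 p2] : iso g (Some x', Some y').
      by apply: disjoint_iso T => //; apply: le_trans yv H1.
    by exists p => //; apply/T.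
  have vx : vN (v i) <= vN x'.
    by have := @le_qfa _ _ _ i2 i0 q; rewrite E0 E2 F0 F2; apply.
  apply: nxy; apply: disjoint_iso (tpe_sym T) => //.
  exact: le_trans H2 vx.
have get a b : vN a < vN b -> ~ her g (Some a, Some b) -> exists x y,
    [/\ vN x < vN y, ~ iso g (Some x, Some y), vN a <= vN x & vN y <= vN b].
  move=> ab /(her_not (ab : lo (itv (Some a) (Some b)) < hi (itv (Some a) (Some b)))).
  move=> [[l u] []]; rewrite /lo /hi /=.
  case: l => [x|]; last by rewrite leNgt vN_gt0.
  case: u => [y|]; last by move=> _; rewrite leNgt vN_lt1.
  by move=> ? ? ? ?; exists x, y.
have [H|H|H] := slt_total linN (v i) (w i).
- constructor 2; split=> //; apply: contrapT => /(get _ _ H)[x [y [xy nxy vx yw]]].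
  by apply: (key x y xy nxy); left.
- by constructor 1.
- constructor 3; split=> //; apply: contrapT => /(get _ _ H)[x [y [xy nxy vx yw]]].
  by apply: (key x y xy nxy); right.
Qed.

(** [absorb] finds omega copies of [(a, b)] at the beginning of [(a, oo)]. Each [(a, y n)] is
    hereditarily isolated and [(a, c)] is not, so every [y n] lies before [c]. The copies thus begin
    [(a, c)] as well, and [beq_shift] drops the first one. *)
Lemma absorbR a b c : slt a b -> her g (Some a, Some b) ->
  tpe g (Some a, None) (Some b, None) -> vN a < hi (itv None c) -> ~ her g (Some a, c) ->
  vN b < hi (itv None c) /\ beq (itv (Some a) c) (itv (Some b) c).
Proof.
move=> ab hab T ac nac.
have far y : vN a < vN y -> her g (Some a, Some y) -> vN y < hi (itv None c).
  move=> ay hay; rewrite ltNge; apply/negP => cy; apply: nac; apply: her_sub hay _.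
  exact: bnd_sub.
split; first exact: far.
have sab : sp (itv (Some a) None) (itv (Some a) (Some b)) (itv (Some b) None).
  by apply: sp_mid => //; rewrite /hi /= vN_lt1.
have [V [e [[V1 V2] V0 e0 VB he]]] := absorb sab hab T.
have ex n : exists y : N, V n = (Some y, None).
  elim: n => [|n [y Vn]]; first by exists a.
  by have := V1 n; rewrite Vn => -[x [_ _ ->]]; exists x.
pose y n := projT1 (cid (ex n)); have yP n : V n = (Some (y n), None) := projT2 (cid (ex n)).
have eP n : e n = (Some (y n), Some (y n.+1)).
  by have := V1 n; rewrite !yP => -[x [_ -> [xE]]]; rewrite xE.
have ylt n : vN (y n) < vN (y n.+1).
  by have := V1 n; rewrite !yP => -[x [/inIP[lx _] _ [->]]]; exact: lx.
have ya : y 0%N = a by have := yP 0%N; rewrite V0 => -[].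
have yb : y 1%N = b by have := yP 1%N; rewrite VB => -[].
have hay n : vN a < vN (y n.+1) /\ her g (Some a, Some (y n.+1)).
  elim: n => [|n [ayn IH]]; first by rewrite yb; split.
  split; first exact: lt_trans ayn (ylt _).
  apply: her_sp (_ : sp _ (itv (Some a) (Some (y n.+1))) _) IH (he n.+1).
  by rewrite eP; apply: sp_mid; [exact: ayn|exact: ylt].
have yc n : vN (y n) < hi (itv None c).
  by case: n => [|n]; [rewrite ya|have [h1 h2] := hay n; apply: far].
have om : omega_sum (fun n => itv (Some (y n)) c) e.
  by split=> // n; rewrite eP; apply: sp_mid; [exact: ylt|exact: yc].
by have := beq_shift om; rewrite ya yb.
Qed.

Lemma absorbL a b c : slt b a -> her g (Some b, Some a) ->
  tpe g (None, Some a) (None, Some b) -> lo (itv c None) < vN a -> ~ her g (c, Some a) ->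
  lo (itv c None) < vN b /\ beq (itv c (Some a)) (itv c (Some b)).
Proof.
move=> ba hba T ca nca.
have far y : vN y < vN a -> her g (Some y, Some a) -> lo (itv c None) < vN y.
  move=> ya hya; rewrite ltNge; apply/negP => yc; apply: nca; apply: her_sub hya _.
  exact: bnd_sub.
split; first exact: far.
have sba : sp (itv None (Some a)) (itv None (Some b)) (itv (Some b) (Some a)).
  by apply: sp_mid => //; rewrite /lo /= vN_gt0.
have [V [e [[V1 V2] V0 e0 VB he]]] :=
  (* In the reversed order the copies run to the left, starting from [a]. *)
  @absorb (opp IN) (gopp g) (itv None (Some a)) (itv (Some b) (Some a)) (itv None (Some b))
    sba ((her_opp g _).2 hba) T.
have ex n : exists y : N, V n = (None, Some y).
  elim: n => [|n [y Vn]]; first by exists a.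
  by have := V1 n; rewrite Vn => -[x [_ -> _]]; exists x.
pose y n := projT1 (cid (ex n)); have yP n : V n = (None, Some (y n)) := projT2 (cid (ex n)).
have eP n : e n = (Some (y n.+1), Some (y n)).
  by have := V1 n; rewrite !yP => -[x [_ [xE] ->]]; rewrite xE.
have ylt n : vN (y n.+1) < vN (y n).
  by have := V1 n; rewrite !yP => -[x [/inIP[_ xu] [->] _]]; exact: xu.
have ya : y 0%N = a by have := yP 0%N; rewrite V0 => -[].
have yb : y 1%N = b by have := yP 1%N; rewrite VB => -[].
have hya n : vN (y n.+1) < vN a /\ her g (Some (y n.+1), Some a).
  elim: n => [|n [ayn IH]]; first by rewrite yb; split.
  split; first exact: lt_trans (ylt _) ayn.
  have := (her_opp g _).1 (he n.+1); rewrite eP => hn.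
  apply: her_sp (_ : sp _ (itv (Some (y n.+2)) (Some (y n.+1))) _) hn IH.
  by apply: sp_mid => //=; apply: ylt.
have cy n : lo (itv c None) < vN (y n).
  by case: n => [|n]; [rewrite ya|have [h1 h2] := hya n; apply: far].
have om : @omega_sum (opp IN) (fun n => itv c (Some (y n))) e.
  by split=> // n; rewrite eP; apply: sp_mid; [exact: cy|exact: ylt].
by have := beq_shift om; rewrite ya yb => /beq_opp.
Qed.

Lemma moveR a b c : near a b -> tpe g (Some a, None) (Some b, None) ->
  vN a < hi (itv None c) -> ~ her g (Some a, c) ->
  [/\ vN b < hi (itv None c), ~ her g (Some b, c) & beq (itv (Some a) c) (itv (Some b) c)].
Proof.
move=> [<-|[ab hab]|[ba hba]] T ac nac; first by split=> //; apply: beq_refl.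
  have [bc H] := absorbR ab hab T ac nac; split=> // hbc; apply: nac.
  exact: her_sp (sp_mid (ab : lo (itv (Some a) c) < vN b) bc) hab hbc.
have bc : vN b < hi (itv None c) by apply: lt_trans ac.
have nbc : ~ her g (Some b, c).
  move=> H; apply: nac; apply: her_sub H _; apply: bnd_sub => //.
  by rewrite /lo /= ltW.
split=> //; apply: beq_sym.
by have [] := absorbR ba hba (tpe_sym T) bc nbc.
Qed.

Lemma moveL a b c : near a b -> tpe g (None, Some a) (None, Some b) ->
  lo (itv c None) < vN a -> ~ her g (c, Some a) ->
  [/\ lo (itv c None) < vN b, ~ her g (c, Some b) & beq (itv c (Some a)) (itv c (Some b))].
Proof.
move=> [<-|[ab hab]|[ba hba]] T ca nca; first by split=> //; apply: beq_refl.
  have cb : lo (itv c None) < vN b by apply: lt_trans ca ab.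
  have ncb : ~ her g (c, Some b).
    move=> H; apply: nca; apply: her_sub H _; apply: bnd_sub => //.
    by rewrite /hi /= ltW.
  split=> //; apply: beq_sym.
  by have [] := absorbL ab hab (tpe_sym T) cb ncb.
have [cb H] := absorbL ba hba T ca nca; split=> // hcb; apply: nca.
exact: her_sp (@sp_mid c b (Some a) cb ba) hcb hba.
Qed.

Definition matched n (v w : 'I_n -> N) := qfa v w /\ forall l r : option 'I_n,
  lo (itv (omap v l) (omap v r)) < hi (itv (omap v l) (omap v r)) ->
  beq (itv (omap v l) (omap v r)) (itv (omap w l) (omap w r)).

Lemma bf_matched n (v w : 'I_n -> N) : bf b2 v w -> matched v w.
Proof.
move=> vw; split=> [|l r lh]; first exact: bf_qfa vw.
have T := bf_tpe vw lh.
have [h|nh] := pselect (her g (itv (omap v l) (omap v r))); first exact: her_beq h T.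
case: l r {T} lh nh => [l|] [r|] /= lh nh.
(* The left end moves first, from [v l] to [w l]; then the right end moves, with the new left end
   fixed. *)
- have [bc nb E] := @moveR _ _ (Some (v r)) (bf_near l vw) (@bf_tpe _ _ _ (Some l) None vw (vN_lt1 _)) lh nh.
  have [_ _ E'] := @moveL _ _ (Some (w l)) (bf_near r vw) (@bf_tpe _ _ _ None (Some r) vw (vN_gt0 _)) bc nb.
  exact: beq_trans E E'.
- by have [] := @moveR _ _ None (bf_near l vw) (@bf_tpe _ _ _ (Some l) None vw (vN_lt1 _)) lh nh.
- by have [] := @moveL _ _ None (bf_near r vw) (@bf_tpe _ _ _ None (Some r) vw (vN_gt0 _)) lh nh.
- exact: beq_refl.
Qed.

Lemma matched_sym n (v w : 'I_n -> N) : matched v w -> matched w v.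
Proof.
move=> [q H]; have q' := qfa_sym q; split=> // l r lh; apply: beq_sym; apply: H.
exact: bf_lt q' lh.
Qed.

Lemma matched_comp m n (e : 'I_m -> 'I_n) (v w : 'I_n -> N) : matched v w ->
  matched (fun i => v (e i)) (fun i => w (e i)).
Proof.
move=> [q H]; split=> [|l r lh]; first exact: qfa_comp q.
have E (u : 'I_n -> N) o : omap (fun i => u (e i)) o = omap u (omap e o) by case: o.
by move: lh; rewrite !E; apply: H.
Qed.

Lemma closest_left n (v : 'I_n -> N) x : exists l : option 'I_n,
  lo (itv (omap v l) None) < vN x /\ forall i, vN (v i) < vN x ->
    exists2 j, l = Some j & vN (v i) <= vN (v j).
Proof.
have [[i0 Hi0]|H] := pselect (exists i, vN (v i) < vN x); last first.
  exists None; split; first exact: vN_gt0.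
  by move=> i Hi; case: H; exists i.
case: (@Order.TotalTheory.arg_maxP _ _ _ i0 (fun i => vN (v i) < vN x) (fun i => vN (v i)) Hi0).
move=> j Hj Hmax; exists (Some j); split=> // i /Hmax Hi.
by exists j.
Qed.

Lemma closest_right n (v : 'I_n -> N) x : exists r : option 'I_n,
  vN x < hi (itv None (omap v r)) /\ forall i, vN x < vN (v i) ->
    exists2 j, r = Some j & vN (v j) <= vN (v i).
Proof.
have [[i0 Hi0]|H] := pselect (exists i, vN x < vN (v i)); last first.
  exists None; split; first exact: vN_lt1.
  by move=> i Hi; case: H; exists i.
case: (@Order.TotalTheory.arg_minP _ _ _ i0 (fun i => vN x < vN (v i)) (fun i => vN (v i)) Hi0).
move=> j Hj Hmin; exists (Some j); split=> // i /Hmin Hi.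
by exists j.
Qed.

Lemma omap_vcons n (v w : 'I_n -> N) x y (o : option 'I_n.+1) :
  (omap (vcons x v) o = Some x /\ omap (vcons y w) o = Some y) \/
  exists o' : option 'I_n, omap (vcons x v) o = omap v o' /\ omap (vcons y w) o = omap w o'.
Proof.
case: o => [i|]; last by right; exists None.
case: (unliftP ord0 i) => [j ->|->].
  by right; exists (Some j); rewrite /= !vconsS.
by left; rewrite /= !vcons0.
Qed.

(** Only the gap around [x] is played. An interval from a farther point to [x] is the sum of a
    matched interval ending at a neighbour of [x] and a part of that gap, so [beq_sp] applies. *)
Lemma matched_forth n (v w : 'I_n -> N) : matched v w ->
  forall x, exists y, matched (vcons x v) (vcons y w).
Proof.
move=> vw x; have [[i vi]|nx] := pselect (exists i, v i = x).
  exists (w i).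
  have E (u : 'I_n -> N) : vcons (u i) u = fun j => u (vcons i id j).
    by apply/funext => j; rewrite /vcons; case: unlift.
  by rewrite -vi !E; apply: matched_comp.
have [qv H] := vw.
have [l [lx Hl]] := closest_left v x; have [r [xr Hr]] := closest_right v x.
have lr : lo (itv (omap v l) (omap v r)) < hi (itv (omap v l) (omap v r)).
  exact: lt_trans lx xr.
have [+ _] := beq_bisim (H l r lr); move=> /(_ _ _ (@sp_mid (omap v l) x (omap v r) lx xr)).
move=> [A' [B' [[y [/inIP[/= ly yr] -> ->]] /= Ex Ey]]]; exists y.
have xv i : vN x <> vN (v i) by move=> /vN_inj E; apply: nx; exists i.
have lty i : vN (v i) < vN x <-> vN (w i) < vN y.
  have dir : vN (v i) < vN x -> vN (w i) < vN y.
    move=> /Hl[j lE vij]; apply: le_lt_trans (le_qfa qv vij) _.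
    by move: ly; rewrite lE.
  split=> // wy; have [//|xvi|E] := ltgtP (vN (v i)) (vN x); last by case: (xv i).
  have [j rE vji] := Hr _ xvi.
  have yw : vN y < vN (w i).
    by apply: lt_le_trans (le_qfa qv vji); move: yr; rewrite rE.
  by have := lt_trans wy yw; rewrite ltxx.
have gty i : vN x < vN (v i) -> vN y < vN (w i).
  move=> /Hr[j rE vji]; apply: lt_le_trans (le_qfa qv vji).
  by move: yr; rewrite rE.
have yw i : vN y <> vN (w i).
  move=> E; have [vx|xvi|Ex'] := ltgtP (vN (v i)) (vN x); last by case: (xv i).
    by have := (lty i).1 vx; rewrite E ltxx.
  by have := gty i xvi; rewrite E ltxx.
have gty' i : vN x < vN (v i) <-> vN y < vN (w i).
  split; first exact: gty; move=> ywi; have [vx|//|E] := ltgtP (vN (v i)) (vN x).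
    by have := lt_trans ywi ((lty i).1 vx); rewrite ltxx.
  by case: (xv i).
split.
  move=> i j; case: (unliftP ord0 i) => [i' ->|->]; case: (unliftP ord0 j) => [j' ->|->];
    rewrite ?vcons0 ?vconsS.
  - exact: qv.
  - split; last exact: lty.
    by split=> E; [case: (xv i'); rewrite E|case: (yw i'); rewrite E].
  - split; last exact: gty'.
    by split=> E; [case: (xv j'); rewrite E|case: (yw j'); rewrite E].
  - by split; split=> // /ltNE; rewrite ltxx.
have left_part (o : option 'I_n) : lo (itv (omap v o) None) < vN x ->
    beq (itv (omap v o) (Some x)) (itv (omap w o) (Some y)).
  move=> ox; have [oE|ol] : omap v o = omap v l \/ lo (itv (omap v o) None) < lo (itv (omap v l) None).
  - case: o ox => [i|] ox.
      have [j lE] := Hl _ ox; rewrite lE le_eqVlt => /orP[/eqP/vN_inj E|]; last by right.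
      by left; rewrite /= E.
    case: (l) => [j|]; last by left.
    by right; apply: vN_gt0.
  - have -> : omap w o = omap w l.
      case: (o) (l) oE => [i|] [j|] //= [E].
      by rewrite ((qv i j).1.1 E).
    by rewrite oE.
  case lE : l ol => [j|]; last first.
    by rewrite /lo /= ltNge; case: (o) => [i|]; rewrite ?lexx// ltW ?vN_gt0.
  move=> ov; have oj : lo (itv (omap v o) (omap v (Some j))) < hi (itv (omap v o) (omap v (Some j))).
    exact: ov.
  have oj' := bf_lt qv oj.
  rewrite lE /= in lx ly Ex.
  exact: beq_sp (@sp_mid (omap v o) (v j) (Some x) ov lx)
    (@sp_mid (omap w o) (w j) (Some y) oj' ly) (H o (Some j) oj) Ex.
have right_part (o : option 'I_n) : vN x < hi (itv None (omap v o)) ->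
    beq (itv (Some x) (omap v o)) (itv (Some y) (omap w o)).
  move=> ox; have [oE|ol] : omap v o = omap v r \/ hi (itv None (omap v r)) < hi (itv None (omap v o)).
  - case: o ox => [i|] ox.
      have [j rE] := Hr _ ox; rewrite rE le_eqVlt => /orP[/eqP/vN_inj E|]; last by right.
      by left; rewrite /= E.
    case: (r) => [j|]; last by left.
    by right; apply: vN_lt1.
  - have -> : omap w o = omap w r.
      case: (o) (r) oE => [i|] [j|] //= [E].
      by rewrite ((qv i j).1.1 E).
    by rewrite oE.
  case rE : r ol => [j|]; last first.
    by rewrite /hi /= ltNge; case: (o) => [i|]; rewrite ?lexx// ltW ?vN_lt1.
  move=> ov; have oj : lo (itv (omap v (Some j)) (omap v o)) < hi (itv (omap v (Some j)) (omap v o)).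
    exact: ov.
  have oj' := bf_lt qv oj.
  rewrite rE /= in xr yr Ey.
  exact: beq_sp (@sp_mid (Some x) (v j) (omap v o) xr ov)
    (@sp_mid (Some y) (w j) (omap w o) yr oj') Ey (H (Some j) o oj).
move=> o o'.
case: (omap_vcons v w x y o) => [[-> ->]|[p [-> ->]]];
  case: (omap_vcons v w x y o') => [[-> ->]|[p' [-> ->]]].
- by rewrite /lo /hi /= ltxx.
- exact: right_part.
- exact: left_part.
- exact: H.
Qed.

Lemma matched_back n (v w : 'I_n -> N) : matched v w ->
  forall y, exists x, matched (vcons x v) (vcons y w).
Proof.
move=> /matched_sym vw y; have [x /matched_sym H] := matched_forth vw y.
by exists x.
Qed.

Lemma matched_extend k n (v w : 'I_n -> N) (w' : 'I_(k + n) -> N) : matched v w ->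
  extends w' w -> exists2 v' : 'I_(k + n) -> N, extends v' v & matched v' w'.
Proof.
elim: k w' => [|k IH] w' vw.
  by move=> /extends0 ->; exists v => //; apply: extends_refl.
move=> /extendsS[y [u [-> uw]]]; have [v' vv' H] := IH u vw uw.
have [x Hx] := matched_back H y.
by exists (vcons x v') => //; apply/extendsS; exists x, v'.
Qed.

Lemma matched_bf (a : ord) n (v w : 'I_n -> N) : matched v w -> bf a v w.
Proof.
elim: a n v w => J f IH n v w vw; split; first by case: vw.
move=> j k w' ww'; have [v' vv' H] := matched_extend vw ww'.
by exists v' => //; apply: IH; apply: matched_sym.
Qed.

Lemma generic_scott d : olt (osucc b2) d -> has_Pi_scott_sentence d N.
Proof.
move=> bd; apply: scott_homogeneous bd _ _.
- exact: N_countable.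
- apply/ole_osucc; apply: ole_olt (_ : olt (osucc (beta S)) _); last first.
    by apply/olt_osucc/ole_refl.
  by case: (osucc (beta S)) => J f [].
- move=> n v w /bf_matched vw x; have [y H] := matched_forth vw x.
  by exists y; apply: matched_bf.
- move=> n v w /bf_matched vw y; have [x H] := matched_back vw y.
  by exists x; apply: matched_bf.
Qed.

End Homogeneous.

(** * The downward Löwenheim-Skolem theorem *)

Section Skolem.
Variables (M : structure) (x0 : M).

(** Skolem functions take lists, so that one countable family covers all arities. *)
Definition fclosed (F : nat -> seq M -> M) (D : structure) (emb : D -> M) :=
  forall i s, exists d, emb d = F i [seq emb x | x <- s].

Definition elem n (phi : formula n) (F : nat -> seq M -> M) :=
  forall (D : structure) (emb : D -> M), injective emb ->
  (forall x y, slt x y <-> slt (emb x) (emb y)) -> fclosed F emb ->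
  forall v : 'I_n -> D, sat phi v <-> sat phi (fun i => emb (v i)).

Lemma skolem_join n (J : countType) (G : J -> formula n) :
  (forall j, exists F, elem (G j) F) -> exists F, forall j, elem (G j) F.
Proof.
move=> H; pose F j := projT1 (cid (H j)).
exists (fun i => if unpickle i is Some (j, m) then F j m else fun=> x0).
move=> j D emb inj hs cl; apply: (projT2 (cid (H j)) D emb inj hs) => i s.
by have [d Hd] := cl (pickle (j, i)) s; exists d; rewrite Hd pickleK.
Qed.

Lemma skolem_witness n (P : ('I_n.+1 -> M) -> Prop) : exists f : seq M -> M,
  forall v : 'I_n -> M, (exists x, P (vcons x v)) ->
    P (vcons (f [seq v i | i <- enum 'I_n]) v).
Proof.
pose val_of s : 'I_n -> M := fun i => nth x0 s i.
exists (fun s => if pselect (exists x, P (vcons x (val_of s))) is left H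
  then projT1 (cid H) else x0) => v.
have -> : val_of [seq v i | i <- enum 'I_n] = v.
  by apply/funext => i; rewrite /val_of (nth_map i) ?size_enum_ord// nth_ord_enum.
by move=> Hv; case: pselect => // H; exact: (projT2 (cid H)).
Qed.

Lemma skolem_cons n (phi : formula n.+1) F f :
  elem phi F -> exists F', elem phi F' /\ forall (D : structure) (emb : D -> M), fclosed F' emb ->
    forall s, exists d, emb d = f [seq emb x | x <- s].
Proof.
move=> HF; exists (fun i => if i is j.+1 then F j else f); split.
  by move=> D emb inj hs cl; apply: HF => // i s; exact: (cl i.+1 s).
by move=> D emb cl s; exact: (cl 0 s).
Qed.

Lemma emb_vcons n (D : structure) (emb : D -> M) x (v : 'I_n -> D) :
  (fun i => emb (vcons x v i)) = vcons (emb x) (fun i => emb (v i)).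
Proof. by apply/funext => i; rewrite /vcons; case: unlift. Qed.

Lemma skolem n (phi : formula n) : exists F, elem phi F.
Proof.
elim: phi => {n} [n i j|n i j|n phi [F IH]|n J G IH|n J G IH|n phi [F IH]|n phi [F IH]].
- by exists (fun _ _ => x0) => D emb inj _ _ v /=; split=> [->|/inj].
- by exists (fun _ _ => x0) => D emb _ hs _ v /=; apply: hs.
- by exists F => D emb inj hs cl v /=; rewrite (IH D emb inj hs cl).
- have [F HF] := skolem_join IH; exists F => D emb inj hs cl v /=.
  by split=> H j; apply/(HF j D emb inj hs cl).
- have [F HF] := skolem_join IH; exists F => D emb inj hs cl v /=.
  by split=> -[j H]; exists j; apply/(HF j D emb inj hs cl).
- have [f Hf] := skolem_witness (fun v => sat phi v).
  have [F' [HF' cf]] := skolem_cons f IH; exists F' => D emb inj hs cl v /=.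
  split=> [[x /(HF' D emb inj hs cl)]|/Hf].
    by rewrite emb_vcons => H; exists (emb x).
  have [d] := cf D emb cl [seq v i | i <- enum 'I_n]; rewrite -map_comp => <- H.
  by exists d; apply/(HF' D emb inj hs cl); rewrite emb_vcons.
- have [f Hf] := skolem_witness (fun v => ~ sat phi v).
  have [F' [HF' cf]] := skolem_cons f IH; exists F' => D emb inj hs cl v /=.
  split=> H x; last by apply/(HF' D emb inj hs cl); rewrite emb_vcons.
  apply: contrapT => nx; have := Hf (fun i => emb (v i)) (ex_intro _ x nx).
  have [d] := cf D emb cl [seq v i | i <- enum 'I_n]; rewrite -map_comp => <-; apply.
  by have /(HF' D emb inj hs cl) := H d; rewrite emb_vcons.
Qed.

End Skolem.

Lemma lowenheim_skolem (M : structure) (T : sentence) : models M T ->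
  exists D : structure, countable_structure D /\ models D T.
Proof.
move=> MT; have [x0] := dom_inh M; have [F HF] := skolem x0 T.
pose ev := fix ev (t : GenTree.tree nat) : M := match t with
  | GenTree.Leaf _ => x0 | GenTree.Node i ts => F i [seq ev t | t <- ts] end.
(* Trees name the elements of the Skolem hull. Keeping only the name of least code for each element
   replaces a quotient. *)
pose least t := `[< forall t', ev t' = ev t -> (pickle t <= pickle t')%N >].
have rep t : exists d : {t | least t}, ev (val d) = ev t.
  have H : exists i, `[< exists2 t', pickle t' = i & ev t' = ev t >].
    by exists (pickle t); apply/asboolP; exists t.
  case: (ex_minnP H) => m /asboolP[t' t'm Et'] Hm.
  have Lt' : least t'.
    apply/asboolP => t2 Et2; rewrite t'm; apply: Hm; apply/asboolP; exists t2 => //.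
    by rewrite Et2.
  by exists (exist _ t' Lt').
have [d0 _] := rep (GenTree.Leaf 0).
pose D := @Structure {t | least t} (fun x y => slt (ev (val x)) (ev (val y))) (inhabits d0).
exists D; split; first exact: (@countableP {t | least t}).
pose emb (d : D) : M := ev (val (d : {t | least t})).
have inj : injective emb.
  move=> [t Lt] [t' Lt'] E; apply: val_inj => /=.
  apply: (pcan_inj (@pickleK _)); apply/eqP; rewrite eqn_leq.
  by move/asboolP: (Lt) => ->//; move/asboolP: (Lt') => ->.
move=> v; apply/(HF D emb inj) => // i s.
have [d Hd] := rep (GenTree.Node i [seq val (x : {t | least t}) | x <- s]).
by exists d; rewrite [LHS]Hd /= -map_comp.
Qed.

(** * Existence of the Scott rank and the final construction *)

Lemma least_ord (P : ord -> Prop) c0 : P c0 ->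
  exists c, [/\ P c, ole c c0 & forall d, P d -> ole c d].
Proof.
elim: (olt_wf c0) => {}c0 _ IH Pc0.
have [[d [dc Pd]]|H] := pselect (exists d, olt d c0 /\ P d).
  by have [c [? cd ?]] := IH d dc Pd; exists c; split=> //; apply: ole_trans cd (oltW dc).
exists c0; split=> // [|d Pd]; first exact: ole_refl.
by have [//|dc] := ole_total c0 d; case: H; exists d.
Qed.

Lemma size_gapsof (M : structure) (linM : linear_order M) (I : oint linM) t :
  size (gapsof I t) = (size t).+1.
Proof. by elim: t I => //= y t IH I; rewrite IH. Qed.

Theorem theorem5p2 (alpha : ord) (T : sentence)
    (alpha_ge1 : ole oone alpha)
    (T_E : isE alpha T)
    (T_sat : satisfiable T)
    (T_lin : forall M : structure, models M T -> linear_order M) :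
  exists B : structure,
    countable_structure B /\
    linear_order B /\
    models B T /\
    has_Pi_scott_sentence (osucc (osucc (osucc alpha))) B /\
    (exists c : ord, is_scott_rank B c /\ ole c (osucc (osucc alpha))).
Proof.
have [M0 /lowenheim_skolem[M [cM MT]]] := T_sat.
have linM := T_lin M MT; have [x0] := dom_inh M.
pose v0 (i : 'I_0) : M := x0.
have [b [k [u [e [ba _ HN]]]]] := classes_witnessed.2.1 _ _ _ T_E _ _ (MT v0).
pose full : oint linM := (None, None).
(* The point [x0] is added because the tuple [u] may be empty and the new order must have a
   point. *)
have [t ct ut] := chain_exists full (x0 :: [seq u i | i <- enum 'I_k]).
have [en Hen] := countable_enum cM.
have [eX HeX] : exists eX : nat -> oint linM, forall I, exists i, eX i = I.
  pose oe := omap en.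
  have Hoe c : exists o, oe o = c.
    case: c => [x|]; last by exists None.
    by have [i <-] := Hen x; exists (Some i).
  exists (fun i => if unpickle i is Some (a, a') then (oe a, oe a') else full) => -[l r].
  have [a <-] := Hoe l; have [a' <-] := Hoe r.
  by exists (pickle (a, a')); rewrite pickleK.
have [eM HeM] := free_enum HeX; have [dl Hdl] := desc_enum b.
pose S := @Setting (free (oint linM)) (@Mul _) (@free_mul _) eM HeM b dl Hdl.
(* The initial condition promises the gaps of [M] cut out by [t]. It is obtained by labelling all of
   [0, 1) with the sum of [L] and spreading this label. *)
pose L : seq S := [seq Base J | J <- gapsof full t].
have L0 : L <> [::] by rewrite /L; case: (t).
pose A := sumK (@mul S) (eM 0) L.
have W0 : wf ([::] ++ (0%R, A) :: [::] : state S).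
  by rewrite /wf /srt /pts /= ?lexx ?ltr01 ?inE ?eqxx.
have [s0 [W _ sL _]] := @ext_spread S (@mul S) (@mulP S) (eM 0) b [::] 0%R A [::] 1%R L L0
  (ile_refl _ _) W0 ltr01 (lexx _) isT.
rewrite cats0 /= in W; have {}W : @wf S s0 := W.
have pt : exists2 x, x \in @pts S s0 & (0 < x)%R.
  have : size s0 = (size t).+1 by rewrite -(size_map snd) sL size_map size_gapsof.
  have : (0 < size t)%N by case: (t) (ut x0 (or_introl erefl)) => // -[].
  case: (s0) W => [|p [|q s]] //=; first by move=> _; case: (size t).
  move=> /and3P[/andP[/andP[pq _] _] /andP[/andP[p0 _] _] _] _ _; exists q.1.
    by rewrite !inE eqxx orbT.
  exact: le_lt_trans p0 pq.
pose N0 := N W pt; pose linN := N_lin W pt.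
pose fullN : oint linN := (None, None).
have rN : ready 0 fullN.
  split; last exact: ltr01; last by rewrite /endp /hi eqxx.
  by rewrite /lo /= st0; have /and3P[] := W.
have qN : q 0 fullN = flatten [seq [:: Base J : S] | J <- gapsof full t].
  rewrite /q st0 gl_all; last first.
    by have /and3P[_ + _] := W; apply: sub_all => p.
  by rewrite sL /L; elim: (gapsof full t) => //= J w ->.
have nn : nonnil [seq [:: Base J : S] | J <- gapsof full t].
  by move=> r /List.in_map_iff[J [<-]].
have [w Nw Hw] := q_groups rN qN nn.
(* A gap of [M] is bisimilar to its formal copy [Base J], which was promised as a lower bound. *)
have Hgap : Forall2 (ile b) (gapsof full t) w.
  elim: (gapsof full t) w Hw {Nw qN nn} => [|J s IH] w Hw.
    by inversion Hw; constructor.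
  inversion Hw as [|J0 ? w' ? [rJ qJ] Hw']; subst; constructor; last exact: IH.
  apply: ile_trans (beq_ile _ (base_beq J)) _.
  by have := c_le rJ; rewrite /c qJ.
have [z Hz tz] := zg_ile_split Nw Hgap ct.
have Hy i : exists y, List.In (u i, y) z.
  apply/tz/ut => //; right; apply/List.in_map_iff; exists i; split=> //.
  have : i \in enum 'I_k by rewrite mem_enum.
  by elim: (enum _) => //= a s IHs; rewrite inE => /orP[/eqP ->|/IHs]; [left|right].
pose u' i := projT1 (cid (Hy i)).
have bu : bf b u u' by apply: zg_bf Hz _ => i; exact: (projT2 (cid (Hy i))).
have NT : models N0 T.
  by move=> v; rewrite (_ : v = fun i => u' (e i)); [exact: HN|apply/funext => -[]].
(* [generic_scott] reaches every level above b + 3, and alpha + 3 is one because b < alpha. *)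
have lt3 : olt (osucc (osucc (osucc b))) (osucc (osucc (osucc alpha))).
  by do 3 (apply/olt_osucc/ole_osucc); exact: ba.
have SS := generic_scott W pt lt3.
exists N0; split; first exact: N_countable.
split; first exact: linN.
do 2 (split; first by []).
have [c [Pc ca Hc]] := @least_ord (fun d => has_Pi_scott_sentence (osucc d) N0) _ SS.
by exists c; split.
Qed.
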